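(* Let $N\ge3$, let $u_0\ge0$ be nontrivial, $u$ the mild solution, and let $g:(0,\infty)\to(0,\infty)$ satisfy $g(t)\to\infty$ and $g(t)/t^{\alpha/2}\to0$ as $t\to\infty$. (a) If $u_0\in L^1(\mathbb{R}^N)$, then $\Phi\in M^{p_c}(\mathbb{R}^N)$ and $\|t^\alpha u(\cdot,t)-\kappa\Phi\|_{M^{p_c}(B_{g(t)})}\to0$ as $t\to\infty$. (b) If moreover $u_0\in L^1(\mathbb{R}^N)\cap L^{p_c}_{\rm loc}(\mathbb{R}^N)$, then $\Phi\in L^{p_c}_{\rm loc}(\mathbb{R}^N)$ and $\|t^\alpha u(\cdot,t)-\kappa\Phi\|_{L^{p_c}(B_{g(t)})}\to0$ as $t\to\infty$.
   Context: Fix $N\ge1$ and $\alpha\in(0,1)$. Let $\mathbb{E}_\alpha(s)=\sum_{k\ge0}s^k/\Gamma(1+k\alpha)$ be the Mittag-Leffler function. The fundamental solution of the time-fractional heat equation $\partial_t^\alpha u=\Delta u$ (where $\partial_t^\alpha$ is the Caputo derivative $\partial_t^\alpha u(x,t)=\frac{1}{\Gamma(1-\alpha)}\partial_t\int_0^t\frac{u(x,\tau)-u(x,0)}{(t-\tau)^\alpha}\,d\tau$) is the function $Z$ on $\mathbb{R}^N\times(0,\infty)$ whose Fourier transform in $x$ is $\widehat Z(\omega,t)=\mathbb{E}_\alpha(-|\omega|^2t^\alpha)$. It has the self-similar form $Z(x,t)=t^{-\alpha N/2}F(xt^{-\alpha/2})$ with a positive radially symmetric profile $F$, smooth on $\mathbb{R}^N\setminus\{0\}$,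 $\int F=1$. For nonnegative nontrivial $u_0\in L^1(\mathbb{R}^N)$ the (mild) solution of $\partial_t^\alpha u=\Delta u$ in $\mathbb{R}^N\times(0,\infty)$, $u(\cdot,0)=u_0$, is $u(x,t)=\int_{\mathbb{R}^N}Z(x-y,t)u_0(y)\,dy$. For $N\ge3$: $p_c=N/(N-2)$, $E_N(\xi)=|\xi|^{2-N}$, and $\kappa=\kappa(N)>0$ is the constant such that $F(\xi)/E_N(\xi)\to\kappa$ as $\xi\to0$. The Newtonian potential of $u_0$ is $\Phi(x)=\int_{\mathbb{R}^N}\frac{u_0(x-y)}{|y|^{N-2}}\,dy$. $B_r$ is the open ball of radius $r$ centered at the origin. For $p\in[1,\infty)$ and a measurable set $\Omega$, the Marcinkiewicz (weak $L^p$) quasi-norm is $\|h\|_{M^p(\Omega)}=\sup_{\lambda>0}\lambda\,|\{x\in\Omega:|h(x)|>\lambda\}|^{1/p}$ and $M^p(\Omega)$ is the space where it is finite. *)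

(* Defs.v *)
From HB Require Import structures.
From mathcomp Require Import all_boot all_order all_algebra.
From mathcomp Require Import all_classical all_reals all_analysis measurable_realfun.
Set Implicit Arguments. Unset Strict Implicit. Unset Printing Implicit Defensive.
Import Order.TTheory GRing.Theory Num.Theory.
Import numFieldNormedType.Exports.
Local Open Scope classical_set_scope.
Local Open Scope ring_scope.

(* Points of R^N are N-tuples of reals, with the product (= Borel) sigma-algebra
   provided by MathComp-Analysis on n.-tuple R. *)
Section Rn.
Variable R : realType.

Definition vsub (N : nat) (x y : N.-tuple R) : N.-tuple R :=
  [tuple tnth x i - tnth y i | i < N].
Definition vdot (N : nat) (x y : N.-tuple R) : R :=
  \sum_(i < N) tnth x i * tnth y i.
Definition enorm (N : nat) (x : N.-tuple R) : R := Num.sqrt (vdot x x).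
Definition ballO (N : nat) (r : R) : set (N.-tuple R) := [set x | enorm x < r].

(* Lebesgue integral on R^N of a nonnegative function, as the iterated
   one-dimensional Lebesgue integral (equal to the N-dimensional Lebesgue
   integral for nonnegative measurable functions by Tonelli). *)
Fixpoint intRN (N : nat) : (N.-tuple R -> \bar R) -> \bar R :=
  match N with
  | 0 => fun f => f [tuple]
  | M.+1 => fun f =>
      (\int[@lebesgue_measure R]_x intRN (fun y : M.-tuple R => f (cons_tuple x y)))%E
  end.

Definition lebN (N : nat) (A : set (N.-tuple R)) : \bar R :=
  intRN (fun x => (\1_A x)%:E).

Definition integrable_RN (N : nat) (f : N.-tuple R -> R) : Prop :=
  measurable_fun [set: N.-tuple R] f /\
  (intRN (fun x => `|f x|%:E) < +oo)%E.
Definition RintN (N : nat) (f : N.-tuple R -> R) : R :=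
  fine (intRN (fun x => (Num.max (f x) 0)%:E))
  - fine (intRN (fun x => (Num.max (- f x) 0)%:E)).

Definition Gamma (s : R) : R :=
  fine (\int[@lebesgue_measure R]_(x in `]0%R, +oo[%classic)
          ((x `^ (s - 1)) * expR (- x))%:E)%E.
Definition MittagLeffler (a s : R) : R :=
  limn (fun n => \sum_(0 <= k < n) s ^+ k / Gamma (1 + k%:R * a)).

Definition weakLnorm (N : nat) (p : R) (Om : set (N.-tuple R))
    (h : N.-tuple R -> \bar R) : \bar R :=
  ereal_sup [set ((lam%:E) * poweR (lebN [set x | Om x /\ (lam%:E < `|h x|)%E]) p^-1)%E
            | lam in [set lam : R | 0 < lam]].

Definition LpnormN (N : nat) (p : R) (Om : set (N.-tuple R))
    (h : N.-tuple R -> \bar R) : \bar R :=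
  poweR (intRN (fun x => (\1_Om x)%:E * poweR `|h x| p)%E) p^-1.

Definition LplocN (N : nat) (p : R) (h : N.-tuple R -> \bar R) : Prop :=
  measurable_fun [set: N.-tuple R] (fun x => h x) /\
  forall r : R, 0 < r -> (LpnormN p (ballO (N:=N) r) h < +oo)%E.

(* Hypotheses characterising the fundamental solution Z of d_t^a u = Lap u:
   for each t > 0, Z(.,t) is integrable with Fourier transform
   int Z(x,t) e^{-i x.w} dx = E_a(-|w|^2 t^a) (real and imaginary parts),
   and Z(.,t) is continuous on R^N \ {0} (this selects the smooth
   representative, on which pointwise statements such as the definition of
   kappa make sense). *)
Definition fundamental_solution (N : nat) (a : R) (Z : N.-tuple R -> R -> R) : Prop :=
  forall t : R, 0 < t ->
    [/\ integrable_RN (fun x => Z x t),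
        (forall w : N.-tuple R,
           RintN (fun x => Z x t * cos (vdot x w)) = MittagLeffler a (- (enorm w ^+ 2) * t `^ a)),
        (forall w : N.-tuple R, RintN (fun x => Z x t * sin (vdot x w)) = 0) &
        (forall xi : N.-tuple R, 0 < enorm xi -> forall e : R, 0 < e ->
           exists2 d : R, 0 < d & forall y : N.-tuple R,
             enorm (vsub y xi) < d -> `|Z y t - Z xi t| < e)].

Definition kappa_limit (N : nat) (Z : N.-tuple R -> R -> R) (kappa : R) : Prop :=
  forall e : R, 0 < e -> exists2 d : R, 0 < d & forall xi : N.-tuple R,
    0 < enorm xi < d -> `|Z xi 1 * enorm xi ^+ (N - 2) - kappa| < e.

Definition mild_solution (N : nat) (Z : N.-tuple R -> R -> R) (u0 : N.-tuple R -> R)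
    (x : N.-tuple R) (t : R) : R :=
  RintN (fun y => Z (vsub x y) t * u0 y).

Definition newton_potential (N : nat) (u0 : N.-tuple R -> R) (x : N.-tuple R) : \bar R :=
  intRN (fun y => (u0 (vsub x y) / enorm y ^+ (N - 2))%:E).

End Rn.

(* Main.v *)
Require Import Defs.
From HB Require Import structures.
From mathcomp Require Import all_boot all_order all_algebra.
From mathcomp Require Import all_classical all_reals all_analysis measurable_realfun.
From mathcomp Require Import ring lra zify.
Set Implicit Arguments. Unset Strict Implicit. Unset Printing Implicit Defensive.
Import Order.TTheory GRing.Theory Num.Theory.
Import numFieldNormedType.Exports.
Local Open Scope classical_set_scope.
Local Open Scope ring_scope.

(* Let K_2 = 2, let K jump from m to m + 1 with probability a m / n at time n, and given K = m let j be
   m with probability a and uniform on {1, ..., m - 1} otherwise.  Then n^-a j converges to the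
   Mittag-Leffler law, whose Laplace transform is E_a(-s).  So the Fourier transform of Z(.,t) is a
   limit of mixtures of Gaussians exp(-|w|^2 t^a n^-a j), and Z(.,t) is the corresponding limit of
   mixtures of heat kernels.  The uniform part of the law of j produces Riemann sums of the heat kernel
   over its variance, whose integral is a multiple of |x|^(2-N).  The errors are quantitative and give
     |t^a Z(x,t) - kappa |x|^(2-N)| <= K t^(-a/2) |x|^(3-N).
   Hence |t^a u - kappa Phi| <= K t^(-a/2) |.|^(3-N) * u_0, and the L^pc norm of |. - y|^(3-N) on B_r
   is at most a constant times r, uniformly in y; so the L^pc norm on B_g(t) is O(g(t) / t^(a/2)). *)

(** The hypotheses give only the Fourier transform of [Z], with [MittagLeffler] a power series. The
    chain supplies an explicit subordination formula at each finite [n], where every estimate is a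
    finite average; only Gaussian averages of [Z] are passed to the limit, so no limit law has to be
    constructed. The Mittag-Leffler law has a positive density at 0, so its moment of order -1
    diverges, and this is what makes Z singular. Splitting j into K itself and a uniform variable
    below K isolates the divergence: K stays away from 0, with E (n^-a K)^(-3/2) <= 8. As the heat
    kernel at time v is at most C |x|^(3-N) v^(-3/2), this moment is the source of the exponent 3-N
    in the error. The coefficient of |x|^(2-N) at stage n depends on n but not on (x,t). Comparing
    (x,t) with points near the origin at time 1, for the same n, replaces it by kappa, so its
    convergence is never studied. With pc = N/(N-2) one has N - (N-3) pc = pc: the kernel |x|^(3-N)
    is locally in L^pc, while |x|^(2-N) is only in weak L^pc. Hence the strong norm of the
    difference is the one estimated, and (a) follows by Chebyshev. *)

(** * A Markov chain with exact rising-factorial moments *)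

Section chain.
Context {R : realType}.
Variable a : R.

(** Expectation of [f] at time n+2 for the chain that is at 2 at time 2. The recursion peels off the
    last jump, replacing [f] by its one-step average. The state at time n+2 lies between 2 and n+2,
    which keeps the jump probabilities at most 1 and [m.-1] nonzero in [mixE]. *)
Fixpoint chainE (n : nat) (f : nat -> R) : R :=
  if n is n'.+1 then
    chainE n' (fun m => (1 - a * m%:R / n'.+2%:R) * f m + a * m%:R / n'.+2%:R * f m.+1)
  else f 2%N.

Definition mixE (n : nat) (f : nat -> R) : R :=
  chainE n (fun m => a * f m + (1 - a) * ((m.-1)%:R^-1 * \sum_(1 <= j < m) f j)).

Lemma eq_chainE n f g : (forall m, (2 <= m <= n.+2)%N -> f m = g m) ->
  chainE n f = chainE n g.
Proof.
elim: n f g => [|n IH] f g fg /=; first by apply: fg.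
by apply: IH => m hm; rewrite !fg//; lia.
Qed.

Lemma chainED n f g : chainE n (fun m => f m + g m) = chainE n f + chainE n g.
Proof.
elim: n f g => [|n IH] f g //=; rewrite -IH; apply: eq_chainE => m _; ring.
Qed.

Lemma chainEZ n c f : chainE n (fun m => c * f m) = c * chainE n f.
Proof.
elim: n f => [|n IH] f //=; rewrite -IH; apply: eq_chainE => m _; ring.
Qed.

Lemma chainEB n f g : chainE n (fun m => f m - g m) = chainE n f - chainE n g.
Proof.
rewrite chainED; congr +%R; rewrite -mulN1r -chainEZ.
by apply: eq_chainE => m _; rewrite mulN1r.
Qed.

Lemma chainE_cst n c : chainE n (fun=> c) = c.
Proof.
elim: n => [|n IH] //=; rewrite -[RHS]IH; apply: eq_chainE => m _; ring.
Qed.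

Lemma mixED n f g : mixE n (fun m => f m + g m) = mixE n f + mixE n g.
Proof.
by rewrite -chainED; apply: eq_chainE => m _; rewrite big_split/=; ring.
Qed.

Lemma mixEZ n c f : mixE n (fun m => c * f m) = c * mixE n f.
Proof.
by rewrite -chainEZ; apply: eq_chainE => m _; rewrite -mulr_sumr; ring.
Qed.

Lemma mixEB n f g : mixE n (fun m => f m - g m) = mixE n f - mixE n g.
Proof.
rewrite mixED; congr +%R; rewrite -mulN1r -mixEZ; congr mixE.
by apply/funext => m; rewrite mulN1r.
Qed.

Lemma mixE_cst n c : mixE n (fun=> c) = c.
Proof.
rewrite -[RHS](chainE_cst n); apply: eq_chainE => m hm.
rewrite sumr_const_nat subn1 -(mulr_natl c) [_ * (_ * c)]mulrA mulVf; first by ring.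
by rewrite pnatr_eq0; lia.
Qed.

Lemma mixE_sum n (K : nat) (F : nat -> nat -> R) :
  mixE n (fun m => \sum_(k < K) F k m) = \sum_(k < K) mixE n (F k).
Proof.
elim: K => [|K IH].
  rewrite big_ord0 -[RHS](mixE_cst n); congr mixE; apply/funext => m.
  by rewrite big_ord0.
rewrite big_ord_recr/= -IH -mixED; congr mixE; apply/funext => m.
by rewrite big_ord_recr.
Qed.

Hypothesis a01 : 0 < a < 1.

Let a0 : 0 < a. Proof. by case/andP: a01. Qed.
Let a1 : a < 1. Proof. by case/andP: a01. Qed.

Lemma step_prob_le1 (m n : nat) : (m <= n.+2)%N -> a * m%:R / n.+2%:R <= 1.
Proof.
move=> hm; rewrite ler_pdivrMr ?ltr0n// mul1r -[leRHS]mul1r.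
by apply: ler_pM; rewrite ?ler_nat ?ler0n// ltW.
Qed.

Lemma le_chainE n f g : (forall m, (2 <= m <= n.+2)%N -> f m <= g m) ->
  chainE n f <= chainE n g.
Proof.
elim: n f g => [|n IH] f g fg /=; first by apply: fg.
apply: IH => m hm; apply: lerD; apply: ler_wpM2l.
- by rewrite subr_ge0 step_prob_le1//; lia.
- by apply: fg; lia.
- by rewrite divr_ge0// mulr_ge0// ltW.
- by apply: fg; lia.
Qed.

Lemma norm_chainE n f : `|chainE n f| <= chainE n (fun m => `|f m|).
Proof.
rewrite ler_norml -mulN1r -chainEZ; apply/andP; split; apply: le_chainE => m _.
  by rewrite mulN1r lerNl -normrN ler_norm.
exact: ler_norm.
Qed.

Lemma le_mixE n f g : (forall m, (1 <= m <= n.+2)%N -> f m <= g m) ->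
  mixE n f <= mixE n g.
Proof.
move=> fg; apply: le_chainE => m hm; apply: lerD.
  by apply: ler_wpM2l; [exact: ltW|apply: fg; lia].
apply: ler_wpM2l; first by rewrite subr_ge0 ltW.
apply: ler_wpM2l; first by rewrite invr_ge0.
by apply: ler_sum_nat => j hj; apply: fg; lia.
Qed.

Lemma norm_mixE n f c : (forall m, (1 <= m <= n.+2)%N -> `|f m| <= c) ->
  `|mixE n f| <= c.
Proof.
move=> fc; rewrite ler_norml -{1}(mixE_cst n c) -{2}(mixE_cst n c) -mulN1r -mixEZ.
apply/andP; split; apply: le_mixE => m /fc; rewrite ler_norml => /andP[]; rewrite ?mulN1r//.
Qed.

(** The rising factorial j (j+1) ... (j+k-1) / k!, up to sign the coefficient of r^k in (1+r)^-j.
    With the truncated predecessor, the value at j = 0 is 1 for k = 0 and 0 for k > 0, as that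
    expansion requires. *)
Definition rbin (j k : nat) : nat := 'C((j + k).-1, k).

Lemma rbinS j k : rbin j.+1 k.+1 = (rbin j k.+1 + rbin j.+1 k)%N.
Proof. by rewrite /rbin !addSn !addnS /= binS. Qed.

Lemma sum_rbin m k : (\sum_(1 <= j < m.+1) rbin j k)%N = rbin m k.+1.
Proof.
elim: m => [|m IH]; first by rewrite big_geq// /rbin add0n/= bin_small.
by rewrite big_nat_recr//= IH rbinS.
Qed.

Lemma rbin_left m k : (k.+1 * rbin m.+1 k.+1 = m.+1 * rbin m.+2 k)%N.
Proof.
by rewrite /rbin !addSn !addnS/= mul_bin_left subSn ?leq_addl// addnK.
Qed.

(** [rbin _ k] is an eigenfunction of every step: since rbin(m+1,k) = (1 + k/m) rbin(m,k), a jump of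
    probability a m / n multiplies the mean by 1 + a k / n. The factor k+1 is the initial value
    [rbin 2 k]. *)
Lemma chain_moment n k :
  chainE n (fun m => (rbin m k)%:R) = k.+1%:R * \prod_(2 <= i < n.+2) (1 + a * k%:R / i%:R).
Proof.
elim: n => [|n IH].
  by rewrite /= big_geq// mulr1 /rbin add2n/= binSn.
rewrite big_nat_recr//= mulrA -IH mulrC -chainEZ; apply: eq_chainE => m hm.
case: m hm => // m hm; have n0 : n.+2%:R != 0 :> R by rewrite pnatr_eq0.
have -> : ((rbin m.+2 k)%:R = (rbin m.+1 k)%:R + k%:R / m.+1%:R * (rbin m.+1 k)%:R :> R).
  case: k {IH} => [|k]; first by rewrite /rbin !bin0 mul0r mul0r addr0.
  rewrite rbinS natrD; congr +%R.
  apply: (@mulfI _ m.+1%:R); first by rewrite pnatr_eq0.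
  rewrite -natrM -rbin_left natrM mulrA mulrCA mulfV ?pnatr_eq0// mulr1//.
have m0 : m.+1%:R != 0 :> R by rewrite pnatr_eq0.
by move: (_%:R) m0 (_%:R) n0 => x x0 y y0; field; apply/andP.
Qed.

(** The uniform part supplies exactly the missing factor i = 1: the mean of rbin(j,k) over 1 <= j <
    m is rbin(m,k)/(k+1) by the hockey-stick identity, and a + (1-a)/(k+1) = (1 + a k)/(k+1). *)
Lemma mix_moment n k :
  mixE n (fun j => (rbin j k)%:R) = \prod_(1 <= i < n.+2) (1 + a * k%:R / i%:R).
Proof.
rewrite big_ltn// divr1; set P := \prod_(_ <= _ < _) _.
have -> : (1 + a * k%:R) * P = (1 + a * k%:R) / k.+1%:R * (k.+1%:R * P).
  by rewrite mulrA divfK// pnatr_eq0.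
rewrite -chain_moment -chainEZ.
apply: eq_chainE => m hm; case: m hm => // -[//|m] hm /=.
rewrite -natr_sum sum_rbin.
have -> : ((rbin m.+1 k.+1)%:R = m.+1%:R / k.+1%:R * (rbin m.+2 k)%:R :> R).
  apply: (@mulfI _ k.+1%:R); first by rewrite pnatr_eq0.
  by rewrite -natrM rbin_left natrM mulrA mulrCA mulfV ?pnatr_eq0// mulr1.
have m0 : m.+1%:R != 0 :> R by rewrite pnatr_eq0.
have k0 : k.+1%:R != 0 :> R by rewrite pnatr_eq0.
have := @natr1 R k; move: m0 k0; move: (m.+1%:R) (k.+1%:R) (k%:R) => x y z x0 /[swap] <- y0.
by field; rewrite ?x0 ?y0.
Qed.

Lemma rbin_sum_rec (r : R) M j :
  (1 + r) * \sum_(k < M.+1) (- r) ^+ k * (rbin j.+1 k)%:R =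
  \sum_(k < M.+1) (- r) ^+ k * (rbin j k)%:R - (- r) ^+ M.+1 * (rbin j.+1 M)%:R.
Proof.
elim: M => [|M IH].
  by rewrite !big_ord_recr !big_ord0/= /rbin !bin0; ring.
rewrite big_ord_recr [in RHS]big_ord_recr/= mulrDr IH rbinS natrD !exprS; ring.
Qed.

(** Remainder of the binomial series of (1+r)^-j after M terms, with the sign that makes it
    nonnegative for r >= 0. *)
Definition negbin_rem (r : R) M j :=
  (-1) ^+ M * ((1 + r) ^- j - \sum_(k < M) (- r) ^+ k * (rbin j k)%:R).

Lemma negbin_rem_ge0 r M j : 0 <= r -> 0 <= negbin_rem r M j.
Proof.
move=> r0; have r1 : 0 < 1 + r by rewrite ltr_wpDr.
case: M => [|M].
  by rewrite /negbin_rem big_ord0 subr0 expr0 mul1r invr_ge0 exprn_ge0// ltW.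
elim: j => [|j IH].
  rewrite /negbin_rem big_ord_recl big1 ?addr0; last first.
    by move=> i _; rewrite /rbin add0n/= bin_small// mulr0.
  by rewrite /rbin bin0 !expr0 invr1 mulr1 subrr mulr0.
rewrite -(pmulr_rge0 _ r1) /negbin_rem.
have -> : (1 + r) * ((-1) ^+ M.+1 * ((1 + r) ^- j.+1 -
    \sum_(k < M.+1) (- r) ^+ k * (rbin j.+1 k)%:R)) =
  negbin_rem r M.+1 j + r ^+ M.+1 * (rbin j.+1 M)%:R.
  rewrite mulrCA mulrBr rbin_sum_rec /negbin_rem [(1 + r) ^+ j.+1]exprS invfM.
  rewrite [_ * ((1 + r)^-1 * _)]mulrA mulfV ?gt_eqF// mul1r.
  have -> : r ^+ M.+1 = (-1) ^+ M.+1 * (- r) ^+ M.+1 by rewrite -exprMn mulN1r opprK.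
  ring.
by rewrite addr_ge0// mulr_ge0// exprn_ge0.
Qed.

(** The remainders after M and M+1 terms are nonnegative and add up to r^M rbin(j,M); so each is at
    most the first omitted term, even for r where the series diverges. *)
Lemma negbin_taylor (r : R) M j : 0 <= r ->
  `|(1 + r) ^- j - \sum_(k < M) (- r) ^+ k * (rbin j k)%:R| <= r ^+ M * (rbin j M)%:R.
Proof.
move=> r0; have h : negbin_rem r M.+1 j = r ^+ M * (rbin j M)%:R - negbin_rem r M j.
  have -> : r ^+ M = (-1) ^+ M * (- r) ^+ M by rewrite -exprMn mulN1r opprK.
  rewrite /negbin_rem big_ord_recr/= exprS.
  ring.
have -> : `|(1 + r) ^- j - \sum_(k < M) (- r) ^+ k * (rbin j k)%:R| = negbin_rem r M j.
  rewrite -[RHS]ger0_norm ?negbin_rem_ge0// /negbin_rem normrM normrX normrN1 expr1n mul1r//.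
by rewrite -subr_ge0 -h negbin_rem_ge0.
Qed.

(** The bound is uniform in j, so e^(-r j) may be replaced by (1+r)^-j under the mixture. With x =
    1/(1+r) and y = e^-r: x - y <= r^2, x^j - y^j <= j (x-y) x^(j-1), and j r x^(j-1) <= 1. *)
Lemma expR_negbin (r : R) j : 0 <= r <= 1 -> `|(1 + r) ^- j - expR (- r * j%:R)| <= r.
Proof.
move=> /andP[r0 r1]; have r10 : 0 < 1 + r by rewrite ltr_wpDr.
rewrite mulrC expRM_natl.
set x := (1 + r)^-1; set y := expR (- r).
have x0 : 0 < x by rewrite invr_gt0.
have y0 : 0 < y by exact: expR_gt0.
have yx : y <= x by rewrite /y expRN lef_pV2 ?posrE ?expR_gt0// expR_ge1Dx.
have xy : x - y <= r ^+ 2.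
  have : 1 - r <= y by apply: expR_ge1Dx.
  suff : x <= 1 - r + r ^+ 2 by lra.
  rewrite /x -[leLHS]mul1r ler_pdivrMr//; nra.
have ler1 i : (i.+1%:R * r) * x ^+ i <= 1.
  rewrite exprVn ler_pdivrMr ?exprn_gt0// mul1r.
  elim: i => [|i IH]; first by rewrite mul1r expr0.
  have : 1 <= (1 + r) ^+ i by rewrite exprn_ege1// lerDl.
  rewrite exprS -natr1; nra.
rewrite -exprVn -/x ger0_norm; last first.
  by rewrite subr_ge0; apply: lerXn2r => //; rewrite nnegrE ltW.
have xyj i : x ^+ i.+1 - y ^+ i.+1 <= i.+1%:R * (x - y) * x ^+ i.
  elim: i => [|i IH]; first by rewrite !expr0 !expr1 mul1r mulr1.
  have yxi : y ^+ i.+1 <= x ^+ i.+1 by apply: lerXn2r => //; rewrite nnegrE ltW.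
  have := ler_wpM2l (ltW x0) IH; have : 0 <= x - y by rewrite subr_ge0.
  rewrite -[i.+2%:R]natr1 [x ^+ i.+2]exprS [y ^+ i.+2]exprS.
  have -> : x * (i.+1%:R * (x - y) * x ^+ i) = i.+1%:R * (x - y) * x ^+ i.+1.
    by rewrite exprS; ring.
  move: yxi; move: (x ^+ i.+1) (y ^+ i.+1) (i.+1%:R) => X Y c; nra.
case: j => [|j]; first by rewrite !expr0 subrr.
apply: le_trans (xyj j) _; apply: le_trans (_ : j.+1%:R * r ^+ 2 * x ^+ j <= _).
  by rewrite ler_wpM2r ?exprn_ge0 ?(ltW x0)// ler_wpM2l.
have -> : j.+1%:R * r ^+ 2 * x ^+ j = r * (j.+1%:R * r * x ^+ j) by ring.
by rewrite -[leRHS]mulr1 ler_wpM2l.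
Qed.
End chain.

(** * The Gamma function: functional equation, growth, ratio asymptotics *)

Section gamma.
Context {R : realType}.
Notation mu := (@lebesgue_measure R).

Lemma powR_le_tangent (u th : R) : 0 <= u -> 0 <= th <= 1 ->
  u `^ th <= 1 + th * (u - 1).
Proof.
move=> u0 /andP[th0 th1]; move: u0; rewrite le_eqVlt => /predU1P[<-|u0].
  have [->|thn0] := eqVneq th 0; first by rewrite powRr0 mul0r addr0.
  by rewrite powR0// sub0r mulrN1 subr_ge0.
have := convex_expR (Itv01 th0 th1) (ln u) 0.
rewrite !convRE/= lnK ?posrE// expR0 mulr0 addr0 mulr1 /powR gt_eqF// => /le_trans; apply.
by rewrite /unstable.onem; lra.
Qed.

Lemma powR_expR_bound (p x : R) : 0 < p -> 0 <= x ->
  x `^ p <= (2 * p) `^ p * expR (x / 2).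
Proof.
move=> p0 x0; have p20 : 0 < 2 * p by lra.
rewrite -[X in X `^ p](mulVKf (lt0r_neq0 p20)) (powRM _ (ltW p20)); last first.
  by rewrite mulr_ge0// invr_ge0 ltW.
rewrite ler_wpM2l ?powR_ge0//.
move: x0; rewrite le_eqVlt => /predU1P[<-|x0].
  by rewrite mulr0 powR0 ?expR_ge0 ?gt_eqF.
rewrite /powR gt_eqF ?mulr_gt0 ?invr_gt0// ler_expR.
apply: le_trans (_ : p * ((2 * p)^-1 * x) <= _).
  by rewrite ler_pM2l// ltW// ln_sublinear// mulr_gt0 ?invr_gt0.
by rewrite le_eqVlt; apply/orP; left; apply/eqP; field; rewrite gt_eqF.
Qed.

Lemma cvg_powR_expRN (p : R) : 0 < p -> x `^ p * expR (- x) @[x --> +oo] --> 0.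
Proof.
move=> p0; apply: (@squeeze_cvgr _ _ _ _ (fun=> 0) (fun x => (2 * p) `^ p * expR (- (2^-1 * x)))).
- near=> x; rewrite mulr_ge0 ?powR_ge0 ?expR_ge0//=.
  have x0 : 0 <= x by near: x; apply: nbhs_pinfty_ge; rewrite num_real.
  apply: le_trans (ler_wpM2r (expR_ge0 _) (powR_expR_bound p0 x0)) _.
  by rewrite -mulrA -expRD; apply: ler_wpM2l; rewrite ?powR_ge0// ler_expR; lra.
- exact: cvg_cst.
- rewrite -[X in _ --> X](mulr0 ((2 * p) `^ p)); apply: cvgM; first exact: cvg_cst.
  apply: (@cvg_comp _ _ _ (fun x : R => 2^-1 * x) (fun x => expR (- x)) _ (pinfty_nbhs R)); last exact: cvgr_expR.
  exact: gt0_cvgMry.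
Unshelve. all: end_near. Qed.

Definition gamma_int (s : R) : \bar R :=
  (\int[mu]_(x in `]0%R, +oo[%classic) ((x `^ (s - 1)) * expR (- x))%:E)%E.

Lemma measurable_gamma_integrand (s : R) (D : set R) :
  measurable_fun D (fun x => (x `^ s * expR (- x))%:E).
Proof.
apply/measurable_EFinP; apply: measurable_funTS; apply: measurable_funM.
  exact: measurable_powR.
by apply: measurableT_comp => //; apply: measurable_expR.
Qed.

Lemma cvg_right0_powR (p : R) : 0 <= p -> x `^ p @[x --> 0^'+] --> 0 `^ p.
Proof.
rewrite le_eqVlt => /predU1P[<-|p0]; last by rewrite powR0 ?gt_eqF//; exact: powR_cvg0.
by rewrite powRr0; under eq_fun do rewrite powRr0; exact: cvg_cst.
Qed.

Lemma cvg_expRN (x : R) : expR (- y) @[y --> x] --> expR (- x).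
Proof.
by apply: continuous_comp; [exact: opp_continuous|exact: continuous_expR].
Qed.

(** Integration by parts for h(x) = x^s e^-x in the extended reals, so that finiteness is not
    presupposed. Its derivative (s-x) x^(s-1) e^-x changes sign only at s. Cutting the half-line
    there, the fundamental theorem is applied to a nonnegative function on each piece, and the
    boundary value h(s) cancels. *)
Lemma gamma_int_rec (s : R) : 1 <= s -> (gamma_int (s + 1) = s%:E * gamma_int s)%E.
Proof.
move=> s1; have s0 : 0 < s by lra.
have sm1 : 0 <= s - 1 by lra.
rewrite /gamma_int addrK.
pose h (x : R) := x `^ s * expR (- x).
pose k (x : R) := x `^ (s - 1) * expR (- x).
pose f (x : R) := h x - s * k x.
change (\int[mu]_(x in `]0%R, +oo[%classic) (h x)%:E =
  s%:E * \int[mu]_(x in `]0%R, +oo[%classic) (k x)%:E)%E.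
have h0 x : 0 <= h x by rewrite mulr_ge0 ?powR_ge0 ?expR_ge0.
have k0 x : 0 <= k x by rewrite mulr_ge0 ?powR_ge0 ?expR_ge0.
have cpw (p x : R) : 0 < x -> {for x, continuous (fun y : R => y `^ p)}.
  move=> x0; apply: differentiable_continuous; apply/derivable1_diffP.
  by apply: ex_derive; exact: is_derive1_powR.
have ch (x : R) : 0 < x -> {for x, continuous h}.
  by move=> x0; apply: cvgM; [exact: cpw|exact: cvg_expRN].
have ck (x : R) : 0 < x -> {for x, continuous k}.
  by move=> x0; apply: cvgM; [exact: cpw|exact: cvg_expRN].
have cf (x : R) : 0 < x -> {for x, continuous f}.
  by move=> x0; apply: cvgB; [exact: ch|apply: cvgM; [exact: cvg_cst|exact: ck]].
have ch0 : h x @[x --> 0^'+] --> h 0.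
  by apply: cvgM; [exact: cvg_right0_powR (ltW _)|apply/cvg_at_right_filter/cvg_expRN].
have ck0 : k x @[x --> 0^'+] --> k 0.
  by apply: cvgM; [exact: cvg_right0_powR|apply/cvg_at_right_filter/cvg_expRN].
have cf0 : f x @[x --> 0^'+] --> f 0.
  by apply: cvgB => //; apply: cvgM => //; exact: cvg_cst.
have df (x : R) : 0 < x -> is_derive x 1 h (- f x).
  move=> x0.
  have -> : - f x = x `^ s * (- expR (- x)) + expR (- x) * (s * x `^ (s - 1)).
    by rewrite /f /h /k; ring.
  have d2 : is_derive x 1 (fun x : R => expR (- x)) (- expR (- x)).
    by apply: is_derive_eq; rewrite /= ?mulrN1 ?mulN1r.
  by apply: (@is_deriveM _ _ (fun y : R => y `^ s) (fun x : R => expR (- x)) x 1 _ _ (is_derive1_powR _ x0) d2).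
have fE (x : R) : 0 < x -> f x = (x - s) * k x.
  by move=> x0; rewrite /f /h /k -(mulr_powRB1 (ltW x0) s0); ring.
have hs0 : h 0 = 0 by rewrite /h powR0 ?gt_eqF// mul0r.
have mh D : measurable_fun D (EFin \o h) by exact: measurable_gamma_integrand.
have mk D : measurable_fun D (EFin \o k) by exact: measurable_gamma_integrand.
have mf D : measurable_fun D (EFin \o f).
  apply/measurable_EFinP; apply: measurable_funB; first exact/measurable_EFinP.
  by apply: measurable_funM => //; exact/measurable_EFinP.
have IA : (\int[mu]_(x in `]0%R, s]) (- f x)%:E = (h s)%:E)%E.
  rewrite integral_itv_obnd_cbnd; last first.
    by apply/measurable_EFinP; apply: measurable_funN; apply/measurable_EFinP; exact: mf.
  rewrite (@continuous_FTC2 _ _ h)// ?hs0 ?sube0//.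
  - apply/continuous_within_itvP => //; split.
    + by move=> x; rewrite in_itv/= => /andP[x0 _]; apply: cvgN; exact: cf.
    + exact: cvgN.
    + by apply/cvg_at_left_filter; apply: cvgN; exact: cf.
  - split.
    + by move=> x; rewrite in_itv/= => /andP[x0 _]; have [] := df x x0.
    + exact: ch0.
    + by apply/cvg_at_left_filter; exact: ch.
  - move=> x; rewrite in_itv/= => /andP[x0 _]; rewrite derive1E.
    by have [] := df x x0.
have IB : (\int[mu]_(x in `]s, +oo[) (f x)%:E = (h s)%:E)%E.
  rewrite integral_itv_obnd_cbnd; last exact: mf.
  rewrite (@ge0_continuous_FTC2y _ _ (fun x => - h x) _ 0)//.
  - by rewrite sub0e EFinN oppeK.
  - by move=> x sx; rewrite fE ?(lt_le_trans s0)// mulr_ge0// subr_ge0.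
  - apply/continuous_within_itvcyP; split.
    + by move=> x; rewrite in_itv/= andbT => sx; apply: cf; exact: lt_trans sx.
    + by apply/cvg_at_right_filter; exact: cf.
  - by rewrite -oppr0; apply: cvgN; exact: cvg_powR_expRN.
  - by move=> x sx; apply: derivableN; have [] := df x (lt_trans s0 sx).
  - by apply/cvg_at_right_filter; apply: cvgN; exact: ch.
  - move=> x; rewrite in_itv/= andbT => sx; have [dh dhE] := df x (lt_trans s0 sx).
    by rewrite derive1E deriveN// dhE opprK.
have -> : `]0%R, +oo[%classic = `]0%R, s]%classic `|` `]s, +oo[%classic :> set R.
  by rewrite -itv_bndbnd_setU// bnd_simp ltW.
have dAB : [disjoint `]0%R, s]%classic & `]s, +oo[%classic].
  apply/disj_set2P; rewrite -subset0 => x [/=]; rewrite !in_itv/= andbT => /andP[_ xs].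
  by rewrite ltNge xs.
rewrite !ge0_integral_setU//=; [|exact: mk|by move=> x _; rewrite lee_fin|exact: mh|by move=> x _; rewrite lee_fin].
have -> : (\int[mu]_(x in `]s, +oo[) (h x)%:E = (h s)%:E + s%:E * \int[mu]_(x in `]s, +oo[) (k x)%:E)%E.
  rewrite -IB -ge0_integralZl//=; [|exact: mk|by move=> x _; rewrite lee_fin|by rewrite lee_fin ltW].
  rewrite -ge0_integralD//=; [| |exact: mf| |]; last 3 first.
  - by move=> x; rewrite in_itv/= andbT => sx; rewrite lee_fin fE ?(lt_trans s0)// mulr_ge0// subr_ge0 ltW.
  - by move=> x _; rewrite -EFinM lee_fin mulr_ge0// ltW.
  - by apply: emeasurable_funM => //; exact: mk.
  by apply: eq_integral => x _; rewrite -EFinM -EFinD /f subrK.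
have ik D : (0 <= \int[mu]_(x in D) (k x)%:E)%E by apply: integral_ge0 => x _; rewrite lee_fin.
rewrite addeA -IA [in RHS]ge0_muleDr//.
congr (_ + _)%E; rewrite -ge0_integralD//=; [|by move=> x _; rewrite lee_fin|exact: mh| |]; last 2 first.
- move=> x; rewrite in_itv/= => /andP[x0 xs]; rewrite lee_fin fE// -mulNr mulr_ge0//.
  by rewrite opprB subr_ge0.
- by apply/measurable_EFinP; apply: measurable_funN; apply/measurable_EFinP; exact: mf.
rewrite -ge0_integralZl//=; [|exact: mk|by move=> x _; rewrite lee_fin|by rewrite lee_fin ltW].
by apply: eq_integral => x _; rewrite -EFinM -EFinD /f opprB addrC subrK.
Qed.

Lemma gamma_int1 : gamma_int 1 = 1%E.
Proof.
rewrite /gamma_int; under eq_integral do rewrite subrr powRr0 mul1r.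
rewrite integral_itv_obnd_cbnd; last first.
  by apply/measurable_EFinP; apply: measurable_funTS; apply: measurableT_comp => //; exact: measurable_expR.
rewrite (@ge0_continuous_FTC2y _ _ (fun x => - expR (- x)) _ 0)//.
- by rewrite oppr0 expR0 sub0e EFinN oppeK.
- have cE : continuous (fun x : R => expR (- x)) by move=> x; exact: cvg_expRN.
  exact: continuous_subspaceT.
- by rewrite -oppr0; apply: cvgN; exact: cvgr_expR.
- by apply/cvg_at_right_filter; apply: cvgN; exact: cvg_expRN.
- move=> x _; rewrite derive1E.
  have d2 : is_derive x 1 (fun x : R => - expR (- x)) (expR (- x)).
    by apply: is_derive_eq; rewrite /= ?mulrN1 ?mulN1r ?opprK.
  by have [] := d2.
Qed.

(** Integrates the tangent-line bound x^th <= y^th (1 + th (x/y - 1)) against x^(y-1) e^-x; by the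
    functional equation the linear term integrates to 0. This plays the part of log-convexity. *)
Lemma gamma_int_le (y th : R) : 1 <= y -> 0 <= th <= 1 ->
  (gamma_int (y + th) <= (y `^ th)%:E * gamma_int y)%E.
Proof.
move=> y1 /andP[th0 th1]; have y0 : 0 < y by lra.
pose c := y `^ th; have c0 : 0 <= c by exact: powR_ge0.
have -> : (c%:E * gamma_int y = (c * (1 - th))%:E * gamma_int y +
    (c * th / y)%:E * gamma_int (y + 1))%E.
  rewrite gamma_int_rec// muleA -EFinM divfK ?gt_eqF// -ge0_muleDl ?lee_fin; last 2 first.
  - by rewrite mulr_ge0// subr_ge0.
  - by rewrite mulr_ge0.
  by rewrite -EFinD -mulrDr subrK mulr1.
have mg (s : R) (D : set R) : measurable_fun D (fun x : R => (x `^ s * expR (- x))%:E).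
  exact: measurable_gamma_integrand.
have pos (s x : R) : 0 <= x `^ s * expR (- x) by rewrite mulr_ge0 ?powR_ge0 ?expR_ge0.
have k1 : 0 <= c * (1 - th) by rewrite mulr_ge0// subr_ge0.
have k2 : 0 <= c * th / y by rewrite !mulr_ge0// invr_ge0 ltW.
rewrite /gamma_int -!ge0_integralZl//=; [|exact: mg|by move=> x _; rewrite lee_fin|exact: mg|by move=> x _; rewrite lee_fin].
rewrite -ge0_integralD//=; last 4 first.
- by move=> x _; rewrite -EFinM lee_fin mulr_ge0.
- by apply: emeasurable_funM => //; exact: mg.
- by move=> x _; rewrite -EFinM lee_fin mulr_ge0.
- by apply: emeasurable_funM => //; exact: mg.
apply: ge0_le_integral => //=.
- by move=> x _; rewrite lee_fin.
- exact: mg.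
- by apply: emeasurable_funD; apply: emeasurable_funM => //; exact: mg.
move=> x; rewrite in_itv/= andbT => x0.
rewrite -!EFinM -EFinD lee_fin !mulrA -mulrDl ler_wpM2r ?expR_ge0//.
have -> : y + th - 1 = (y - 1) + th by lra.
rewrite addrK powRD ?(gt_eqF x0) ?implybT//.
have -> : x `^ y = x * x `^ (y - 1) by rewrite mulr_powRB1// ltW.
have -> : c * (1 - th) * x `^ (y - 1) + c * th / y * (x * x `^ (y - 1)) =
  x `^ (y - 1) * (c * (1 + th * (x / y - 1))) by field; rewrite gt_eqF.
rewrite ler_wpM2l ?powR_ge0//.
have xy0 : 0 <= x / y by rewrite divr_ge0// ltW.
rewrite -[X in X `^ th <= _](divfK (lt0r_neq0 y0)) mulrC powRM ?(ltW y0)//.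
by rewrite ler_wpM2l// powR_le_tangent// th0.
Qed.

Lemma gamma_int_fin (s : R) : 1 <= s -> gamma_int s \is a fin_num.
Proof.
move=> s1.
have [n] : exists n : nat, s <= n%:R + 2.
  exists (Num.truncn s).+1; apply: le_trans (ltW (truncnS_gt s)) _; lra.
have g0 x : (0 <= gamma_int x)%E.
  by apply: integral_ge0 => y _; rewrite lee_fin mulr_ge0 ?powR_ge0 ?expR_ge0.
elim: n s s1 => [|n IH] s s1 sn.
  rewrite ge0_fin_numE//; have -> : s = 1 + (s - 1) by lra.
  apply: le_lt_trans (gamma_int_le _ _) _ => //; first by apply/andP; split; move: sn; rewrite ?add0r; lra.
  by rewrite gamma_int1 powR1 mule1 ltry.
have [s2|s2] := leP s 2.
  by apply: IH => //; apply: le_trans s2 _; rewrite lerDr.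
have -> : s = (s - 1) + 1 by lra.
rewrite gamma_int_rec; last by lra.
by rewrite fin_numM//; apply: IH; [lra|rewrite -natr1 in sn; lra].
Qed.

Lemma gamma_intE s : gamma_int s =
  (\int[mu]_(x in `]0%R, +oo[%classic) ((x `^ (s - 1)) * expR (- x))%:E)%E.
Proof. by []. Qed.

Lemma gammaE s : Gamma s = fine (gamma_int s). Proof. by []. Qed.

Local Opaque Gamma gamma_int.

Lemma gamma_rec (s : R) : 1 <= s -> Gamma (s + 1) = s * Gamma s.
Proof. by move=> s1; rewrite !gammaE gamma_int_rec// fineM// gamma_int_fin. Qed.

Lemma gamma1 : Gamma 1 = 1 :> R.
Proof. by rewrite gammaE gamma_int1. Qed.

Lemma gamma_le (y th : R) : 1 <= y -> 0 <= th <= 1 ->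
  Gamma (y + th) <= y `^ th * Gamma y.
Proof.
move=> y1 th01; have := gamma_int_le y1 th01; rewrite -lee_fin EFinM !gammaE.
by rewrite !fineK// gamma_int_fin//; case/andP: th01 => *; lra.
Qed.

(** Only the interval [A, A+1] of the integral is kept. As A is free, Gamma(1+x) outgrows every
    exponential, which makes the Mittag-Leffler terms tend to 0. *)
Lemma gamma_ge (A x : R) : 0 < A -> 0 <= x -> A `^ x * expR (- (A + 1)) <= Gamma (1 + x).
Proof.
move=> A0 x0; rewrite -lee_fin gammaE fineK ?gamma_int_fin ?lerDl//.
rewrite gamma_intE addrAC subrr add0r.
apply: (@le_trans _ _ (\int[mu]_(y in `[A, (A + 1)%R]) (A `^ x * expR (- (A + 1)))%:E)%E).
  rewrite integral_cst//= lebesgue_measure_itv/= lte_fin ltrDl ltr01.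
  by rewrite -EFinB addrAC subrr add0r mule1.
apply: (@le_trans _ _ (\int[mu]_(y in `[A, (A + 1)%R]) (y `^ x * expR (- y))%:E)%E).
  apply: ge0_le_integral => //=.
  - by move=> y _; rewrite lee_fin mulr_ge0 ?powR_ge0 ?expR_ge0.
  - exact: measurable_gamma_integrand.
  - move=> y; rewrite in_itv/= => /andP[Ay yA]; rewrite lee_fin.
    rewrite ler_pM ?powR_ge0 ?expR_ge0 ?ler_expR ?lerN2//.
    by apply: ge0_ler_powR; rewrite // nnegrE; lra.
apply: ge0_subset_integral => //=.
- exact: measurable_gamma_integrand.
- by move=> y _; rewrite lee_fin mulr_ge0 ?powR_ge0 ?expR_ge0.
- by move=> y/=; rewrite !in_itv/= andbT => /andP[Ay _]; apply: lt_le_trans Ay.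
Qed.

Lemma gamma_gt0 (x : R) : 0 <= x -> 0 < Gamma (1 + x).
Proof.
move=> x0; apply: lt_le_trans (gamma_ge ltr01 x0).
by rewrite mulr_gt0 ?powR_gt0 ?expR_gt0.
Qed.

Definition gamma_ratio (x : R) (n : nat) :=
  Gamma (n.+2%:R + x) / (Gamma n.+2%:R * n.+2%:R `^ x).

Lemma cvg_invn_shift (c : R) : 0 <= c -> (n.+2%:R + c)^-1 @[n --> \oo] --> (0:R).
Proof.
  move=> c0; apply/cvgrPdist_lt => e e0; near=> n.
  have p : 0 < n.+2%:R + c by rewrite ltr_wpDr ?ltr0n.
  rewrite sub0r normrN ger0_norm; last by rewrite invr_ge0 ltW.
  apply: (@le_lt_trans _ _ n.+1%:R^-1); last by near: n; exact: (near_infty_natSinv_lt (PosNum e0)).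
  have n1 : (0 : R) < n.+1%:R by rewrite ltr0n.
  by rewrite lef_pV2 ?posrE// -[n.+2%:R]natr1; lra.
Unshelve. all: end_near. Qed.

(** The lower bound uses [gamma_le] a second time, from y+x up to y+1: y Gamma(y) = Gamma(y+1) <=
    (y+x)^(1-x) Gamma(y+x). *)
Lemma gamma_ratio_bounds (y x : R) : 1 <= y -> 0 <= x <= 1 ->
  1 - (y + 1)^-1 <= Gamma (y + x) / (Gamma y * y `^ x) <= 1.
Proof.
move=> y1 /andP[x0 x1]; have y0 : 0 < y by lra.
have yx1 : 1 <= y + x by lra.
have p0 : 0 < y `^ x by rewrite powR_gt0.
have x1' : 0 <= 1 - x <= 1 by apply/andP; split; lra.
have hh : y `^ x * (y + x) `^ (1 - x) <= y + 1.
  have <- : (y + 1) `^ x * (y + 1) `^ (1 - x) = y + 1.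
    rewrite -powRD; last by apply/implyP => _; rewrite gt_eqF//; lra.
    by rewrite subrKC powRr1//; lra.
  by apply: ler_pM; rewrite ?powR_ge0//; apply: ge0_ler_powR; rewrite ?nnegrE; lra.
have -> : 1 - (y + 1)^-1 = y / (y + 1) by field; rewrite gt_eqF//; lra.
have yy1 : 0 < y + 1 by lra.
have yxE : y + x + (1 - x) = y + 1 by lra.
have pos (z : R) : 1 <= z -> 0 < Gamma z.
  by move=> z1; rewrite -(subrKC 1 z); apply: gamma_gt0; rewrite subr_ge0.
have gy := pos _ y1; have gx := pos _ yx1.
apply/andP; split; last first.
  by rewrite ler_pdivrMr ?mulr_gt0// mul1r mulrC gamma_le// x0.
have h : y * Gamma y <= (y + x) `^ (1 - x) * Gamma (y + x).
  by rewrite -gamma_rec// -yxE gamma_le.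
rewrite ler_pdivlMr ?mulr_gt0// mulrAC ler_pdivrMr//.
have h1 := ler_wpM2l (ltW p0) h; have h2 := ler_wpM2r (ltW gx) hh.
have -> : y * (Gamma y * y `^ x) = y `^ x * (y * Gamma y) by rewrite mulrA mulrC.
by apply: le_trans h1 _; rewrite mulrA [leRHS]mulrC.
Qed.

Lemma gamma_ratio_cvg (x : R) : 0 <= x -> gamma_ratio x n @[n --> \oo] --> (1:R).
Proof.
move=> x0.
have [m] : exists m : nat, x <= m%:R + 1.
  exists (Num.truncn x).+1; apply: le_trans (ltW (truncnS_gt x)) _; lra.
have g0 (n : nat) : 0 < Gamma n.+2%:R :> R.
  by rewrite -natr1 addrC gamma_gt0.
elim: m x x0 => [|m IH] x x0 xm.
  apply: (@squeeze_cvgr _ _ _ _ (fun n => 1 - (n.+2%:R + 1)^-1) (fun=> 1)); last exact: cvg_cst.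
  - near=> n; apply: gamma_ratio_bounds; first by rewrite ler1n.
    by rewrite x0; move: xm; rewrite add0r.
  - rewrite -[X in _ --> X]subr0; apply: cvgB; [exact: cvg_cst|exact: cvg_invn_shift].
have [x1|x1] := leP x 1.
  by apply: IH => //; apply: le_trans x1 _; rewrite lerDr.
have x10 : 0 <= x - 1 by lra.
(* A unit step in x contributes (y+x-1)/y = 1 + (x-1)/y; the [+ 0] only fits the form of
   [cvg_invn_shift]. *)
have -> : gamma_ratio x = (fun n => gamma_ratio (x - 1) n * (1 + (x - 1) * (n.+2%:R + 0)^-1)).
  apply/funext => n; rewrite /gamma_ratio.
  have := g0 n; rewrite addr0; have : 1 <= n.+2%:R :> R by rewrite ler1n.
  move: (n.+2%:R) => y y1 /lt0r_neq0 gy.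
  have -> : y + x = y + (x - 1) + 1 by lra.
  rewrite gamma_rec; last by lra.
  have -> : y `^ x = y * y `^ (x - 1) by rewrite mulr_powRB1//; lra.
  have y0 : y != 0 by rewrite gt_eqF//; lra.
  have p0 : y `^ (x - 1) != 0 by rewrite gt_eqF// powR_gt0//; lra.
  by move: (Gamma _) (Gamma _) (_ `^ _) gy p0 => A B C gy p0; field; rewrite p0 y0 gy.
rewrite -[X in _ --> X]mulr1; apply: cvgM; first by apply: IH => //; rewrite -natr1 in xm; lra.
rewrite -[X in _ --> X]addr0; apply: cvgD; first exact: cvg_cst.
rewrite -[X in _ --> X](mulr0 (x - 1)); apply: cvgM; [exact: cvg_cst|exact: cvg_invn_shift].
Unshelve. all: end_near. Qed.
End gamma.

(** * The scaled mixture converges to the Mittag-Leffler transform; a uniform negative moment *)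

Section mittag_leffler.
Local Opaque Gamma gamma_int.
Context {R : realType}.
Variable a : R.
Hypothesis a01 : 0 < a < 1.

Let a0 : 0 < a. Proof. by case/andP: a01. Qed.
Let a1 : a < 1. Proof. by case/andP: a01. Qed.

Definition qscale (n : nat) : R := n.+2%:R `^ (- a).

Lemma qscale_gt0 n : 0 < qscale n.
Proof. by rewrite powR_gt0// ltr0n. Qed.

Lemma cvg_qscale : qscale n @[n --> \oo] --> (0 : R).
Proof.
apply: (@cvg_comp _ _ _ (fun n : nat => n.+2%:R : R) (fun x => x `^ (- a)) _ (pinfty_nbhs R)).
  by apply/cvgryPge => A; near=> n; apply: le_trans (_ : n%:R <= _);
    [near: n; exact: nbhs_infty_ger|rewrite ler_nat; lia].
have -> : (fun x : R => x `^ (- a)) = (fun x => (x `^ a)^-1).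
  by apply/funext => x; rewrite powRN.
apply/cvgrPdist_lt => e e0; near=> x.
have x0 : 0 < x by near: x; apply: nbhs_pinfty_gt; rewrite num_real.
have ex : e^-1 `^ a^-1 < x by near: x; apply: nbhs_pinfty_gt; rewrite num_real.
rewrite sub0r normrN ger0_norm ?invr_ge0 ?powR_ge0//.
rewrite invf_plt ?posrE ?powR_gt0//.
rewrite -[X in X < _]powRr1 ?invr_ge0 ?ltW// -(mulVf (lt0r_neq0 a0)) powRrM.
by apply: gt0_ltr_powR; rewrite ?nnegrE ?powR_ge0 ?ltW.
Unshelve. all: end_near. Qed.

(** The power -3/2, shifted. Unshifted, convexity of (1+u)^(-3/2) would reverse [phi_step]; with w =
    m - 3/2 that inequality becomes w (w + 3/2)^2 <= (w+1)^3. *)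
Let phi (m : nat) : R := ((m%:R - 3 / 2) * Num.sqrt (m%:R - 3 / 2))^-1.

Lemma phi_step (m : nat) : (2 <= m)%N -> phi m.+1 <= phi m * (1 - 3 / (2 * m%:R)).
Proof.
move=> m2; have M2 : 2 <= m%:R :> R by rewrite ler_nat.
rewrite /phi -[m.+1%:R]natr1; move: (m%:R) M2 => x x2 {m m2}.
have u0 : 0 < x - 3 / 2 by lra.
have v0 : 0 < x + 1 - 3 / 2 by lra.
set su := Num.sqrt (x - 3 / 2); set sv := Num.sqrt (x + 1 - 3 / 2).
have su0 : 0 < su by rewrite sqrtr_gt0.
have sv0 : 0 < sv by rewrite sqrtr_gt0.
have -> : 1 - 3 / (2 * x) = (x - 3 / 2) / x by field; rewrite gt_eqF//; lra.
have uE : x - 3 / 2 = su ^+ 2 by rewrite sqr_sqrtr ?ltW.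
have vE : x + 1 - 3 / 2 = sv ^+ 2 by rewrite sqr_sqrtr ?ltW.
have x0 : 0 < x by lra.
have -> : ((x - 3 / 2) * su)^-1 * ((x - 3 / 2) / x) = (su * x)^-1.
  by rewrite uE; field; rewrite !gt_eqF.
rewrite vE lef_pV2 ?posrE ?mulr_gt0 ?exprn_gt0//.
rewrite -(@ler_pXn2r _ 2) ?nnegrE ?mulr_ge0 ?exprn_ge0 ?ltW//.
have -> : x = su ^+ 2 + 3 / 2 by rewrite -uE; lra.
have sE : sv ^+ 2 = su ^+ 2 + 1 by rewrite -uE -vE; lra.
have -> : (sv ^+ 2 * sv) ^+ 2 = (sv ^+ 2) ^+ 3 by ring.
rewrite sE exprMn; have : 0 <= su ^+ 2 by rewrite exprn_ge0// ltW.
move: (su ^+ 2) => w w0; nra.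
Qed.

Lemma phi_ge0 m : (2 <= m)%N -> 0 <= phi m.
Proof.
move=> m2; have M2 : 2 <= m%:R :> R by rewrite ler_nat.
by rewrite invr_ge0 mulr_ge0 ?sqrtr_ge0//; lra.
Qed.

(** A substitute for [chain_moment] at k = -3/2, as an inequality: by [phi_step], a step at time n
    multiplies the mean of [phi] by at most 1 - (3/2) a / n. *)
Lemma chain_phi n :
  chainE a n phi <= phi 2 * \prod_(2 <= i < n.+2) (1 - 3 / 2 * a / i%:R).
Proof.
have /andP[ap al] := a01.
elim: n => [|n IH]; first by rewrite big_geq// mulr1.
have n2 : 2 <= n.+2%:R :> R by rewrite ler_nat.
have c0 : 0 <= 1 - 3 / 2 * a / n.+2%:R.
  by move: n2; move: (n.+2%:R) => x x2; rewrite subr_ge0 ler_pdivrMr; lra.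
rewrite big_nat_recr//= mulrA.
apply: le_trans (ler_wpM2r c0 IH).
rewrite mulrC -chainEZ; apply: le_chainE => // m hm.
have m2 : (2 <= m)%N by lia.
have M2 : 2 <= m%:R :> R by rewrite ler_nat.
have k0 : 0 <= a * m%:R / n.+2%:R by rewrite divr_ge0// mulr_ge0// ltW.
have := ler_wpM2l k0 (phi_step m2).
have -> : a * m%:R / n.+2%:R * (phi m * (1 - 3 / (2 * m%:R))) =
  a * m%:R / n.+2%:R * phi m - (3 / 2 * a / n.+2%:R) * phi m.
  by field; rewrite !gt_eqF//; lra.
move: (_ / n.+2%:R) (3 / 2 * a / _) (phi m) (phi m.+1) => A B C D; lra.
Qed.

(** Each factor satisfies 1 - b/x <= e^(-b/x) <= (1 + 1/x)^-b, and the right-hand sides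
    telescope. *)
Lemma prod_phi n : \prod_(2 <= i < n.+2) (1 - 3 / 2 * a / i%:R) <=
  2 `^ (3 / 2 * a) * n.+2%:R `^ (- (3 / 2 * a)) :> R.
Proof.
have /andP[ap al] := a01.
have b0 : 0 < 3 / 2 * a by lra.
elim: n => [|n IH].
  by rewrite big_geq// -powRD ?subrr ?powRr0//; apply/implyP.
have n2 : 2 <= n.+2%:R :> R by rewrite ler_nat.
rewrite big_nat_recr//=; have c0 : 0 <= 1 - 3 / 2 * a / n.+2%:R.
  by move: n2; move: (n.+2%:R) => x x2; rewrite subr_ge0 ler_pdivrMr; lra.
apply: le_trans (ler_wpM2r c0 IH) _; rewrite -[leLHS]mulrA ler_wpM2l ?powR_ge0//.
rewrite -[n.+3%:R]natr1; move: (n.+2%:R) n2 c0 => x x2 c0.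
have -> : x + 1 = x * (1 + x^-1) by field; rewrite gt_eqF//; lra.
have xi : 0 < x^-1 by rewrite invr_gt0; lra.
rewrite (powRM _ (_ : 0 <= x)); [|lra|lra].
rewrite ler_wpM2l ?powR_ge0//.
rewrite /powR gt_eqF; last by lra.
apply: le_trans (_ : expR (- (3 / 2 * a / x)) <= _); first exact: expR_ge1Dx.
rewrite ler_expR mulNr lerN2; apply: (ler_wpM2l (ltW b0)); apply: le_ln1Dx; lra.
Qed.

(** The scale q^(-3/2) = (n+2)^(3a/2) cancels the decay of the product. What is left is phi(2)
    2^(3a/2), at most 2^(3/2) 2^(3/2) = 8. The product starts at i = 2, where 1 - 3a/4 > 0; a chain
    started from 1 would bring in 1 - 3a/2, which can be negative. *)
Lemma chain_neg_moment n :
  chainE a n (fun m => (qscale n * m%:R * Num.sqrt (qscale n * m%:R))^-1) <= 8.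
Proof.
have /andP[ap al] := a01.
set q := qscale n; have q0 : 0 < q by exact: qscale_gt0.
have sq0 : 0 < Num.sqrt q by rewrite sqrtr_gt0.
apply: (@le_trans _ _ ((q * Num.sqrt q)^-1 * chainE a n phi)).
  rewrite -chainEZ; apply: le_chainE => // m /andP[m2 _].
  have M2 : 2 <= m%:R :> R by rewrite ler_nat.
  rewrite (sqrtrM _ (ltW q0)) /phi /= -[leRHS]invfM.
  have s1 : 0 < Num.sqrt (m%:R - 3 / 2 : R) by rewrite sqrtr_gt0; lra.
  have s2 : 0 < Num.sqrt (m%:R : R) by rewrite sqrtr_gt0; lra.
  have ss : Num.sqrt (m%:R - 3 / 2) <= Num.sqrt m%:R :> R by rewrite ler_wsqrtr//; lra.
  rewrite lef_pV2 ?posrE; [|by rewrite !mulr_gt0//; lra|by rewrite !mulr_gt0//; lra].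
  rewrite [leRHS]mulrACA; apply: ler_wpM2l; first by rewrite mulr_ge0 ?ltW.
  by apply: ler_pM => //; lra || exact: ltW.
have -> : (q * Num.sqrt q)^-1 = n.+2%:R `^ (3 / 2 * a).
  rewrite -powR12_sqrt ?ltW// -[X in X * _]powRr1 ?ltW// -powRD; last first.
    by apply/implyP => _; rewrite gt_eqF.
  by rewrite -powRN /q /qscale -powRrM; congr powR; lra.
have p0 : 0 < n.+2%:R `^ (3 / 2 * a) by rewrite powR_gt0// ltr0n.
have phi2 : 0 <= phi 2 by exact: phi_ge0.
apply: le_trans (ler_wpM2l (ltW p0) (chain_phi n)) _.
apply: le_trans (ler_wpM2l (ltW p0) (ler_wpM2l phi2 (prod_phi n))) _.
have -> : n.+2%:R `^ (3 / 2 * a) * (phi 2 * (2 `^ (3 / 2 * a) * n.+2%:R `^ (- (3 / 2 * a)))) =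
  phi 2 * 2 `^ (3 / 2 * a).
  by rewrite powRN; field; rewrite gt_eqF.
have -> : 8 = 2 * 2 `^ 2 :> R by rewrite powR_mulrn//; lra.
have -> : phi 2 = 2 * 2 `^ 2^-1.
  rewrite /phi; have -> : 2 - 3 / 2 = 2^-1 :> R by lra.
  by rewrite invfM invrK sqrtrV// invrK powR12_sqrt.
rewrite -mulrA ler_wpM2l// -powRD; last by apply/implyP.
by apply: ler_powR; lra.
Qed.

Lemma prod_gamma (x : R) n : 0 <= x ->
  \prod_(1 <= i < n.+2) (1 + x / i%:R) = Gamma (n.+2%:R + x) / (Gamma (1 + x) * Gamma n.+2%:R).
Proof.
move=> x0; have gx : Gamma (1 + x) != 0 by rewrite gt_eqF// gamma_gt0.
elim: n => [|n IH].
  rewrite big_nat1 divr1; have -> : 2 + x = (1 + x) + 1 by lra.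
  have -> : 2 = 1 + 1 :> R by lra.
  by rewrite !gamma_rec ?gamma1 ?lerDl// !mulr1 mulfK.
rewrite big_nat_recr//= IH -![n.+3%:R]natr1.
have n1 : 1 <= n.+2%:R :> R by rewrite ler1n.
have gn : Gamma n.+2%:R != 0 :> R by rewrite -natr1 addrC gt_eqF// gamma_gt0.
move: (n.+2%:R) n1 gn {IH} => y y1 gy.
have -> : y + 1 + x = y + x + 1 by rewrite addrAC.
rewrite (gamma_rec y1) gamma_rec; last by rewrite ler_wpDr.
have y0 : y != 0 by rewrite gt_eqF// (lt_le_trans ltr01).
move: (Gamma _) (Gamma _) (Gamma _) gx gy => A B C B0 C0.
by field; rewrite B0 C0 y0.
Qed.

(** As rbin(j,k) behaves like j^k / k!, the limit is a moment already divided by k!, that is, a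
    coefficient of the Mittag-Leffler series itself. *)
Lemma mix_moment_cvg k :
  qscale n ^+ k * mixE a n (fun j => (rbin j k)%:R) @[n --> \oo] --> (Gamma (1 + k%:R * a))^-1.
Proof.
have x0 : 0 <= k%:R * a by rewrite mulr_ge0// ltW.
have -> : (fun n => qscale n ^+ k * mixE a n (fun j => (rbin j k)%:R)) =
    (fun n => (Gamma (1 + k%:R * a))^-1 * gamma_ratio (k%:R * a) n).
  apply/funext => n; rewrite mix_moment.
  have -> : \prod_(1 <= i < n.+2) (1 + a * k%:R / i%:R) =
     \prod_(1 <= i < n.+2) (1 + (k%:R * a) / i%:R) by apply: eq_bigr => i _; rewrite (mulrC a).
  rewrite prod_gamma// /gamma_ratio -powR_mulrn ?powR_ge0// /qscale -powRrM.
  have -> : - a * k%:R = - (k%:R * a) by ring.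
  by rewrite powRN !invfM; ring.
rewrite -[X in _ --> X]mulr1; apply: cvgM; [exact: cvg_cst|exact: gamma_ratio_cvg].
Qed.

Lemma ml_term_cvg0 (s : R) : 0 <= s -> s ^+ k / Gamma (1 + k%:R * a) @[k --> \oo] --> (0 : R).
Proof.
have /andP[ap al] := a01.
(* Chosen so that A^a = 2 (s+1): the terms then decay at least like 2^-k. *)
move=> s0; pose A := (2 * (s + 1)) `^ a^-1.
have A0 : 0 < A by rewrite powR_gt0; lra.
have Aa : A `^ a = 2 * (s + 1).
  by rewrite -powRrM mulVf ?gt_eqF// powRr1//; lra.
apply: (@squeeze_cvgr _ _ _ _ (fun=> 0) (fun k => expR (A + 1) * 2^-1 ^+ k)).
- near=> k; have x0 : 0 <= k%:R * a by rewrite mulr_ge0// ltW.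
  have gp := gamma_gt0 x0.
  apply/andP; split; first by rewrite divr_ge0 ?exprn_ge0// ltW.
  rewrite ler_pdivrMr//.
  apply: (@le_trans _ _ (expR (A + 1) * 2^-1 ^+ k * (A `^ (k%:R * a) * expR (- (A + 1))))).
    have EE : expR (A + 1) * expR (- (A + 1)) = 1 by rewrite -expRD subrr expR0.
    have -> : expR (A + 1) * 2^-1 ^+ k * (A `^ (k%:R * a) * expR (- (A + 1))) =
      (A `^ (k%:R * a) * 2^-1 ^+ k) * (expR (A + 1) * expR (- (A + 1))) by ring.
    rewrite EE mulr1 powRrM powRAC Aa powR_mulrn; last by lra.
    by rewrite -exprMn; apply: lerXn2r; rewrite ?nnegrE; lra.
  by rewrite ler_wpM2l ?gamma_ge// mulr_ge0 ?expR_ge0 ?exprn_ge0.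
- exact: cvg_cst.
- rewrite -[X in _ --> X](mulr0 (expR (A + 1))); apply: cvgM; first exact: cvg_cst.
  by apply: cvg_expr; rewrite ger0_norm; lra.
Unshelve. all: end_near. Qed.

Lemma norm_mixE_le n f g : (forall m, (1 <= m <= n.+2)%N -> `|f m| <= g m) ->
  `|mixE a n f| <= mixE a n g.
Proof.
move=> fg; rewrite ler_norml -mulN1r -mixEZ; apply/andP.
by split; apply: le_mixE => // m /fg; rewrite ler_norml ?mulN1r => /andP[].
Qed.

Definition mixL (s : R) n := mixE a n (fun j => expR (- (s * qscale n) * j%:R)).

Lemma cvg_sum_ord (F : nat -> nat -> R) (l : nat -> R) M :
  (forall k, F k n @[n --> \oo] --> l k) ->
  \sum_(k < M) F k n @[n --> \oo] --> \sum_(k < M) l k.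
Proof.
move=> Fl; elim: M => [|M IH].
  by rewrite big_ord0; under eq_fun do rewrite big_ord0; exact: cvg_cst.
rewrite big_ord_recr/=; under eq_fun do rewrite big_ord_recr/=.
exact: cvgD.
Qed.

(** Replace e^(-s q j) by (1 + s q)^-j at the cost s q, expand to order M with [negbin_taylor], and
    average. The rising moments converge, and the error tends to the first omitted term of the
    series. *)
Lemma mixL_approx (s e : R) M : 0 <= s -> 0 < e -> \forall n \near \oo,
  `|mixL s n - \sum_(0 <= k < M) (- s) ^+ k / Gamma (1 + k%:R * a)| <=
     s ^+ M / Gamma (1 + M%:R * a) + e.
Proof.
move=> s0 e0.
pose mu k n : R := mixE a n (fun j => (rbin j k)%:R).
pose T n := \sum_(k < M) (- (s * qscale n)) ^+ k * mu k n.
pose N n := mixE a n (fun j => (1 + s * qscale n) ^- j).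
have cq : s * qscale n @[n --> \oo] --> (0 : R).
  by rewrite -[X in _ --> X](mulr0 s); apply: cvgM; [exact: cvg_cst|exact: cvg_qscale].
have cT : T n @[n --> \oo] --> \sum_(k < M) (- s) ^+ k / Gamma (1 + k%:R * a).
  apply: (@cvg_sum_ord (fun k n => (- (s * qscale n)) ^+ k * mu k n)
    (fun k => (- s) ^+ k / Gamma (1 + k%:R * a))) => k.
  have -> : (fun n => (- (s * qscale n)) ^+ k * mu k n) = (fun n => (- s) ^+ k * (qscale n ^+ k * mu k n)).
    by apply/funext => n; rewrite -mulNr exprMn mulrA.
  by apply: cvgM; [exact: cvg_cst|exact: mix_moment_cvg].
have cM : (s * qscale n) ^+ M * mu M n @[n --> \oo] --> s ^+ M / Gamma (1 + M%:R * a).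
  under eq_fun do rewrite exprMn -mulrA.
  by apply: cvgM; [exact: cvg_cst|exact: mix_moment_cvg].
near=> n.
have q0 : 0 <= s * qscale n by rewrite mulr_ge0// ltW// qscale_gt0.
have h1 : `|0 - s * qscale n| < Num.min 1 (e / 3).
  near: n; move/cvgrPdist_lt: cq; apply; rewrite lt_min ltr01; lra.
have h2 : `|\sum_(k < M) (- s) ^+ k / Gamma (1 + k%:R * a) - T n| < e / 3.
  by near: n; move/cvgrPdist_lt: cT; apply; lra.
have h3 : `|s ^+ M / Gamma (1 + M%:R * a) - (s * qscale n) ^+ M * mu M n| < e / 3.
  by near: n; move/cvgrPdist_lt: cM; apply; lra.
have h4 : `|mixL s n - N n| <= s * qscale n.
  rewrite -mixEB; apply: norm_mixE => // m _; rewrite distrC expR_negbin//.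
  rewrite q0/=; move: h1; rewrite sub0r normrN ger0_norm// lt_min => /andP[/ltW]//.
have h5 : `|N n - T n| <= (s * qscale n) ^+ M * mu M n.
  have -> : T n = mixE a n (fun j => \sum_(k < M) (- (s * qscale n)) ^+ k * (rbin j k)%:R).
    rewrite (mixE_sum a n M (fun k j => (- (s * qscale n)) ^+ k * (rbin j k)%:R)).
    by apply: eq_bigr => k _; rewrite mixEZ.
  rewrite -mixEB -mixEZ; apply: norm_mixE_le => m _; exact: negbin_taylor.
rewrite big_mkord; move: h1; rewrite sub0r normrN ger0_norm// lt_min => /andP[_ h1].
move: h2 h3 h4 h5; rewrite !ltr_norml !ler_norml.
do 4 move=> /andP[? ?]; apply/andP; split; lra.
Unshelve. all: end_near. Qed.

(** [MittagLeffler] is a [limn], so convergence of the series must be established, and it comes from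
    the mixture: the omitted terms tend to 0, so any two late partial sums are close to [mixL s n]
    for a common n, hence to each other. *)
Lemma mixL_cvg (s : R) : 0 <= s -> mixL s n @[n --> \oo] --> MittagLeffler a (- s).
Proof.
move=> s0; pose S M := \sum_(0 <= k < M) (- s) ^+ k / Gamma (1 + k%:R * a).
have small e : 0 < e -> \forall M \near \oo, s ^+ M / Gamma (1 + M%:R * a) < e.
  move=> e0; near=> M; have : `|0 - s ^+ M / Gamma (1 + M%:R * a)| < e.
    by near: M; have := ml_term_cvg0 s0; move/cvgrPdist_lt; exact.
  by rewrite sub0r normrN; apply: le_lt_trans; exact: ler_norm.
have bnd M : 0 <= s ^+ M / Gamma (1 + M%:R * a).
  have x0 : 0 <= M%:R * a by rewrite mulr_ge0// ltW.
  by rewrite divr_ge0 ?exprn_ge0// ltW// gamma_gt0.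
have cS : cvgn S.
  apply/cauchy_cvgP/cauchy_exP => e e0; have e5 : 0 < e / 5 by rewrite divr_gt0.
  have [M0 _ hM0] := small _ e5; exists (S M0); exists M0 => // M /= MM.
  have [n [hn1 hn2]] := filter_ex (filterI (mixL_approx M0 s0 e5) (mixL_approx M s0 e5)).
  have := hM0 _ MM; have := hM0 _ (leqnn M0); move: hn1 hn2; rewrite -/(S M) -/(S M0).
  rewrite /ball/= => h1 h2 h3 h4.
  have -> : S M0 - S M = (mixL s n - S M) - (mixL s n - S M0) by ring.
  apply: le_lt_trans (ler_normB _ _) _; move: h1 h2 h3 h4.
  move: `|_ - S M| `|_ - S M0| (s ^+ M / _) (s ^+ M0 / _) => A B C D; lra.
have hl : MittagLeffler a (- s) = limn S by [].
rewrite hl; apply/cvgrPdist_lt => e e0; have e3 : 0 < e / 3 by rewrite divr_gt0.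
have : \forall M \near \oo, `|limn S - S M| < e / 3 /\ s ^+ M / Gamma (1 + M%:R * a) < e / 3.
  by near=> M; split; near: M; [have := cS; move/cvgrPdist_lt; exact|exact: small].
move=> [M _ /(_ M (leqnn M)) [h1 h2]].
have := mixL_approx M s0 e3; apply: filterS => n; rewrite -/(S M) => h3.
rewrite -(subrK (S M) (limn S)) -addrA.
apply: le_lt_trans (ler_normD _ _) _; rewrite [X in _ + X]distrC.
move: h1 h2 h3; move: `|_ - S M| `|mixL s n - _| (s ^+ M / _) => A B C; lra.
Unshelve. all: end_near. Qed.
End mittag_leffler.

(** * Lebesgue measure on tuples *)

Lemma sigma_finite_prod (R : realType) d1 d2 (T1 : measurableType d1) (T2 : measurableType d2)
  (m1 : {sigma_finite_measure set T1 -> \bar R}) (m2 : {sigma_finite_measure set T2 -> \bar R}) :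
  sigma_finite setT (m1 \x m2)%E.
Proof.
have /sigma_finiteP[F [TF ndF Foo]] := sigma_finiteT m1.
have /sigma_finiteP[G [TG ndG Goo]] := sigma_finiteT m2.
exists (fun n => F n `*` G n) => [|k].
  rewrite -setXTT TF TG; apply/seteqP; split => -[x y] /=.
    move=> [[n _ Fnx] [k _ Gky]]; exists (maxn n k) => //; split => /=.
      by move: x Fnx; exact/subsetPset/ndF/leq_maxl.
    by move: y Gky; exact/subsetPset/ndG/leq_maxr.
  by move=> [n _ []/= ? ?]; split; exists n.
have [mF Foo'] := Foo k; have [mG Goo'] := Goo k; split; first exact: measurableX.
by rewrite product_measure1E// lte_mul_pinfty// ge0_fin_numE.
Qed.

Section lebesgue_on_tuples.
Context {R : realType}.
Notation mu := (@lebesgue_measure R).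

Definition cons_pair M (p : measurableTypeR R * M.-tuple R) : M.+1.-tuple R :=
  cons_tuple p.1 p.2.
Definition uncons M (x : M.+1.-tuple R) : measurableTypeR R * M.-tuple R :=
  (thead x, behead_tuple x).

Lemma cons_pairK M : cancel (@cons_pair M) (@uncons M).
Proof.
by case=> a x; rewrite /uncons /cons_pair/=; congr pair; apply: val_inj.
Qed.

Lemma measurable_cons_pair M : measurable_fun setT (@cons_pair M).
Proof.
apply: measurable_cons; [exact: measurable_fst|exact: measurable_snd].
Qed.

Lemma measurable_uncons M : measurable_fun setT (@uncons M).
Proof.
apply/measurable_fun_pairP; split => /=.
  exact: (measurable_tnth ord0).
exact: measurable_behead.
Qed.

(** Represents the iterated integral by a measure, pushing the product measure forward along
    [cons_pair], so that Tonelli and the convergence theorems apply. Sigma-finiteness is carried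
    through the induction because Tonelli requires it. *)
Lemma intRN_measure_exists N : exists m : {sigma_finite_measure set (N.-tuple R) -> \bar R},
  forall f, measurable_fun setT f -> (forall x, (0 <= f x)%E) ->
    intRN f = (\int[m]_x f x)%E.
Proof.
elim: N => [|N [m IH]].
  exists (dirac (nil_tuple R)) => f mf f0 /=.
  by rewrite integral_dirac// diracT mul1e.
pose nu' : {measure set (N.+1.-tuple R) -> \bar R} := pushforward (mu \x m)%E (@cons_pair N).
pose nu := nu' (@measurable_cons_pair N).
have snu : sigma_finite setT nu.
  have [F FT Ffin] := sigma_finite_prod mu m.
  exists (fun n => @uncons N @^-1` F n).
    by rewrite -preimage_bigcup -FT preimage_setT.
  move=> n; have [mF Foo] := Ffin n; split.
    by rewrite -[X in measurable X]setTI; exact: measurable_uncons.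
  by rewrite /nu /nu'/= /pushforward -comp_preimage (_ : _ \o _ = id) ?preimage_id//;
    apply/funext => x /=; rewrite cons_pairK.
pose h := Measure_isSigmaFinite.Build _ _ _ (nu : set _ -> \bar R) snu.
pose nus : {sigma_finite_measure set (N.+1.-tuple R) -> \bar R} := HB.pack (nu : set _ -> \bar R) (Measure.class nu) h.
exists nus => f mf f0.
rewrite /nus /nu /nu'/= ge0_integral_pushforward//; last exact: measurable_cons_pair.
rewrite preimage_setT fubini_tonelli1//=; last first.
  by apply: measurableT_comp => //; exact: measurable_cons_pair.
apply: eq_integral => x _; rewrite IH//.
apply: (measurableT_comp mf); apply: measurable_cons => //.
Qed.
End lebesgue_on_tuples.

Section integration_on_tuples.
Context {R : realType}.
Notation mu := (@lebesgue_measure R).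

Definition muN N : {sigma_finite_measure set (N.-tuple R) -> \bar R} :=
  projT1 (cid (@intRN_measure_exists R N)).

Lemma intRN_muN N (f : N.-tuple R -> \bar R) : measurable_fun setT f -> (forall x, (0 <= f x)%E) ->
  intRN f = (\int[muN N]_x f x)%E.
Proof. by move=> mf f0; rewrite /muN; case: cid => m /= ->. Qed.

Lemma measurable_reflect (c : R) : measurable_fun setT (fun x : measurableTypeR R => (c - x : measurableTypeR R)).
Proof. by apply: measurable_funB => //; exact: measurable_cst. Qed.

Lemma lebesgue_measure_reflect (c : R) (A : set R) : measurable A ->
  pushforward mu (fun x : measurableTypeR R => (c - x : measurableTypeR R)) A = mu A.
Proof.
move=> mA; pose f := (fun x : measurableTypeR R => (c - x : measurableTypeR R)).
pose nu' : {measure set (measurableTypeR R) -> \bar R} := pushforward mu f.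
pose nu := nu' (measurable_reflect c).
apply/esym; apply: (@lebesgue_measure_unique _ nu) => //= _ [[u v]] _ <-.
rewrite /nu /nu' /= /pushforward.
have -> : f @^-1` `]u, v]%classic = `[c - v, c - u[%classic.
  apply/seteqP; split => x; rewrite /f /= !in_itv/= => /andP[h1 h2]; apply/andP; split; lra.
rewrite !lebesgue_measure_itv/= !lte_fin -!EFinD.
have -> : (c - v < c - u) = (u < v) by rewrite ltrD2l ltrN2.
by case: ifPn => // _; congr EFin; lra.
Qed.

Lemma integral_reflect (c : R) (f : R -> \bar R) : measurable_fun setT f ->
  (forall x, (0 <= f x)%E) -> (\int[mu]_x f (c - x)%R = \int[mu]_x f x)%E.
Proof.
move=> mf f0; pose g := (fun x : measurableTypeR R => (c - x : measurableTypeR R)).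
pose nu' : {measure set (measurableTypeR R) -> \bar R} := pushforward mu g.
pose nu := nu' (measurable_reflect c).
transitivity (\int[nu]_x f x)%E.
  by rewrite /nu /nu' (ge0_integral_pushforward (measurable_reflect c))// preimage_setT.
apply: eq_measure_integral => A mA _; exact: lebesgue_measure_reflect.
Qed.

Lemma measurable_tnth_comp N (i : 'I_N) : measurable_fun setT (fun x : N.-tuple R => tnth x i).
Proof. exact: measurable_tnth. Qed.

Lemma tnth_vsub N (x y : N.-tuple R) i : tnth (vsub x y) i = tnth x i - tnth y i.
Proof. exact: tnth_mktuple. Qed.

Lemma measurable_vsub d (T : measurableType d) N (f g : T -> N.-tuple R) :
  measurable_fun setT f -> measurable_fun setT g -> measurable_fun setT (fun x => vsub (f x) (g x)).
Proof.
move=> mf mg; apply/measurable_fun_tnthP => i /=.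
rewrite (_ : _ \o _ = fun x => tnth (f x) i - tnth (g x) i); last first.
  by apply/funext => x /=; rewrite tnth_vsub.
by apply: measurable_funB; apply: (measurableT_comp (measurable_tnth_comp i)).
Qed.

Lemma measurable_vdot d (T : measurableType d) N (f g : T -> N.-tuple R) :
  measurable_fun setT f -> measurable_fun setT g -> measurable_fun setT (fun x => vdot (f x) (g x)).
Proof.
move=> mf mg; apply: measurable_sum => i.
by apply: measurable_funM; apply: (measurableT_comp (measurable_tnth_comp i)).
Qed.

Lemma measurable_enorm N : measurable_fun setT (@enorm R N).
Proof.
apply: (@measurableT_comp _ _ _ _ _ _ (@Num.sqrt R)).
  by apply: continuous_measurable_fun; exact: sqrt_continuous.
by apply: measurable_vdot; exact: measurable_id.
Qed.

Lemma intRN_reflect N (c : N.-tuple R) (f : N.-tuple R -> \bar R) : measurable_fun setT f ->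
  (forall x, (0 <= f x)%E) -> intRN (fun y => f (vsub c y)) = intRN f.
Proof.
elim: N c f => [|N IH] c f mf f0 /=; first by rewrite !tuple0.
have mcons (x : R) : measurable_fun setT (fun y : N.-tuple R => f (cons_tuple x y)).
  by apply: (measurableT_comp mf); apply: measurable_cons.
rewrite -[RHS](integral_reflect (thead c)); last 2 first.
- have mF : measurable_fun setT (f \o @cons_pair R N).
    by apply: measurableT_comp => //; exact: measurable_cons_pair.
  have := @measurable_fun_fubini_tonelli_F _ _ _ _ _ (muN N) _ mF (fun x => f0 _).
  congr (measurable_fun _ _); apply/funext => x.
  by rewrite intRN_muN.
- by move=> x; rewrite intRN_muN//; apply: integral_ge0 => y _.
apply: eq_integral => x _.
rewrite -(IH (behead_tuple c) (fun y => f (cons_tuple (thead c - x) y)))//.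
congr intRN; apply/funext => y; congr f; apply: eq_from_tnth => i.
rewrite tnth_vsub; have [->|i0] := eqVneq i ord0; first by rewrite !tnth0.
have [j ->] : exists j, i = lift ord0 j.
  by case: (unliftP ord0 i) i0 => [j ->|->]; [exists j|rewrite eqxx].
by rewrite !tnthS tnth_vsub; congr (_ - _); rewrite [in LHS](tuple_eta c) tnthS.
Qed.

Lemma integral_vsub N (c : N.-tuple R) (f : N.-tuple R -> \bar R) : measurable_fun setT f ->
  (forall x, (0 <= f x)%E) -> (\int[muN N]_y f (vsub c y) = \int[muN N]_y f y)%E.
Proof.
move=> mf f0; rewrite -!intRN_muN//; first exact: intRN_reflect.
by apply: (measurableT_comp mf); apply: measurable_vsub => //; exact: measurable_id.
Qed.

(** A translation is the composite of the two reflections y -> c - y and y -> 0 - y. *)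
Lemma integral_vsubr N (c : N.-tuple R) (f : N.-tuple R -> \bar R) : measurable_fun setT f ->
  (forall x, (0 <= f x)%E) -> (\int[muN N]_y f (vsub y c) = \int[muN N]_y f y)%E.
Proof.
move=> mf f0; pose o : N.-tuple R := [tuple 0 | i < N].
have mo : measurable_fun setT (fun z => f (vsub o z)).
  by apply: (measurableT_comp mf); apply: measurable_vsub => //; exact: measurable_id.
rewrite -(integral_vsub o mf f0) -(integral_vsub c mo)//.
apply: eq_integral => y _; congr f; apply: eq_from_tnth => i.
by rewrite !tnth_vsub tnth_mktuple; lra.
Qed.

Lemma intRN_prod N (g : R -> R) : measurable_fun setT g -> (forall x, 0 <= g x) ->
  intRN (fun x : N.-tuple R => (\prod_(i < N) g (tnth x i))%:E) =
  (\prod_(i < N) \int[mu]_x (g x)%:E)%E.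
Proof.
move=> mg g0; elim: N => [|N IH] /=; first by rewrite !big_ord0.
have pg0 M (x : M.-tuple R) : 0 <= \prod_(i < M) g (tnth x i) by apply: prodr_ge0.
have mpg M : measurable_fun setT (fun x : M.-tuple R => (\prod_(i < M) g (tnth x i))%:E).
  apply/measurable_EFinP; apply: measurable_prod => i _.
  exact: (measurableT_comp mg (measurable_tnth_comp i)).
rewrite big_ord_recl/= -IH muleC -ge0_integralZl//=; last 3 first.
- exact/measurable_EFinP.
- by move=> x _; rewrite lee_fin.
- rewrite intRN_muN; [by apply: integral_ge0 => y _; rewrite lee_fin; exact: pg0|exact: mpg|].
  by move=> y; rewrite lee_fin; exact: pg0.
apply: eq_integral => x _.
rewrite (intRN_muN (mpg N)) => [|y]; last by rewrite lee_fin; exact: pg0.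
rewrite muleC -ge0_integralZl//; [|exact: mpg|by move=> y _; rewrite lee_fin; exact: pg0|by rewrite lee_fin].
have E (y : N.-tuple R) : \prod_(i < N.+1) g (tnth (cons_tuple x y) i) = g x * \prod_(i < N) g (tnth y i).
  rewrite big_ord_recl/= tnth0; congr (_ * _).
  by apply: eq_bigr => i _; rewrite tnthS.
rewrite intRN_muN.
- by apply: eq_integral => y _; rewrite E EFinM.
- by under eq_fun do rewrite E EFinM; apply: emeasurable_funM => //; exact: mpg.
- by move=> y; rewrite lee_fin; exact: pg0.
Qed.

Lemma lebesgue_sym_itv (r : R) : 0 < r ->
  (\int[mu]_x (\1_(`]- r, r[%classic : set R) x)%:E = (r *+ 2)%:E)%E.
Proof.
move=> r0; rewrite integral_indic//= setIT lebesgue_measure_itv/= lte_fin ifT; last by lra.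
by rewrite -EFinB opprK mulr2n.
Qed.

Lemma normr_tnth_le N (x : N.-tuple R) i : `|tnth x i| <= enorm x.
Proof.
rewrite -sqrtr_sqr; apply: ler_wsqrtr; rewrite /vdot (bigD1 i)//= expr2 lerDl.
by apply: sumr_ge0 => j _; rewrite -expr2 sqr_ge0.
Qed.

Lemma enorm_ge0 N (x : N.-tuple R) : 0 <= enorm x.
Proof. exact: sqrtr_ge0. Qed.

Lemma measurable_ballO N (r : R) : measurable (ballO (N := N) r).
Proof.
have -> : ballO (N := N) r = @enorm R N @^-1` `]-oo, r[%classic.
  by apply/seteqP; split => x /=; rewrite in_itv.
by rewrite -[X in measurable X]setTI; apply: measurable_enorm.
Qed.

(** The ball lies in a cube of side 2r. This crude volume suffices because integrals are only
    bounded from above. *)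
Lemma muN_ball_le N (r : R) : 0 < r -> (muN N (ballO r) <= ((2 * r) ^+ N)%:E)%E.
Proof.
move=> r0; have mI : measurable_fun setT (\1_(`]- r, r[%classic : set R) : R -> R).
  exact: measurable_indic.
have I0 (x : R) : 0 <= \1_(`]- r, r[%classic : set R) x :> R by rewrite indicE.
rewrite -[X in muN N X]setIT -integral_indic//; last exact: measurable_ballO.
have -> : ((2 * r) ^+ N)%:E = intRN (fun x : N.-tuple R => (\prod_(i < N) (\1_(`]- r, r[%classic : set R) (tnth x i)))%:E).
  rewrite (intRN_prod N mI I0).
  rewrite (eq_bigr (fun=> (2 * r)%:E)) => [|i _]; last by rewrite lebesgue_sym_itv// mulr_natl.
  by rewrite prodEFin prodr_const card_ord.
rewrite intRN_muN; last 2 first.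
- apply/measurable_EFinP; apply: measurable_prod => i _.
  exact: (measurableT_comp mI (measurable_tnth_comp i)).
- by move=> x; rewrite lee_fin prodr_ge0// => i _; rewrite indicE.
apply: ge0_le_integral => //=.
- by apply/measurable_EFinP; apply: measurable_indic; exact: measurable_ballO.
- apply/measurable_EFinP; apply: measurable_prod => i _.
  exact: (measurableT_comp mI (measurable_tnth_comp i)).
move=> x _; rewrite lee_fin indicE; have [xb|_] := boolP (x \in _); last first.
  by rewrite prodr_ge0// => i _; rewrite indicE.
rewrite big1// => i _; rewrite indicE mem_set//=.
rewrite in_itv/= -ltr_norml; apply: le_lt_trans (normr_tnth_le x i) _.
by move: xb; rewrite inE.
Qed.
End integration_on_tuples.

Section ge0_real_integrals.
Context {R : realType} d (T : measurableType d) (m : {measure set T -> \bar R}).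
Implicit Types f g : T -> R.

Lemma ge0_integralZ_real f (c : R) : measurable_fun setT f -> (forall x, 0 <= f x) -> 0 <= c ->
  (\int[m]_x (c * f x)%:E = c%:E * \int[m]_x (f x)%:E)%E.
Proof.
move=> mf f0 c0; under eq_integral do rewrite EFinM.
by rewrite ge0_integralZl// => [|x _]; [exact/measurable_EFinP|rewrite lee_fin].
Qed.

Lemma ge0_integralD_real f g : measurable_fun setT f -> measurable_fun setT g ->
  (forall x, 0 <= f x) -> (forall x, 0 <= g x) ->
  (\int[m]_x (f x + g x)%:E = \int[m]_x (f x)%:E + \int[m]_x (g x)%:E)%E.
Proof.
move=> mf mg f0 g0; under eq_integral do rewrite EFinD.
by rewrite ge0_integralD// => [x _||x _|]; rewrite ?lee_fin//; exact/measurable_EFinP.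
Qed.

Lemma ge0_le_integral_real f g : measurable_fun setT f -> measurable_fun setT g ->
  (forall x, 0 <= f x) -> (forall x, f x <= g x) ->
  (\int[m]_x (f x)%:E <= \int[m]_x (g x)%:E)%E.
Proof.
move=> mf mg f0 fg.
by apply: ge0_le_integral => // [x _|||x _]; rewrite ?lee_fin//; exact/measurable_EFinP.
Qed.
End ge0_real_integrals.

(** * Convolution inequalities *)

Section riesz_kernels.
Context {R : realType}.

Lemma young_tangent (p c x : R) : 1 <= p -> 0 < c -> 0 <= x ->
  p * c `^ (p - 1) * x <= x `^ p + (p - 1) * c `^ p.
Proof.
move=> p1 c0 x0; have p0 : 0 < p by lra.
have y0 : 0 <= x / c by rewrite divr_ge0// ltW.
have th : 0 <= p^-1 <= 1 by rewrite invr_ge0 ltW//= invf_le1.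
have := powR_le_tangent (powR_ge0 (x / c) p) th.
rewrite -powRrM mulfV ?gt_eqF// powRr1// => h.
have cp : 0 < c `^ p by rewrite powR_gt0.
have -> : c `^ (p - 1) = c `^ p / c.
  by rewrite powRB ?powRr1 ?ltW//; apply/implyP => _; rewrite gt_eqF.
have -> : x `^ p = c `^ p * (x / c) `^ p.
  by rewrite -powRM ?(ltW c0)// mulrC divfK// gt_eqF.
have -> : p * (c `^ p / c) * x = c `^ p * (p * (x / c)) by ring.
have -> : (p - 1) * c `^ p = c `^ p * (p - 1) by ring.
rewrite -mulrDr ler_wpM2l ?(ltW cp)//.
have := ler_wpM2l (ltW p0) h; move: (x / c) (_ `^ p) => v w.
have -> : p * (1 + p^-1 * (w - 1)) = p + w - 1 by field; rewrite gt_eqF.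
lra.
Qed.

(** Jensen for the measure u dm of mass at most A: integrate the tangent line of x^p at c and take c
    = I/A. In the extended reals, an infinite I forces J to be infinite already with c = 1. *)
Lemma jensen_powR d (T : measurableType d) (m : {measure set T -> \bar R}) (u phi : T -> R) (p A : R) :
  1 <= p -> 0 < A -> measurable_fun setT u -> measurable_fun setT phi ->
  (forall x, 0 <= u x) -> (forall x, 0 <= phi x) -> (\int[m]_x (u x)%:E <= A%:E)%E ->
  (poweR (\int[m]_x (phi x * u x)%:E) p <= (A `^ (p - 1))%:E * \int[m]_x (phi x `^ p * u x)%:E)%E.
Proof.
move=> p1 A0 mu_ mphi u0 phi0 uA; have p0 : 0 < p by lra.
set I := (\int[m]_x (phi x * u x)%:E)%E; set J := (\int[m]_x (phi x `^ p * u x)%:E)%E.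
have I0 : (0 <= I)%E by apply: integral_ge0 => x _; rewrite lee_fin mulr_ge0.
have J0 : (0 <= J)%E by apply: integral_ge0 => x _; rewrite lee_fin mulr_ge0 ?powR_ge0.
have mpp : measurable_fun setT (fun x => phi x `^ p).
  exact: (measurableT_comp (measurable_powR _) mphi).
have key (c : R) : 0 < c -> ((p * c `^ (p - 1))%:E * I <= J + ((p - 1) * c `^ p * A)%:E)%E.
  move=> c0; have k1 : 0 <= p * c `^ (p - 1) by rewrite mulr_ge0 ?powR_ge0 ?ltW.
  have k2 : 0 <= (p - 1) * c `^ p by rewrite mulr_ge0 ?powR_ge0//; lra.
  apply: (@le_trans _ _ (J + ((p - 1) * c `^ p)%:E * \int[m]_x (u x)%:E)%E); last first.
    by rewrite leeD2l// [leRHS]EFinM lee_wpmul2l// lee_fin.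
  have mpu : measurable_fun setT (fun x => phi x * u x) by exact: measurable_funM.
  have mppu : measurable_fun setT (fun x => phi x `^ p * u x) by exact: measurable_funM.
  have pu0 x : 0 <= phi x * u x by rewrite mulr_ge0.
  have ppu0 x : 0 <= phi x `^ p * u x by rewrite mulr_ge0 ?powR_ge0.
  have mk2 : measurable_fun setT (fun x => (p - 1) * c `^ p * u x) by exact: measurable_funM.
  have k2u x : 0 <= (p - 1) * c `^ p * u x by rewrite mulr_ge0.
  rewrite -!ge0_integralZ_real// -ge0_integralD_real//.
  apply: ge0_le_integral_real => [|||x].
  - exact: measurable_funM.
  - exact: measurable_funD.
  - by move=> x; rewrite mulr_ge0.
  rewrite mulrA -mulrDl ler_wpM2r//.
  exact: young_tangent.
have Ap : 0 < A `^ (p - 1) by rewrite powR_gt0.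
have [Ifin|] := boolP (I \is a fin_num); last first.
  rewrite ge0_fin_numE// -leNgt leye_eq => /eqP Ioo.
  have := key 1 ltr01; rewrite Ioo powR1 mulr1 gt0_muley ?lte_fin// leye_eq => /eqP JE.
  have [Jfin|] := boolP (J \is a fin_num); first by move: JE; rewrite -(fineK Jfin) -EFinD.
  rewrite ge0_fin_numE// -leNgt leye_eq => /eqP ->.
  by rewrite gt0_muley ?lte_fin ?powR_gt0// leey.
have [I00|In0] := eqVneq (fine I) 0.
  rewrite -(fineK Ifin) I00 poweR_EFin powR0 ?gt_eqF// mule_ge0// lee_fin ltW//.
have fI0 : 0 < fine I by rewrite lt_neqAle eq_sym In0 fine_ge0.
have [Jfin|] := boolP (J \is a fin_num); last first.
  rewrite ge0_fin_numE// -leNgt leye_eq => /eqP ->.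
  by rewrite gt0_muley ?lte_fin// leey.
have c0 : 0 < fine I / A by rewrite divr_gt0.
have := key _ c0; rewrite -(fineK Ifin) -(fineK Jfin) poweR_EFin -!EFinM -EFinD !lee_fin.
move: (fine I) (fine J) fI0 c0 => i j i0 c0.
have -> : p * (i / A) `^ (p - 1) * i = p * ((i / A) `^ p * A).
  have -> : (i / A) `^ p = (i / A) * (i / A) `^ (p - 1) by rewrite mulr_powRB1// ltW.
  by field; rewrite gt_eqF.
have -> : (p - 1) * (i / A) `^ p * A = (p - 1) * ((i / A) `^ p * A) by ring.
have iE : i `^ p = A `^ (p - 1) * ((i / A) `^ p * A).
  have -> : A `^ (p - 1) * ((i / A) `^ p * A) = (i / A) `^ p * (A * A `^ (p - 1)) by ring.
  by rewrite mulr_powRB1 ?ltW// -powRM ?divfK ?gt_eqF// ltW.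
rewrite iE => h; rewrite ler_pM2l//; move: h; lra.
Qed.

Definition conv N (k u : N.-tuple R -> R) (x : N.-tuple R) : \bar R :=
  (\int[muN N]_y (k (vsub x y) * u y)%:E)%E.

Lemma measurable_conv_integrand N (k u : N.-tuple R -> R) :
  measurable_fun setT k -> measurable_fun setT u ->
  measurable_fun setT (fun z : N.-tuple R * N.-tuple R => k (vsub z.1 z.2) * u z.2).
Proof.
move=> mk mu_; apply: measurable_funM.
  by apply: (measurableT_comp mk); apply: measurable_vsub.
exact: (measurableT_comp mu_ measurable_snd).
Qed.

Lemma measurable_conv N (k u : N.-tuple R -> R) :
  measurable_fun setT k -> measurable_fun setT u ->
  (forall z, 0 <= k z) -> (forall z, 0 <= u z) -> measurable_fun setT (conv k u).
Proof.
move=> mk mu_ k0 u0.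
apply: (@measurable_fun_fubini_tonelli_F _ _ _ _ _ (muN N)
  (fun z : N.-tuple R * N.-tuple R => (k (vsub z.1 z.2) * u z.2)%:E)).
  by apply/measurable_EFinP; exact: measurable_conv_integrand.
by move=> z; rewrite lee_fin mulr_ge0.
Qed.

Lemma vsubK N (x y : N.-tuple R) : vsub x (vsub x y) = y.
Proof. by apply: eq_from_tnth => i; rewrite !tnth_vsub; lra. Qed.

Lemma conv_comm N (k u : N.-tuple R -> R) x :
  measurable_fun setT k -> measurable_fun setT u ->
  (forall z, 0 <= k z) -> (forall z, 0 <= u z) -> conv k u x = conv u k x.
Proof.
move=> mk mu_ k0 u0; rewrite /conv.
rewrite -(@integral_vsub _ N x (fun y => (k (vsub x y) * u y)%:E)); last 2 first.
- apply/measurable_EFinP; apply: measurable_funM => //.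
  by apply: (measurableT_comp mk); apply: measurable_vsub.
- by move=> y; rewrite lee_fin mulr_ge0.
by apply: eq_integral => y _; rewrite vsubK mulrC.
Qed.

(** Minkowski's inequality, the L^1 norm of u times the supremum over y of the L^p norm of k(. - y)
    on [B], by Jensen and Tonelli. The supremum runs only over points with u(y) > 0, so that a [u]
    supported in a ball leads to a local statement. *)
Lemma conv_Lp N (k u : N.-tuple R -> R) (B : set (N.-tuple R)) (p A C : R) :
  1 <= p -> 0 < A -> 0 <= C -> measurable B ->
  measurable_fun setT k -> measurable_fun setT u ->
  (forall z, 0 <= k z) -> (forall z, 0 <= u z) ->
  (\int[muN N]_y (u y)%:E <= A%:E)%E ->
  (forall y, (0 < u y)%R -> \int[muN N]_x (\1_B x * k (vsub x y) `^ p)%:E <= C%:E)%E ->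
  (\int[muN N]_x ((\1_B x)%:E * poweR (conv k u x) p) <= (A `^ p * C)%:E)%E.
Proof.
move=> p1 A0 C0 mB mk mu_ k0 u0 uA kC; have p0 : 0 < p by lra.
have mkp : measurable_fun setT (fun x => k x `^ p).
  exact: (measurableT_comp (measurable_powR _) mk).
have mI : measurable_fun setT (\1_B : N.-tuple R -> R) by exact: measurable_indic.
pose F (z : N.-tuple R * N.-tuple R) : \bar R := (\1_B z.1 * k (vsub z.1 z.2) `^ p * u z.2)%:E.
have mF : measurable_fun setT F.
  apply/measurable_EFinP; apply: measurable_funM; last exact: measurableT_comp.
  apply: measurable_funM; first exact: measurableT_comp.
  by apply: (measurableT_comp mkp); apply: measurable_vsub.
have F0 z : (0 <= F z)%E by rewrite lee_fin !mulr_ge0 ?powR_ge0.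
apply: (@le_trans _ _ ((A `^ (p - 1))%:E * \int[muN N]_x \int[muN N]_y F (x, y))%E).
  rewrite -ge0_integralZl//; last 3 first.
  - exact: (@measurable_fun_fubini_tonelli_F _ _ _ _ _ (muN N) _ mF F0).
  - by move=> x _; apply: integral_ge0.
  - by rewrite lee_fin powR_ge0.
  apply: ge0_le_integral => //.
  - by move=> x _; rewrite mule_ge0 ?lee_fin ?poweR_ge0.
  - apply: emeasurable_funM; first exact/measurable_EFinP.
    apply: (measurableT_comp (measurable_poweR _)); exact: measurable_conv.
  - apply: emeasurable_funM => //.
    exact: (@measurable_fun_fubini_tonelli_F _ _ _ _ _ (muN N) _ mF F0).
  move=> x _; rewrite /F; under eq_integral do rewrite /= -mulrA.
  have mkx : measurable_fun setT (fun y => k (vsub x y)).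
    by apply: (measurableT_comp mk); apply: measurable_vsub.
  rewrite ge0_integralZ_real//; last 2 first.
  - by apply: measurable_funM => //; apply: (measurableT_comp (measurable_powR _) mkx).
  - by move=> y; rewrite mulr_ge0 ?powR_ge0.
  rewrite muleCA lee_wpmul2l ?lee_fin//; exact: jensen_powR.
rewrite (fubini_tonelli _ mF F0).
apply: (@le_trans _ _ ((A `^ (p - 1))%:E * \int[muN N]_y (C%:E * (u y)%:E))%E).
  rewrite lee_wpmul2l ?lee_fin ?powR_ge0//; apply: ge0_le_integral => //.
  - by move=> y _; apply: integral_ge0.
  - exact: (@measurable_fun_fubini_tonelli_G _ _ _ _ _ (muN N) _ mF F0).
  - by apply: emeasurable_funM => //; exact/measurable_EFinP.
  move=> y _; rewrite /F; under eq_integral do rewrite /= mulrC.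
  have mky : measurable_fun setT (fun x => k (vsub x y)).
    by apply: (measurableT_comp mk); apply: measurable_vsub.
  rewrite ge0_integralZ_real//; last 2 first.
  - by apply: measurable_funM => //; apply: (measurableT_comp (measurable_powR _) mky).
  - by move=> x; rewrite mulr_ge0 ?powR_ge0.
  rewrite muleC; have [uy|uy] := ltP 0 (u y); first by rewrite lee_wpmul2r ?lee_fin// kC.
  by have -> : u y = 0; [apply/eqP; rewrite eq_le uy u0|rewrite !mule0].
under eq_integral do rewrite -EFinM.
rewrite ge0_integralZ_real//.
have -> : (A `^ p * C)%:E = ((A `^ (p - 1))%:E * (C%:E * A%:E))%E.
  by rewrite -!EFinM; congr EFin; rewrite -[A `^ p](mulr_powRB1 (ltW A0) p0); ring.
by rewrite lee_wpmul2l ?lee_fin ?powR_ge0// lee_wpmul2l ?lee_fin.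
Qed.
End riesz_kernels.

(** * Integrals of negative powers of the norm over balls *)

Section riesz_kernel_balls.
Context {R : realType}.

(** The convention for the inverse of 0 gives the value 0 at the origin for m > 0, and 1 for m =
    0. *)
Definition kern (N m : nat) (z : N.-tuple R) : R := (enorm z ^+ m)^-1.

Lemma kern_ge0 N m (z : N.-tuple R) : 0 <= kern m z.
Proof. by rewrite invr_ge0 exprn_ge0// enorm_ge0. Qed.

Lemma measurable_kern N m : measurable_fun setT (@kern N m).
Proof.
have -> : @kern N m = (fun z => (enorm z ^+ m) `^ (-1)).
  by apply/funext => z; rewrite powR_inv1// exprn_ge0// enorm_ge0.
apply: (measurableT_comp (measurable_powR _)); apply: measurable_funX.
exact: measurable_enorm.
Qed.

Lemma kern_powR N m (p : R) (z : N.-tuple R) : 0 < enorm z ->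
  kern m z `^ p = enorm z `^ (- (m%:R * p)).
Proof.
move=> z0; rewrite /kern -powR_inv1 ?exprn_ge0 ?ltW// -powR_mulrn ?ltW// -!powRrM.
by congr powR; ring.
Qed.

Lemma kern_powR_le N m (p s : R) (z : N.-tuple R) : 0 <= p -> 0 < s -> s <= enorm z ->
  kern m z `^ p <= s `^ (- (m%:R * p)).
Proof.
move=> p0 s0 sz; have z0 : 0 < enorm z by exact: lt_le_trans sz.
have mp : 0 <= m%:R * p by rewrite mulr_ge0.
rewrite kern_powR// !powRN lef_pV2 ?posrE ?powR_gt0//.
by apply: ge0_ler_powR; rewrite ?nnegrE// ltW.
Qed.

(** A dyadic decomposition instead of polar coordinates: with radii rho_k = r 2^-k, the integrand at
    z is bounded by the single term [F k z] for the least k with rho_(k+1) <= |z|. The integrals of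
    the terms are dominated by a geometric series of ratio x = 2^(mp-N). *)
Lemma kern_ball_integral N m (p : R) : 0 < p -> m%:R * p < N%:R ->
  exists2 C : R, 0 < C & forall r : R, 0 < r ->
    (\int[muN N]_z (\1_(ballO r) z * kern m z `^ p)%:E <= (C * r `^ (N%:R - m%:R * p))%:E)%E.
Proof.
move=> p0 mpN; set b : R := m%:R * p; set e : R := N%:R - b.
have b0 : 0 <= b by rewrite mulr_ge0// ltW.
have e0 : 0 < e by rewrite subr_gt0.
pose x : R := 2^-1 `^ e.
have x0 : 0 < x by rewrite powR_gt0.
have x1 : x < 1.
  have <- : 1 `^ e = 1 :> R by rewrite powR1.
  apply: gt0_ltr_powR; rewrite ?nnegrE//; lra.
pose c : R := 2 `^ b * 2 ^+ N.
have c0 : 0 < c by rewrite mulr_gt0 ?powR_gt0 ?exprn_gt0.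
exists (c / (1 - x)); first by rewrite divr_gt0// subr_gt0.
move=> r r0; pose rho (k : nat) : R := r * 2^-1 ^+ k.
have rho0 k : 0 < rho k by rewrite mulr_gt0// exprn_gt0.
pose F (k : nat) (z : N.-tuple R) : \bar R := ((rho k / 2) `^ (- b) * \1_(ballO (rho k)) z)%:E.
have mI k : measurable_fun setT (\1_(ballO (rho k)) : N.-tuple R -> R).
  by apply: measurable_indic; exact: measurable_ballO.
have F0 k z : (0 <= F k z)%E by rewrite lee_fin mulr_ge0 ?powR_ge0.
have mF k : measurable_fun setT (F k) by apply/measurable_EFinP; exact: measurable_funM.
apply: (@le_trans _ _ (\int[muN N]_z \sum_(k <oo) F k z)%E).
  apply: ge0_le_integral => //.
  - by move=> z _; rewrite lee_fin mulr_ge0 ?powR_ge0.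
  - apply/measurable_EFinP; apply: measurable_funM.
      by apply: measurable_indic; exact: measurable_ballO.
    exact: (measurableT_comp (measurable_powR _) (@measurable_kern N m)).
  - by apply: ge0_emeasurable_sum => // k z _.
  move=> z _.
  have Fk k : (F k z <= \sum_(k <oo) F k z)%E.
    apply: le_trans (nneseries_lim_ge k.+1 _) => //.
    by rewrite big_nat_recr//= leeDr// sume_ge0.
  have [zr|zr] := ltP (enorm z) r; last first.
    rewrite indicE memNset ?mul0r; last by rewrite /ballO/=; apply/negP; rewrite -leNgt.
    by apply: nneseries_ge0.
  rewrite indicE mem_set// mul1r.
  (* No shell contains the origin; the conventional value of [kern] there is covered by the term k =
     0. *)
  have [z0|z0] := eqVneq (enorm z) 0.
    apply: le_trans (Fk 0%N); rewrite lee_fin indicE mem_set ?mulr1; last first.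
      by rewrite /ballO/= z0.
    rewrite /kern z0; have [m0|m0] := eqVneq m 0%N.
      by rewrite /b m0 expr0 invr1 powR1 mul0r oppr0 powRr0.
    by rewrite expr0n (negbTE m0) invr0 powR0 ?powR_ge0// gt_eqF.
  have zp : 0 < enorm z by rewrite lt_neqAle eq_sym z0 enorm_ge0.
  have [k] : exists k, rho k.+1 <= enorm z.
    have : rho k @[k --> \oo] --> (0 : R).
      rewrite -[X in _ --> X](mulr0 r); apply: cvgM; first exact: cvg_cst.
      by apply: cvg_expr; rewrite ger0_norm; lra.
    move=> /cvgrPdist_lt /(_ _ zp) [k _ /(_ k.+1 (leqnSn k))].
    by rewrite sub0r normrN gtr0_norm// => /ltW ?; exists k.
  move=> /[dup] hk _; have hex : exists k, rho k.+1 <= enorm z by exists k.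
  case: (ex_minnP hex) => n hn nmin; apply: le_trans (Fk n).
  have zn : enorm z < rho n.
    case: n hn nmin => [|n] hn nmin; first by rewrite /rho expr0 mulr1.
    by rewrite ltNge; apply/negP => /nmin; rewrite ltnn.
  rewrite lee_fin indicE mem_set// mulr1; apply: kern_powR_le; first exact: ltW.
    by rewrite divr_gt0.
  by apply: le_trans hn; rewrite /rho exprSr mulrA.
rewrite integral_nneseries//.
apply: (@le_trans _ _ (\sum_(k <oo) (c * r `^ e * x ^+ k)%:E)%E).
  apply: lee_nneseries => [k _ _|k _]; first by apply: integral_ge0.
  rewrite ge0_integralZ_real//; last by rewrite powR_ge0.
  rewrite integral_indic ?setIT//; last exact: measurable_ballO.
  apply: le_trans (lee_wpmul2l _ (muN_ball_le N (rho0 k))) _; first by rewrite lee_fin powR_ge0.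
  rewrite -EFinM lee_fin.
  have -> : (rho k / 2) `^ (- b) = rho k `^ (- b) * 2 `^ b.
    by rewrite powRM ?ltW// -[2^-1]powR_inv1// -powRrM mulrNN mul1r.
  have -> : (2 * rho k) ^+ N = 2 ^+ N * rho k `^ N%:R by rewrite exprMn powR_mulrn// ltW.
  have -> : x ^+ k = (2^-1 ^+ k) `^ e.
    by rewrite -powR_mulrn ?powR_ge0// -powRrM mulrC powRrM powR_mulrn.
  have i0 : 0 <= 2^-1 ^+ k :> R by rewrite exprn_ge0.
  have -> : c * r `^ e * (2^-1 ^+ k) `^ e = c * rho k `^ e.
    by rewrite -mulrA -(powRM _ (ltW r0) i0).
  have -> : rho k `^ e = rho k `^ N%:R * rho k `^ (- b).
    by rewrite -powRD//; apply/implyP => _; rewrite gt_eqF.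
  by rewrite le_eqVlt; apply/orP; left; apply/eqP; rewrite /c; ring.
apply: lime_le; first by apply: is_cvg_nneseries => k _ _; rewrite lee_fin !mulr_ge0 ?exprn_ge0 ?powR_ge0 ?ltW.
near=> n; rewrite sumEFin lee_fin -mulr_sumr.
have -> : \sum_(0 <= i < n) x ^+ i = (1 - x ^+ n) / (1 - x).
  have := @geometric_seriesE R 1 x (negbT (lt_eqF x1)).
  move=> /(congr1 (fun f => f n)); rewrite /series/= mul1r => <-.
  by apply: eq_bigr => i _; rewrite mul1r.
have -> : c / (1 - x) * r `^ e = c * r `^ e * (1 / (1 - x)) by ring.
rewrite ler_wpM2l ?mulr_ge0 ?powR_ge0 ?(ltW c0)// ler_wpM2r ?invr_ge0//; first by lra.
by rewrite lerBlDr lerDl exprn_ge0// ltW.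
Unshelve. all: end_near. Qed.

(** Uniform in the centre: where |x-y| < r, translate to the centred integral; elsewhere in the ball
    the integrand is at most r^(-mp), and the cube bound for the volume adds 2^N to the constant. *)
Lemma kern_ball_integral_shift N m (p : R) : 0 < p -> m%:R * p < N%:R ->
  exists2 C : R, 0 < C & forall (r : R) (y : N.-tuple R), 0 < r ->
    (\int[muN N]_x (\1_(ballO r) x * kern m (vsub x y) `^ p)%:E <= (C * r `^ (N%:R - m%:R * p))%:E)%E.
Proof.
move=> p0 mpN; have [C C0 hC] := kern_ball_integral p0 mpN.
exists (C + 2 ^+ N); first by rewrite addr_gt0// exprn_gt0.
move=> r y r0.
have mI : measurable_fun setT (\1_(ballO r) : N.-tuple R -> R).
  by apply: measurable_indic; exact: measurable_ballO.
have mkp : measurable_fun setT (fun z : N.-tuple R => kern m z `^ p).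
  exact: (measurableT_comp (measurable_powR _) (@measurable_kern N m)).
have mv : measurable_fun setT (fun x : N.-tuple R => vsub x y).
  by apply: measurable_vsub.
have mIk : measurable_fun setT (fun z : N.-tuple R => \1_(ballO r) z * kern m z `^ p).
  exact: measurable_funM.
apply: (@le_trans _ _ (\int[muN N]_x (\1_(ballO r) (vsub x y) * kern m (vsub x y) `^ p
   + r `^ (- (m%:R * p)) * \1_(ballO r) x)%:E)%E).
  apply: ge0_le_integral_real => [|||x].
  - exact: (measurable_funM mI (measurableT_comp mkp mv)).
  - apply: measurable_funD; first exact: (measurableT_comp mIk mv).
    exact: measurable_funM.
  - by move=> x; rewrite mulr_ge0 ?powR_ge0.
  rewrite [\1_(ballO r) (vsub x y)]indicE; have [xy|xy] := boolP (vsub x y \in _).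
    rewrite mul1r -[leLHS]addr0 lerD ?mulr_ge0 ?powR_ge0//.
    by rewrite -[leRHS]mul1r ler_wpM2r ?powR_ge0// indicE lern1; case: (_ \in _).
  rewrite mul0r add0r mulrC ler_wpM2r//; apply: kern_powR_le; [exact: ltW|exact: r0|].
  by rewrite leNgt; apply/negP => h; apply: (negP xy); rewrite inE.
have mS : measurable_fun setT (fun x => \1_(ballO r) (vsub x y) * kern m (vsub x y) `^ p).
  exact: (measurableT_comp mIk mv).
have mS2 : measurable_fun setT (fun x : N.-tuple R => r `^ (- (m%:R * p)) * \1_(ballO r) x).
  exact: measurable_funM.
rewrite (ge0_integralD_real _ mS mS2); last 2 first.
- by move=> x; rewrite mulr_ge0 ?powR_ge0.
- by move=> x; rewrite mulr_ge0 ?powR_ge0.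
rewrite mulrDl EFinD leeD//.
  rewrite (@integral_vsubr _ N y (fun z => (\1_(ballO r) z * kern m z `^ p)%:E)).
  - exact: hC.
  - by apply/measurable_EFinP; exact: mIk.
  - by move=> z; rewrite lee_fin mulr_ge0 ?powR_ge0.
rewrite ge0_integralZ_real ?powR_ge0// integral_indic ?setIT//; last exact: measurable_ballO.
apply: le_trans (lee_wpmul2l _ (muN_ball_le N r0)) _; first by rewrite lee_fin powR_ge0.
rewrite -EFinM lee_fin powRD; last by apply/implyP => _; rewrite gt_eqF.
rewrite exprMn powR_mulrn ?(ltW r0)// le_eqVlt; apply/orP; left; apply/eqP; ring.
Qed.
End riesz_kernel_balls.

(** * Gaussian integrals and their Fourier transforms *)

Section gaussian_mass.
Context {R : realType}.
Notation mu := (@lebesgue_measure R).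
Variable e : R.
Hypothesis e0 : 0 < e.

Definition gE (w : R) := expR (- (e * w ^+ 2)).

Lemma gE_normal w : gE w = Num.sqrt (pi / e) * normal_pdf 0 (Num.sqrt (2 * e)^-1) w.
Proof.
have s0 : 0 < (2 * e)^-1 by rewrite invr_gt0 mulr_gt0.
have pe : 0 < pi / e by rewrite divr_gt0// pi_gt0.
rewrite normal_pdfE; last by rewrite gt_eqF// sqrtr_gt0.
rewrite /normal_peak /normal_fun subr0 sqr_sqrtr ?ltW//.
have -> : ((2 * e)^-1 * pi) *+ 2 = pi / e by rewrite mulr2n; field; rewrite gt_eqF.
have -> : (2 * e)^-1 *+ 2 = e^-1 by rewrite mulr2n; field; rewrite gt_eqF.
rewrite mulrA mulfV ?mul1r ?gt_eqF ?sqrtr_gt0// /gE; congr expR.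
by rewrite invrK mulNr mulrC.
Qed.

Lemma gE_gt0 w : 0 < gE w. Proof. exact: expR_gt0. Qed.

Lemma continuous_gE : continuous gE.
Proof.
move=> x; apply: (@continuous_comp _ _ _ (fun x : R => - (e * x ^+ 2)) expR).
  by apply: cvgN; apply: cvgM; [exact: cvg_cst|exact: exprn_continuous].
exact: continuous_expR.
Qed.

Lemma measurable_gE : measurable_fun setT gE.
Proof. exact: continuous_measurable_fun continuous_gE. Qed.

Lemma integrable_gE : mu.-integrable setT (EFin \o gE).
Proof.
have -> : EFin \o gE = fun w => ((Num.sqrt (pi / e))%:E * (normal_pdf 0 (Num.sqrt (2 * e)^-1) w)%:E)%E.
  by apply/funext => w /=; rewrite gE_normal EFinM.
by apply: integrableZl => //; exact: integrable_normal_pdf.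
Qed.

Lemma integral_gE : (\int[mu]_w (gE w)%:E)%E = (Num.sqrt (pi / e))%:E.
Proof.
under eq_integral do rewrite gE_normal EFinM.
by rewrite integralZl//= ?integral_normal_pdf ?mule1//; exact: integrable_normal_pdf.
Qed.
End gaussian_mass.

Section gaussian_cosine_transform.
Context {R : realType}.
Notation mu := (@lebesgue_measure R).
Variable e : R.
Hypothesis e0 : 0 < e.

(** Half of the exponent absorbs the factor |w|: the constant satisfies C >= 1 and C e / 2 >= 1,
    whence |w| <= C (1 + e w^2 / 2). This function dominates the differentiated cosine integral in
    [derive_phi]. *)
Lemma integrable_wgE : mu.-integrable setT (EFin \o (fun w => `|w| * gE e w)).
Proof.
have e2 : 0 < e / 2 by rewrite divr_gt0.
pose C := Num.max 1 (2 / e).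
have ig : mu.-integrable setT (fun w => (C%:E * (gE (e / 2) w)%:E)%E).
  by apply: integrableZl => //; exact: integrable_gE.
apply: le_integrable ig => //.
  apply/measurable_EFinP; apply: measurable_funM; last exact: measurable_gE.
  by apply: continuous_measurable_fun => x; exact: norm_continuous.
move=> w _ /=; rewrite lee_fin [leLHS]ger0_norm ?mulr_ge0 ?expR_ge0//.
apply: le_trans (ler_norm _).
have -> : gE e w = gE (e / 2) w * gE (e / 2) w by rewrite -expRD; congr expR; lra.
rewrite mulrA ler_wpM2r ?expR_ge0//.
rewrite /gE expRN ler_pdivrMr ?expR_gt0//.
have h1 : 1 + e / 2 * w ^+ 2 <= expR (e / 2 * w ^+ 2) by exact: expR_ge1Dx.
have C1 : 1 <= C by rewrite le_max lexx.
have C2 : 1 <= C * (e / 2).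
  by rewrite -ler_pdivrMr// mul1r invf_div le_max lexx orbT.
apply: le_trans (_ : C * (1 + e / 2 * w ^+ 2) <= _); last by rewrite ler_wpM2l//; lra.
have -> : w ^+ 2 = `|w| ^+ 2 by rewrite real_normK ?num_real.
move: (`|w|) (normr_ge0 w) => x x0.
have h3 : x ^+ 2 <= C * (e / 2) * x ^+ 2 by rewrite ler_peMl// exprn_ge0.
have h4 : 0 <= (x - 1) ^+ 2 by exact: sqr_ge0.
have -> : C * (1 + e / 2 * x ^+ 2) = C + C * (e / 2) * x ^+ 2 by ring.
move: h3 h4 C1 {C2}; rewrite !expr2; move: (C * (e / 2)) => c; nra.
Qed.

Lemma measurable_cos_lin (z : R) : measurable_fun setT (fun w : R => cos (w * z)).
Proof.
apply: continuous_measurable_fun => x; apply: (@continuous_comp _ _ _ (fun w : R => w * z) cos).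
  by apply: cvgM; [exact: cvg_id|exact: cvg_cst].
exact: continuous_cos.
Qed.

Lemma measurable_sin_lin (z : R) : measurable_fun setT (fun w : R => sin (w * z)).
Proof.
apply: continuous_measurable_fun => x; apply: (@continuous_comp _ _ _ (fun w : R => w * z) sin).
  by apply: cvgM; [exact: cvg_id|exact: cvg_cst].
exact: continuous_sin.
Qed.

Lemma integrable_gE_cos z : mu.-integrable setT (EFin \o (fun w => gE e w * cos (w * z))).
Proof.
apply: le_integrable (integrable_gE e0) => //.
  apply/measurable_EFinP; apply: measurable_funM; [exact: measurable_gE|exact: measurable_cos_lin].
move=> w _ /=; rewrite lee_fin normrM -[leRHS]mulr1 ler_wpM2l//; exact: cos_max.
Qed.

Lemma integrable_gE_sin z : mu.-integrable setT (EFin \o (fun w => gE e w * sin (w * z))).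
Proof.
apply: le_integrable (integrable_gE e0) => //.
  apply/measurable_EFinP; apply: measurable_funM; [exact: measurable_gE|exact: measurable_sin_lin].
move=> w _ /=; rewrite lee_fin normrM -[leRHS]mulr1 ler_wpM2l//; exact: sin_max.
Qed.

Lemma integrable_wgE_sin z : mu.-integrable setT (EFin \o (fun w => w * gE e w * sin (w * z))).
Proof.
apply: le_integrable integrable_wgE => //.
  apply/measurable_EFinP; apply: measurable_funM; last exact: measurable_sin_lin.
  by apply: measurable_funM => //; exact: measurable_gE.
move=> w _ /=; rewrite lee_fin !normrM normr_id -[leRHS]mulr1 ler_wpM2l ?mulr_ge0//; exact: sin_max.
Qed.

Let phi (z : R) := \int[mu]_w (gE e w * cos (w * z)).

Lemma is_derive_gE_cos (x w : R) :
  is_derive x 1 (fun x : R => gE e w * cos (w * x)) (- (w * gE e w * sin (w * x))).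
Proof.
have d1 : is_derive x 1 (fun x : R => w * x) w by apply: is_derive_eq; rewrite /GRing.scale /= ?mulr1.
have d2 := is_derive1_comp (is_derive_cos (w * x)) d1.
have := is_deriveM (is_derive_cst (gE e w) x 1) d2.
rewrite /GRing.scale/= mulr0 addr0 => h; apply: is_derive_eq h _; ring.
Qed.

Lemma derive_phi (z : R) : is_derive z 1 phi (- \int[mu]_w (w * gE e w * sin (w * z))).
Proof.
pose f (x w : R) := gE e w * cos (w * x).
have d1f x w : partial1of2 f x w = - (w * gE e w * sin (w * x)).
  by rewrite partial1of2E; have [] := is_derive_gE_cos x w.
have zI : `](z - 1), (z + 1)[%classic z by rewrite /= in_itv/=; apply/andP; split; lra.
have hi x : `](z - 1), (z + 1)[%classic x -> mu.-integrable setT (EFin \o f x).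
  by move=> _; exact: integrable_gE_cos.
have hd x w : `](z - 1), (z + 1)[%classic x -> setT w -> derivable (f ^~ w) x 1.
  by move=> _ _; have [] := is_derive_gE_cos x w.
have G0 w : 0 <= `|w| * gE e w by rewrite mulr_ge0// expR_ge0.
have hG x w : `](z - 1), (z + 1)[%classic x -> setT w -> `|partial1of2 f x w| <= `|w| * gE e w.
  move=> _ _; rewrite d1f normrN !normrM -[leRHS]mulr1 ler_pM ?mulr_ge0 ?sin_max//.
  by rewrite [X in _ * X]ger0_norm// expR_ge0.
have dphi := @derivable_under_integral R _ _ mu f setT measurableT z (z - 1) (z + 1) zI hi hd _ G0 integrable_wgE hG.
have ephi := @differentiation_under_integral R _ _ mu f setT measurableT z (z - 1) (z + 1) zI hi hd _ G0 integrable_wgE hG.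
split; first exact: dphi.
rewrite -derive1E ephi -mulN1r -RintegralZl//; last exact: integrable_wgE_sin.
by apply: eq_Rintegral => w _; rewrite d1f mulN1r.
Qed.

Lemma gE_sin_cvg0 (z : R) (s : R) : s = 1 \/ s = -1 ->
  gE e (s * n.+1%:R) * sin (s * n.+1%:R * z) @[n --> \oo] --> (0 : R).
Proof.
move=> hs; apply: norm_cvg0.
apply: (@squeeze_cvgr _ _ _ _ (fun=> 0) (fun n : nat => expR (- e) ^+ n)).
- near=> n; rewrite normr_ge0/= normrM; apply: (@le_trans _ _ (gE e (s * n.+1%:R))).
    rewrite -[leRHS]mulr1 (ger0_norm (ltW (gE_gt0 _ _))).
    by rewrite ler_wpM2l ?sin_max// ltW// gE_gt0.
  rewrite -expRM_natl ler_expR mulrN lerN2.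
  have -> : (s * n.+1%:R) ^+ 2 = n.+1%:R ^+ 2 by case: hs => ->; ring.
  rewrite mulrC ler_wpM2l ?(ltW e0)// expr2 -natrM ler_nat.
  by rewrite mulSn (leq_trans (leqnSn n))// leq_addr.
- exact: cvg_cst.
- apply: cvg_expr; rewrite ger0_norm ?expR_ge0//.
  by rewrite -expR0 ltr_expR ltrNl oppr0.
Unshelve. all: end_near. Qed.

(* Integration by parts for the odd function gE * sin, whose boundary terms vanish. *)
Lemma gE_by_parts (z : R) :
  2 * e * \int[mu]_w (w * gE e w * sin (w * z)) = z * phi z.
Proof.
pose h (w : R) := gE e w * sin (w * z).
pose h' (w : R) := z * (gE e w * cos (w * z)) - 2 * e * (w * gE e w * sin (w * z)).
have ih' : mu.-integrable setT (EFin \o h').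
  have i1 := integrableZl measurableT z (integrable_gE_cos z).
  have i2 := integrableZl measurableT (2 * e) (integrable_wgE_sin z).
  exact: (integrableB measurableT i1 i2).
have dh (w : R) : is_derive w 1 h (h' w).
  have d1 : is_derive w 1 (fun x : R => x * z) z.
    by apply: is_derive_eq; rewrite /GRing.scale /=; ring.
  have d2 := @is_derive1_comp R sin (fun x : R => x * z) w _ _ (is_derive_sin (w * z)) d1.
  have d3 : is_derive w 1 (fun x : R => - (e * x ^+ 2)) (- (e * (2 * w))).
    by apply: is_derive_eq; rewrite /GRing.scale /=; ring.
  have d4 := @is_derive1_comp R expR (fun x : R => - (e * x ^+ 2)) w _ _ (is_derive_expR (- (e * w ^+ 2))) d3.
  have := is_deriveM d4 d2.
  by rewrite /GRing.scale/= => hh; apply: is_derive_eq hh _; rewrite /h' /gE/=; ring.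
have ch' : continuous h'.
  move=> w; apply: cvgB; apply: cvgM; (try exact: cvg_cst); apply: cvgM.
  - exact: continuous_gE.
  - apply: (@continuous_comp _ _ _ (fun w : R => w * z) cos); last exact: continuous_cos.
    by apply: cvgM; [exact: cvg_id|exact: cvg_cst].
  - by apply: cvgM; [exact: cvg_id|exact: continuous_gE].
  - apply: (@continuous_comp _ _ _ (fun w : R => w * z) sin); last exact: continuous_sin.
    by apply: cvgM; [exact: cvg_id|exact: cvg_cst].
have ch : continuous h.
  by move=> w; apply: differentiable_continuous; apply/derivable1_diffP; have [] := dh w.
have FTC (n : nat) : (\int[mu]_(w in `[(- n.+1%:R)%R, n.+1%:R%R]) (h' w)%:E = (h n.+1%:R%R)%:E - (h (- n.+1%:R)%R)%:E)%E.
  have n0 : (0 : R) < n.+1%:R by rewrite ltr0n.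
  apply: continuous_FTC2; first by lra.
  - by apply: continuous_subspaceT.
  - split; first by move=> w _; have [] := dh w.
    + by apply/cvg_at_right_filter; exact: ch.
    + by apply/cvg_at_left_filter; exact: ch.
  - by move=> w _; rewrite derive1E; have [] := dh w.
have c1 : (\int[mu]_(w in `[(- n.+1%:R)%R, n.+1%:R%R]) (h' w)%:E @[n --> \oo] --> \int[mu]_w (h' w)%:E)%E.
  under eq_fun do rewrite integral_mkcond.
  apply: (@dominated_cvg _ _ _ mu setT measurableT _ _ (fun w => `|h' w|%:E)).
  - move=> n; apply/measurable_restrict => //=.
    apply: measurable_funTS; apply/measurable_EFinP; exact: continuous_measurable_fun ch'.
  - move=> w _; apply: cvg_near_cst.
    near=> n; rewrite patchE mem_set//= in_itv/= -ler_norml.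
    near: n; exists (Num.truncn `|w|) => // n /= hn.
    by apply: le_trans (ltW (truncnS_gt _)) _; rewrite ler_nat.
  - by [].
  - by move/integrable_norm : ih'.
  - move=> n w _; rewrite patchE; case: ifPn => _; first by rewrite lee_fin.
    by rewrite abse0 lee_fin.
have c2 : (\int[mu]_(w in `[(- n.+1%:R)%R, n.+1%:R%R]) (h' w)%:E @[n --> \oo] --> (0 : \bar R))%E.
  under eq_fun do rewrite FTC -EFinB; apply: cvg_EFin; first exact: nearW.
  rewrite -[X in _ --> X](subr0 0); apply: cvgB.
  - have := gE_sin_cvg0 z (or_introl erefl : 1 = 1 :> R \/ 1 = -1).
    by under eq_fun do rewrite mul1r.
  - have := gE_sin_cvg0 z (or_intror erefl : -1 = 1 :> R \/ -1 = -1).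
    by under eq_fun do rewrite mulN1r.
have I0 : (\int[mu]_w (h' w)%:E = 0)%E.
  by rewrite -(cvg_lim _ c1)//; apply: cvg_lim.
have := congr1 fine I0; rewrite -/(Rintegral mu setT h') /h' RintegralB//; last 2 first.
- exact: (integrableZl measurableT z (integrable_gE_cos z)).
- exact: (integrableZl measurableT (2 * e) (integrable_wgE_sin z)).
rewrite !RintegralZl//; [|exact: integrable_wgE_sin|exact: integrable_gE_cos].
by move=> /eqP; rewrite subr_eq0 => /eqP.
Unshelve. all: end_near. Qed.

(** By [derive_phi] and [gE_by_parts] the transform solves phi' = - z phi / (2e), so phi(z)
    e^(z^2/(4e)) is constant, equal to the Gaussian mass. *)
Lemma gaussian_cos (z : R) :
  \int[mu]_w (gE e w * cos (w * z)) = Num.sqrt (pi / e) * expR (- (z ^+ 2 / (4 * e))).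
Proof.
pose psi (z : R) := phi z * expR (z ^+ 2 / (4 * e)).
have dpsi (x : R) : is_derive x 1 psi 0.
  have d1 : is_derive x 1 (fun x : R => x ^+ 2 / (4 * e)) (2 * x / (4 * e)).
    by apply: is_derive_eq; rewrite /GRing.scale /=; ring.
  have d2 := @is_derive1_comp R expR (fun x : R => x ^+ 2 / (4 * e)) x _ _ (is_derive_expR _) d1.
  have := is_deriveM (derive_phi x) d2.
  rewrite /GRing.scale/= => h; apply: is_derive_eq h _.
  have := gE_by_parts x; set I := \int[mu]_w _ => hI.
  have -> : I = x * phi x / (2 * e) by rewrite -hI mulrAC mulfV ?mul1r// gt_eqF// mulr_gt0.
  by field; rewrite gt_eqF.
have : psi z = psi 0 by exact: is_derive_0_is_cst.
rewrite /psi expr0n/= mul0r expR0 mulr1.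
have -> : phi 0 = Num.sqrt (pi / e).
  rewrite /phi; under eq_Rintegral do rewrite mulr0 cos0 mulr1.
  by rewrite /Rintegral integral_gE.
by move=> <-; rewrite -mulrA -expRD subrr expR0 mulr1.
Qed.

Lemma gaussian_sin (z : R) : \int[mu]_w (gE e w * sin (w * z)) = 0.
Proof.
pose f (w : R) := (gE e w * sin (w * z))%:E.
have if_ : mu.-integrable setT f by exact: integrable_gE_sin.
have mf : measurable_fun setT f by have /integrableP[] := if_.
have odd w : f (0 - w) = (- f w)%E.
  by rewrite /f /gE sub0r sqrrN mulNr sinN mulrN EFinN.
have E : (\int[mu]_w f^\+ w = \int[mu]_w f^\- w)%E.
  rewrite -(integral_reflect 0) => [|//|w]; last 2 first.
  - exact: measurable_funepos.
  - exact: funepos_ge0.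
  by apply: eq_integral => w _; rewrite funeposE funenegE odd.
have fin : (\int[mu]_w f^\- w)%E \is a fin_num.
  by apply: integrable_fin_num => //; exact: integrable_funeneg.
by rewrite /Rintegral integralE -/f E subee.
Qed.
End gaussian_cosine_transform.

Section gaussian_tuples.
Context {R : realType}.
Notation mu := (@lebesgue_measure R).

Definition gN (e : R) N (w : N.-tuple R) := expR (- (e * enorm w ^+ 2)).
(** The Fourier transform of [gN e], which is (2 pi)^N times the heat kernel at time [e]; this
    normalisation is kept until the comparison with [Z]. *)
Definition gam (e : R) N (z : N.-tuple R) :=
  Num.sqrt (pi / e) ^+ N * expR (- (enorm z ^+ 2 / (4 * e))).

Lemma enorm_sqr N (w : N.-tuple R) : enorm w ^+ 2 = \sum_(i < N) tnth w i ^+ 2.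
Proof.
rewrite sqr_sqrtr; first by apply: eq_bigr => i _; rewrite expr2.
by apply: sumr_ge0 => i _; rewrite -expr2 sqr_ge0.
Qed.

Lemma vdot_cons N (x : R) (y : N.-tuple R) (z : N.+1.-tuple R) :
  vdot (cons_tuple x y) z = x * thead z + vdot y (behead_tuple z).
Proof.
rewrite /vdot big_ord_recl; congr (_ * _ + _).
by apply: eq_bigr => i _; rewrite tnthS {1}(tuple_eta z) tnthS.
Qed.

Lemma enorm_sqr_cons N (x : R) (y : N.-tuple R) :
  enorm (cons_tuple x y) ^+ 2 = x ^+ 2 + enorm y ^+ 2.
Proof.
rewrite !enorm_sqr big_ord_recl; congr (_ + _).
by apply: eq_bigr => i _; rewrite tnthS.
Qed.

Lemma enorm_sqr_eta N (z : N.+1.-tuple R) :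
  enorm z ^+ 2 = thead z ^+ 2 + enorm (behead_tuple z) ^+ 2.
Proof.
rewrite -enorm_sqr_cons; congr (enorm _ ^+ 2).
by rewrite {1}(tuple_eta z); apply: val_inj.
Qed.

Lemma gN_cons (e : R) N (x : R) (y : N.-tuple R) : gN e (cons_tuple x y) = gE e x * gN e y.
Proof. by rewrite /gN enorm_sqr_cons mulrDr opprD expRD. Qed.

Lemma gN_gt0 (e : R) N (w : N.-tuple R) : 0 < gN e w.
Proof. exact: expR_gt0. Qed.

Lemma measurable_gN (e : R) N : measurable_fun setT (@gN e N).
Proof.
apply: (measurableT_comp (@measurable_expR R)).
apply: measurable_funN; apply: measurable_funM => //.
by apply: measurable_funX; exact: measurable_enorm.
Qed.

Lemma measurable_cosT d (T : measurableType d) (f : T -> R) :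
  measurable_fun setT f -> measurable_fun setT (fun x => cos (f x)).
Proof. exact: (measurableT_comp (continuous_measurable_fun (@continuous_cos R))). Qed.

Lemma measurable_sinT d (T : measurableType d) (f : T -> R) :
  measurable_fun setT f -> measurable_fun setT (fun x => sin (f x)).
Proof. exact: (measurableT_comp (continuous_measurable_fun (@continuous_sin R))). Qed.

Lemma integral_gE_cos_shift (e : R) : 0 < e -> forall (c z b : R), `|c| <= 1 ->
  (\int[mu]_x (gE e x * (1 + c * cos (x * z + b)))%:E =
   (Num.sqrt (pi / e) * (1 + c * cos b * expR (- (z ^+ 2 / (4 * e)))))%:E)%E.
Proof.
move=> e0 c z b c1.
have i0 := integrable_gE e0; have ic := integrable_gE_cos e0 z; have is_ := integrable_gE_sin e0 z.
have E (x : R) : gE e x * (1 + c * cos (x * z + b)) =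
  gE e x + ((c * cos b) * (gE e x * cos (x * z)) - (c * sin b) * (gE e x * sin (x * z))).
  by rewrite cosD; ring.
under eq_integral do rewrite E EFinD EFinB (EFinM (c * cos b)) (EFinM (c * sin b)).
have i1 := integrableZl measurableT (c * cos b) ic.
have i2 := integrableZl measurableT (c * sin b) is_.
have i3 := integrableB measurableT i1 i2.
rewrite (integralD measurableT i0 i3) (integralB measurableT i1 i2).
rewrite (integralZl measurableT ic) (integralZl measurableT is_) integral_gE//.
have -> : (\int[mu]_x (gE e x * cos (x * z))%:E = (Num.sqrt (pi / e) * expR (- (z ^+ 2 / (4 * e))))%:E)%E.
  by rewrite -(gaussian_cos e0) /Rintegral fineK//; exact: integrable_fin_num.
have -> : (\int[mu]_x (gE e x * sin (x * z))%:E = 0%:E)%E.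
  by rewrite -(gaussian_sin e0 z) /Rintegral fineK//; exact: integrable_fin_num.
by rewrite -!EFinM -EFinB -EFinD; congr EFin; ring.
Qed.

(* The phase b is generalised for the induction, and 1 + cos >= 0 keeps every integrand nonnegative. *)
Lemma intRN_gN_cos (e : R) : 0 < e -> forall N (z : N.-tuple R) (b c : R), `|c| <= 1 ->
  intRN (fun w : N.-tuple R => (gN e w * (1 + c * cos (vdot w z + b)))%:E) =
  (Num.sqrt (pi / e) ^+ N * (1 + c * cos b * expR (- (enorm z ^+ 2 / (4 * e)))))%:E.
Proof.
move=> e0; elim=> [|N IH] z b c c1 /=.
  rewrite /gN /vdot !enorm_sqr !big_ord0 mulr0 mul0r oppr0 expR0 expr0 add0r.
  by rewrite !mul1r mulr1.
have ge0 M (z' : M.-tuple R) b' (w : M.-tuple R) : 0 <= gN e w * (1 + c * cos (vdot w z' + b')).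
  rewrite mulr_ge0 ?(ltW (gN_gt0 _ _))//.
  have : `|c * cos (vdot w z' + b')| <= 1.
    by rewrite normrM mulr_ile1// cos_max.
  by rewrite ler_norml => /andP[]; lra.
have mm M (z' : M.-tuple R) b' : measurable_fun setT (fun w : M.-tuple R => (gN e w * (1 + c * cos (vdot w z' + b')))%:E).
  apply/measurable_EFinP; apply: measurable_funM; first exact: measurable_gN.
  apply: measurable_funD => //; apply: measurable_funM => //; apply: measurable_cosT.
  by apply: measurable_funD => //; apply: measurable_vdot.
set E' := expR (- (enorm (behead_tuple z) ^+ 2 / (4 * e))).
have E'1 : 0 <= E' <= 1.
  apply/andP; split; first exact: expR_ge0.
  by rewrite -[leRHS]expR0 ler_expR oppr_le0 divr_ge0 ?sqr_ge0// mulr_ge0// ltW.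
transitivity (\int[mu]_x (gE e x * (Num.sqrt (pi / e) ^+ N * (1 + (c * E') * cos (x * thead z + b))))%:E)%E.
  apply: eq_integral => x _.
  have -> : (fun y : N.-tuple R => (gN e (cons_tuple x y) * (1 + c * cos (vdot (cons_tuple x y) z + b)))%:E) =
    (fun y => ((gE e x)%:E * (gN e y * (1 + c * cos (vdot y (behead_tuple z) + (x * thead z + b))))%:E)%E).
    apply/funext => y; rewrite -EFinM gN_cons vdot_cons mulrA; congr (_ * (1 + c * cos _))%:E; ring.
  rewrite intRN_muN; last 2 first.
  - by apply: emeasurable_funM => //; exact: mm.
  - by move=> y; rewrite mule_ge0// lee_fin ?ge0 ?expR_ge0.
  rewrite ge0_integralZl//=; [|exact: mm|by move=> y _; rewrite lee_fin ge0|by rewrite lee_fin expR_ge0].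
  rewrite -intRN_muN; [|exact: mm|by move=> y; rewrite lee_fin ge0].
  by rewrite IH// -EFinM; congr EFin; rewrite -/E'; ring.
have cE : `|c * E'| <= 1.
  by rewrite normrM mulr_ile1//; case/andP: E'1 => *; rewrite ger0_norm.
have mF : measurable_fun setT (fun x : measurableTypeR R => gE e x * (1 + (c * E') * cos (x * thead z + b))).
  apply: measurable_funM; first exact: measurable_gE.
  apply: measurable_funD => //; apply: measurable_funM => //; apply: measurable_cosT.
  by apply: measurable_funD => //; apply: measurable_funM.
have F0 x : 0 <= gE e x * (1 + (c * E') * cos (x * thead z + b)).
  rewrite mulr_ge0 ?expR_ge0//.
  have : `|c * E' * cos (x * thead z + b)| <= 1 by rewrite normrM mulr_ile1// cos_max.
  by rewrite ler_norml => /andP[]; lra.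
under eq_integral do rewrite mulrCA.
rewrite (ge0_integralZ_real mu mF F0); last by rewrite exprn_ge0 ?sqrtr_ge0.
rewrite integral_gE_cos_shift// -EFinM; congr EFin.
have -> : expR (- (enorm z ^+ 2 / (4 * e))) = expR (- (thead z ^+ 2 / (4 * e))) * E'.
  by rewrite (enorm_sqr_eta z) mulrDl opprD expRD.
rewrite [_ ^+ N.+1]exprS; ring.
Qed.

Lemma integrable_gN (e : R) N : 0 < e -> (muN N).-integrable setT (EFin \o @gN e N).
Proof.
move=> e0; apply/integrableP; split; first by apply/measurable_EFinP; exact: measurable_gN.
have := @intRN_gN_cos e e0 N [tuple 0 | i < N] 0 0.
rewrite normr0 => /(_ ler01); under eq_fun do rewrite mul0r addr0 mulr1.
rewrite intRN_muN => [H||x]; last 2 first.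
- by apply/measurable_EFinP; exact: measurable_gN.
- by rewrite lee_fin ltW// gN_gt0.
under eq_integral do rewrite /= gtr0_norm ?gN_gt0//.
by rewrite H ltry.
Qed.

Lemma integral_gN (e : R) N : 0 < e -> \int[muN N]_w gN e w = Num.sqrt (pi / e) ^+ N.
Proof.
move=> e0; have := @intRN_gN_cos e e0 N [tuple 0 | i < N] 0 0.
rewrite normr0 => /(_ ler01); under eq_fun do rewrite mul0r addr0 mulr1.
rewrite intRN_muN => [H||x]; last 2 first.
- by apply/measurable_EFinP; exact: measurable_gN.
- by rewrite lee_fin ltW// gN_gt0.
by rewrite /Rintegral H/= !mul0r addr0 mulr1.
Qed.

Lemma integrable_gN_bounded (e : R) N (f : N.-tuple R -> R) : 0 < e ->
  measurable_fun setT f -> (forall w, `|f w| <= 1) ->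
  (muN N).-integrable setT (EFin \o (fun w => gN e w * f w)).
Proof.
move=> e0 mf f1; apply: le_integrable (integrable_gN N e0) => //.
  by apply/measurable_EFinP; apply: measurable_funM => //; exact: measurable_gN.
by move=> w _ /=; rewrite lee_fin normrM -[leRHS]mulr1 ler_wpM2l.
Qed.

Lemma integral_gN_cos (e : R) N (z : N.-tuple R) : 0 < e ->
  \int[muN N]_w (gN e w * cos (vdot w z)) = gam e z.
Proof.
move=> e0; have mc : measurable_fun setT (fun w : N.-tuple R => cos (vdot w z)).
  by apply: measurable_cosT; apply: measurable_vdot.
have ic := integrable_gN_bounded e0 mc (fun w => cos_max _).
have := @intRN_gN_cos e e0 N z 0 1; rewrite normr1 => /(_ (lexx _)).
under eq_fun do rewrite mul1r addr0 mulrDr mulr1.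
rewrite intRN_muN => [H||x]; last 2 first.
- apply/measurable_EFinP; apply: measurable_funD; first exact: measurable_gN.
  by apply: measurable_funM => //; exact: measurable_gN.
- rewrite lee_fin -[X in X + _]mulr1 -mulrDr mulr_ge0 ?(ltW (gN_gt0 _ _))//.
have := congr1 fine H; rewrite -/(Rintegral _ _ _) RintegralD//; last exact: integrable_gN.
by rewrite integral_gN//= cos0 mul1r mulrDr mulr1 mul1r => /addrI.
Qed.
End gaussian_tuples.

(** * Exchange of mixtures and integrals *)

Section mix_integral.
Context {R : realType} d (T : measurableType d) (m : {measure set T -> \bar R}).
Variable a : R.

Lemma integrable_lin (f g : T -> R) (c k : R) :
  m.-integrable setT (EFin \o f) -> m.-integrable setT (EFin \o g) ->
  m.-integrable setT (EFin \o (fun x => c * f x + k * g x)).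
Proof.
move=> if_ ig; have i1 := integrableZl measurableT c if_; have i2 := integrableZl measurableT k ig.
exact: (integrableD measurableT i1 i2).
Qed.

Lemma Rintegral_lin (f g : T -> R) (c k : R) :
  m.-integrable setT (EFin \o f) -> m.-integrable setT (EFin \o g) ->
  \int[m]_x (c * f x + k * g x) = c * \int[m]_x f x + k * \int[m]_x g x.
Proof.
move=> if_ ig; have i1 := integrableZl measurableT c if_; have i2 := integrableZl measurableT k ig.
by rewrite RintegralD// !RintegralZl.
Qed.

Lemma chainE_Rintegral n (F : nat -> T -> R) :
  (forall j, m.-integrable setT (EFin \o F j)) ->
  m.-integrable setT (EFin \o (fun x => chainE a n (F ^~ x))) /\
  \int[m]_x chainE a n (F ^~ x) = chainE a n (fun j => \int[m]_x F j x).
Proof.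
elim: n F => [|n IH] F iF; first by split => //; exact: iF.
pose F' j x := (1 - a * j%:R / n.+2%:R) * F j x + a * j%:R / n.+2%:R * F j.+1 x.
have iF' j : m.-integrable setT (EFin \o F' j) by apply: integrable_lin; exact: iF.
have [h1 h2] := IH F' iF'; split => //=.
rewrite h2; congr chainE; apply/funext => j; exact: Rintegral_lin.
Qed.

Lemma sum_Rintegral (n : nat) (F : nat -> T -> R) :
  (forall j, m.-integrable setT (EFin \o F j)) ->
  m.-integrable setT (EFin \o (fun x => \sum_(1 <= j < n) F j x)) /\
  \int[m]_x (\sum_(1 <= j < n) F j x) = \sum_(1 <= j < n) \int[m]_x F j x.
Proof.
move=> iF; elim: n => [|n [IH1 IH2]].
  rewrite big_geq//; split.
    by under eq_fun do rewrite /= big_geq//; exact: integrable0.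
  by under eq_Rintegral do rewrite big_geq//; rewrite Rintegral_cst// mul0r.
case: n => [|n] in IH1 IH2 *.
  rewrite big_geq//; split.
    by under eq_fun do rewrite /= big_geq//; exact: integrable0.
  by under eq_Rintegral do rewrite big_geq//; rewrite Rintegral_cst// mul0r.
have E : (fun x => \sum_(1 <= j < n.+2) F j x) = (fun x => 1 * (\sum_(1 <= j < n.+1) F j x) + 1 * F n.+1 x).
  by apply/funext => x; rewrite !mul1r big_nat_recr.
split; first by rewrite E; apply: integrable_lin.
by rewrite E Rintegral_lin// !mul1r IH2 [RHS]big_nat_recr.
Qed.

Lemma mixE_Rintegral n (F : nat -> T -> R) :
  (forall j, m.-integrable setT (EFin \o F j)) ->
  m.-integrable setT (EFin \o (fun x => mixE a n (F ^~ x))) /\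
  \int[m]_x mixE a n (F ^~ x) = mixE a n (fun j => \int[m]_x F j x).
Proof.
move=> iF.
pose F' j x := a * F j x + (1 - a) / (j.-1)%:R * (\sum_(1 <= i < j) F i x).
have iF' j : m.-integrable setT (EFin \o F' j).
  by apply: integrable_lin; [exact: iF|have [] := sum_Rintegral j iF].
have [h1 h2] := chainE_Rintegral n iF'.
have E x : chainE a n (F' ^~ x) = mixE a n (F ^~ x).
  by apply: eq_chainE => j _; rewrite /F' mulrA.
split.
  by apply: eq_integrable h1 => // x _ /=; rewrite E.
transitivity (\int[m]_x chainE a n (F' ^~ x)); first by apply: eq_Rintegral => x _; rewrite E.
rewrite h2; apply: eq_chainE => j _.
rewrite Rintegral_lin//; last by have [] := sum_Rintegral j iF.
by have [_ ->] := sum_Rintegral j iF; rewrite mulrA.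
Qed.
End mix_integral.

(** * Fourier inversion regularised by a Gaussian *)

Section fourier_inversion.
Context {R : realType}.
Variable N : nat.

Lemma integrable_RN_muN (f : N.-tuple R -> R) : integrable_RN f ->
  (muN N).-integrable setT (EFin \o f).
Proof.
move=> [mf foo]; apply/integrableP; split; first exact/measurable_EFinP.
rewrite -(intRN_muN (f := fun x => `|(EFin \o f) x|%E))//.
by apply: measurableT_comp => //; exact/measurable_EFinP.
Qed.

Lemma RintN_muN (f : N.-tuple R -> R) : measurable_fun setT f ->
  RintN f = fine (\int[muN N]_x (Num.max (f x) 0)%:E) - fine (\int[muN N]_x (Num.max (- f x) 0)%:E).
Proof.
move=> mf; rewrite /RintN !intRN_muN//.
- by apply/measurable_EFinP; apply: measurable_maxr => //; exact: measurable_funN.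
- by move=> x; rewrite lee_fin le_max lexx orbT.
- by apply/measurable_EFinP; apply: measurable_maxr.
- by move=> x; rewrite lee_fin le_max lexx orbT.
Qed.

Lemma RintN_Rintegral (f : N.-tuple R -> R) : (muN N).-integrable setT (EFin \o f) ->
  RintN f = \int[muN N]_x f x.
Proof.
move=> if_; have /integrableP[/measurable_EFinP mf _] := if_.
rewrite RintN_muN// /Rintegral [X in _ = fine X]integralE [RHS]fineB; last 2 first.
- exact: integrable_pos_fin_num.
- exact: integrable_neg_fin_num.
congr (fine _ - fine _); apply: eq_integral => x _.
  by rewrite funeposE /= EFin_max.
by rewrite funenegE /= EFin_max.
Qed.

Lemma vdot_vsub (w x y : N.-tuple R) : vdot w (vsub x y) = vdot w x - vdot w y.
Proof.
rewrite /vdot -sumrB; apply: eq_bigr => i _.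
by rewrite tnth_vsub mulrBr.
Qed.

Lemma vdotC (x y : N.-tuple R) : vdot x y = vdot y x.
Proof. by apply: eq_bigr => i _; rewrite mulrC. Qed.

Lemma integrable_mul_bounded (f h : N.-tuple R -> R) :
  (muN N).-integrable setT (EFin \o f) -> measurable_fun setT h -> (forall x, `|h x| <= 1) ->
  (muN N).-integrable setT (EFin \o (fun x => f x * h x)).
Proof.
move=> if_ mh h1; have /integrableP[/measurable_EFinP mf _] := if_.
apply: le_integrable if_ => //; first by apply/measurable_EFinP; exact: measurable_funM.
by move=> x _ /=; rewrite lee_fin normrM -[leRHS]mulr1 ler_wpM2l.
Qed.

(** Write [gam] as the cosine transform of [gN] and exchange the integrals, as |f(y)| gN(w) is
    integrable in (y,w). The Gaussian weight matters in the application: E_a(-|w|^2) decays only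
    like |w|^-2, so the plain inversion integral is not absolutely convergent. *)
Lemma gaussian_average (f Mf : N.-tuple R -> R) (e : R) (x : N.-tuple R) : 0 < e ->
  integrable_RN f ->
  (forall w, RintN (fun y => f y * cos (vdot y w)) = Mf w) ->
  (forall w, RintN (fun y => f y * sin (vdot y w)) = 0) ->
  \int[muN N]_y (f y * gam e (vsub x y)) = \int[muN N]_w (gN e w * (cos (vdot w x) * Mf w)).
Proof.
move=> e0 irf Mc Ms; have if_ := integrable_RN_muN irf; have [mf _] := irf.
have mcos w : measurable_fun setT (fun y : N.-tuple R => cos (vdot y w)).
  by apply: measurable_cosT; exact: measurable_vdot.
have msin w : measurable_fun setT (fun y : N.-tuple R => sin (vdot y w)).
  by apply: measurable_sinT; exact: measurable_vdot.
have ic w := integrable_mul_bounded if_ (mcos w) (fun y => cos_max _).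
have is_ w := integrable_mul_bounded if_ (msin w) (fun y => sin_max _).
pose G (z : N.-tuple R * N.-tuple R) := (f z.1 * (gN e z.2 * cos (vdot z.2 (vsub x z.1))))%:E.
have mG : measurable_fun setT G.
  apply/measurable_EFinP; apply: measurable_funM; first exact: (measurableT_comp mf measurable_fst).
  apply: measurable_funM; first exact: (measurableT_comp (@measurable_gN R e N) measurable_snd).
  by apply: measurable_cosT; apply: measurable_vdot => //; apply: measurable_vsub.
have iG : (muN N \x muN N)%E.-integrable setT G.
  apply/integrable12ltyP => //.
  apply: (@le_lt_trans _ _ (\int[muN N]_y ((Num.sqrt (pi / e) ^+ N)%:E * `|(f y)%:E|))%E).
    apply: ge0_le_integral => //.
    - by move=> y _; apply: integral_ge0.
    - apply: (@measurable_fun_fubini_tonelli_F _ _ _ _ _ (muN N) (fun z => `|G z|%E)) => //.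
      exact: measurableT_comp.
    - by apply: emeasurable_funM => //; apply: measurableT_comp => //; exact/measurable_EFinP.
    move=> y _; rewrite -integral_gN// /Rintegral fineK; last first.
      by apply: integrable_fin_num => //; exact: integrable_gN.
    rewrite muleC -ge0_integralZl//=; last 2 first.
    - by apply/measurable_EFinP; exact: measurable_gN.
    - by move=> w _; rewrite lee_fin ltW// gN_gt0.
    apply: ge0_le_integral => //.
    - have mGy : measurable_fun setT (fun w => G (y, w)).
        by apply: (measurableT_comp mG); exact: measurable_pair1.
      exact: (measurableT_comp (@abse_measurable R setT) mGy).
    - by apply: emeasurable_funM => //; apply/measurable_EFinP; exact: measurable_gN.
    move=> w _ /=; rewrite lee_fin normrM ler_wpM2l// normrM -[leRHS]mulr1.
    by rewrite (gtr0_norm (gN_gt0 _ _)) ler_wpM2l ?cos_max// ltW// gN_gt0.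
  have mabs : measurable_fun setT (fun y => `|(f y)%:E|%E).
    by apply: measurableT_comp => //; exact/measurable_EFinP.
  rewrite (ge0_integralZl (muN N) measurableT mabs)//.
  by apply: lte_mul_pinfty => //; have /integrableP[] := if_.
have := Fubini iG; rewrite /G/= => FE.
rewrite /Rintegral; congr fine.
transitivity (\int[muN N]_y \int[muN N]_w (f y * (gN e w * cos (vdot w (vsub x y))))%:E)%E.
  apply: eq_integral => y _; under [RHS]eq_integral do rewrite EFinM.
  have mc : measurable_fun setT (fun w : N.-tuple R => cos (vdot w (vsub x y))).
    by apply: measurable_cosT; apply: measurable_vdot.
  have igc := integrable_gN_bounded e0 mc (fun w => cos_max _).
  rewrite (integralZl measurableT igc) EFinM; congr (_ * _)%E.
  by rewrite -(integral_gN_cos (vsub x y) e0) /Rintegral (fineK (integrable_fin_num measurableT igc)).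
rewrite FE; apply: eq_integral => w _.
have E y : f y * (gN e w * cos (vdot w (vsub x y))) =
  gN e w * cos (vdot w x) * (f y * cos (vdot y w)) + gN e w * sin (vdot w x) * (f y * sin (vdot y w)).
  by rewrite vdot_vsub cosD cosN sinN (vdotC w y); ring.
under eq_integral do rewrite E.
have := Rintegral_lin (gN e w * cos (vdot w x)) (gN e w * sin (vdot w x)) (ic w) (is_ w).
rewrite -(RintN_Rintegral (ic w)) -(RintN_Rintegral (is_ w)) Mc Ms mulr0 addr0 -mulrA => <-.
have il := integrable_lin (gN e w * cos (vdot w x)) (gN e w * sin (vdot w x)) (ic w) (is_ w).
by rewrite /Rintegral (fineK (integrable_fin_num measurableT il)).
Qed.
End fourier_inversion.

(** * Heat kernel bounds and a Gaussian approximation of the identity *)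

Section gaussian_limits.
Context {R : realType}.

Lemma exp_sqr_bound (m : nat) : exists2 B : R, 0 < B &
  forall u : R, 0 <= u -> u ^+ m * expR (- (u ^+ 2 / 4)) <= B.
Proof.
case: m => [|m].
  exists 1 => // u u0; rewrite expr0 mul1r -[leRHS]expR0 ler_expR oppr_le0.
  by rewrite divr_ge0// sqr_ge0.
pose p : R := m.+1%:R / 2; have p0 : 0 < p by rewrite divr_gt0// ltr0n.
exists (2 `^ p * (2 * p) `^ p); first by rewrite mulr_gt0 ?powR_gt0// mulr_gt0.
move=> u u0; rewrite expRN ler_pdivrMr ?expR_gt0//.
have x0 : 0 <= u ^+ 2 / 2 by rewrite divr_ge0// sqr_ge0.
have := powR_expR_bound p0 x0.
have -> : u ^+ 2 / 2 / 2 = u ^+ 2 / 4 by field.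
have -> : u ^+ m.+1 = 2 `^ p * (u ^+ 2 / 2) `^ p.
  rewrite -powRM//; have -> : 2 * (u ^+ 2 / 2) = u ^+ 2 by field.
  by rewrite -!powR_mulrn// -powRrM; congr powR; rewrite /p; field.
by move=> h; rewrite -[leRHS]mulrA; apply: (ler_wpM2l (powR_ge0 _ _)).
Qed.

Definition gv N (v r : R) := Num.sqrt v ^- N * expR (- (r ^+ 2 / (4 * v))).

Lemma gv_gt0 N v r : 0 < v -> 0 < gv N v r.
Proof. by move=> v0; rewrite mulr_gt0 ?expR_gt0// invr_gt0 exprn_gt0// sqrtr_gt0. Qed.

Lemma gv_scale N v r : 0 < v -> 0 < r ->
  gv N v r = r ^- N * ((r / Num.sqrt v) ^+ N * expR (- ((r / Num.sqrt v) ^+ 2 / 4))).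
Proof.
move=> v0 r0; have sv : 0 < Num.sqrt v by rewrite sqrtr_gt0.
rewrite /gv mulrA; congr (_ * expR (- _)).
  by rewrite expr_div_n mulrA mulVf ?mul1r// expf_eq0 gt_eqF ?andbF.
by rewrite expr_div_n sqr_sqrtr ?ltW// invfM mulrA mulrAC.
Qed.

(** This bound and [gv_le_32] both express that u^m e^(-u^2/4) is bounded, for u = r / sqrt v, with
    m = N+2 here and m = N-3 there. This one serves small times, the other large times. *)
Lemma gv_le_lin N : exists2 C : R, 0 < C &
  forall v r, 0 < v -> 0 < r -> gv N v r <= C * v * r ^- N.+2.
Proof.
have [B B0 hB] := exp_sqr_bound N.+2; exists B => // v r v0 r0.
have sv : 0 < Num.sqrt v by rewrite sqrtr_gt0.
have u0 : 0 <= r / Num.sqrt v by rewrite divr_ge0 ?ltW.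
rewrite gv_scale//; have := hB _ u0; set E := expR _.
have -> : (r / Num.sqrt v) ^+ N.+2 = (r / Num.sqrt v) ^+ N * (r ^+ 2 / v).
  by rewrite -addn2 exprD [X in _ * X = _]expr_div_n sqr_sqrtr ?ltW.
move: (_ ^+ N) => X h.
have rN : 0 < r ^+ N by rewrite exprn_gt0.
have -> : r ^- N.+2 = r ^- N * r ^- 2 by rewrite -addn2 exprD invfM.
have -> : B * v * (r ^- N * r ^- 2) = r ^- N * (B * (v * r ^- 2)) by ring.
apply: ler_wpM2l; first by rewrite invr_ge0 ltW.
have k0 : 0 <= v * r ^- 2 by rewrite mulr_ge0 ?(ltW v0)// invr_ge0 exprn_ge0// ltW.
apply: le_trans (ler_wpM2r k0 h); rewrite le_eqVlt; apply/orP; left; apply/eqP.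
by field; rewrite !gt_eqF.
Qed.

(** The power of v is tailored to the moment of order -3/2 in [chain_neg_moment]; what remains of
    the distance is r^(3-N). *)
Lemma gv_le_32 N : (3 <= N)%N -> exists2 C : R, 0 < C &
  forall v r, 0 < v -> 0 < r -> gv N v r <= C * r ^- (N - 3) * (v * Num.sqrt v)^-1.
Proof.
move=> N3; have [B B0 hB] := exp_sqr_bound (N - 3); exists B => // v r v0 r0.
have sv : 0 < Num.sqrt v by rewrite sqrtr_gt0.
have u0 : 0 <= r / Num.sqrt v by rewrite divr_ge0 ?ltW.
rewrite gv_scale//; have := hB _ u0; set E := expR _.
have -> : (r / Num.sqrt v) ^+ N = (r / Num.sqrt v) ^+ (N - 3) * (r / Num.sqrt v) ^+ 3.
  by rewrite -exprD subnK.
move: (_ ^+ (N - 3)) => X h.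
have -> : r ^- N = r ^- (N - 3) * r ^- 3 by rewrite -{1}(subnK N3) exprD invfM.
have k0 : 0 < r ^- (N - 3) by rewrite invr_gt0 exprn_gt0.
have vE : (v * Num.sqrt v)^-1 = Num.sqrt v ^- 3.
  by rewrite -[v in v * _](@sqr_sqrtr _ v) ?ltW// -exprSr.
rewrite vE -[leLHS]mulrA -[leRHS]mulrA [leRHS]mulrCA ler_wpM2l ?(ltW k0)//.
have -> : r ^- 3 * (X * (r / Num.sqrt v) ^+ 3 * E) = X * E * Num.sqrt v ^- 3.
  by rewrite expr_div_n; field; rewrite !gt_eqF.
by rewrite ler_wpM2r// invr_ge0 exprn_ge0// ltW.
Qed.

Lemma gam_gv e N (z : N.-tuple R) : 0 < e -> gam e z = Num.sqrt pi ^+ N * gv N e (enorm z).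
Proof.
move=> e0; rewrite /gam /gv sqrtrM ?pi_ge0// sqrtrV ?ltW// exprMn exprVn mulrA.
by [].
Qed.

Lemma gam_gt0 e N (z : N.-tuple R) : 0 < e -> 0 < gam e z.
Proof. by move=> e0; rewrite gam_gv// mulr_gt0 ?gv_gt0// exprn_gt0// sqrtr_gt0 pi_gt0. Qed.

Lemma gam_gN e N (z : N.-tuple R) : 0 < e -> gam e z = Num.sqrt (pi / e) ^+ N * gN (4 * e)^-1 z.
Proof. by move=> e0; rewrite /gam /gN mulrC [_ / (4 * e)]mulrC mulrC. Qed.

Lemma measurable_gam e N : 0 < e -> measurable_fun setT (@gam R e N).
Proof.
move=> e0; rewrite (_ : @gam R e N = fun z => Num.sqrt (pi / e) ^+ N * gN (4 * e)^-1 z).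
  by apply: measurable_funM => //; exact: measurable_gN.
by apply/funext => z; rewrite gam_gN.
Qed.

Lemma gam_shift_integral e N (x : N.-tuple R) : 0 < e ->
  (\int[muN N]_y (gam e (vsub x y))%:E)%E = ((2 * pi) ^+ N)%:E.
Proof.
move=> e0; have e40 : 0 < (4 * e)^-1 :> R by rewrite invr_gt0 mulr_gt0.
have A0 : 0 <= Num.sqrt (pi / e) ^+ N by rewrite exprn_ge0// sqrtr_ge0.
rewrite (integral_vsub x (f := fun z => (gam e z)%:E)); last 2 first.
- by apply/measurable_EFinP; exact: measurable_gam.
- by move=> z; rewrite lee_fin ltW// gam_gt0.
under eq_integral do rewrite gam_gN//.
rewrite ge0_integralZ_real//; last 2 first.
- exact: measurable_gN.
- by move=> z; rewrite ltW// gN_gt0.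
have ig := integrable_gN N e40.
have -> : (\int[muN N]_z (gN (4 * e)^-1 z)%:E)%E = (\int[muN N]_z gN (4 * e)^-1 z)%:E.
  by rewrite /Rintegral fineK//; exact: integrable_fin_num.
rewrite integral_gN// -EFinM -exprMn -sqrtrM; last by rewrite divr_ge0 ?pi_ge0// ltW.
have -> : pi / e * (pi / (4 * e)^-1) = (2 * pi) ^+ 2 by field; rewrite gt_eqF.
by rewrite sqrtr_sqr ger0_norm// mulr_ge0// pi_ge0.
Qed.

Lemma enorm_vsubC N (x y : N.-tuple R) : enorm (vsub x y) = enorm (vsub y x).
Proof.
rewrite /enorm; congr Num.sqrt; apply: eq_bigr => i _; rewrite !tnth_vsub; ring.
Qed.

Lemma gam_double e N (z : N.-tuple R) : 0 < e ->
  gam e z = Num.sqrt 2 ^+ N * expR (- (enorm z ^+ 2 / (8 * e))) * gam (2 * e) z.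
Proof.
move=> e0; rewrite /gam; have -> : pi / e = 2 * (pi / (2 * e)) :> R by field; rewrite gt_eqF.
rewrite sqrtrM// exprMn.
have -> : expR (- (enorm z ^+ 2 / (4 * e))) =
    expR (- (enorm z ^+ 2 / (8 * e))) * expR (- (enorm z ^+ 2 / (4 * (2 * e)))) :> R.
  by rewrite -expRD; congr expR; field; rewrite gt_eqF.
ring.
Qed.

(** Half of the exponent gives the small factor through e^-y <= 1/y; the other half is a Gaussian of
    doubled variance, with the same total mass. *)
Lemma gam_far e N (z : N.-tuple R) (del : R) : 0 < e -> 0 < del -> del <= enorm z ->
  gam e z <= Num.sqrt 2 ^+ N * (8 * e / del ^+ 2) * gam (2 * e) z.
Proof.
move=> e0 d0 dz; have z0 : 0 < enorm z by exact: lt_le_trans dz.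
rewrite gam_double// ler_wpM2r ?(ltW (gam_gt0 _ _)) ?mulr_gt0//.
rewrite ler_wpM2l ?exprn_ge0 ?sqrtr_ge0//.
set y := _ / (8 * e); have y0 : 0 < y by rewrite divr_gt0 ?exprn_gt0 ?mulr_gt0.
apply: (@le_trans _ _ y^-1).
  rewrite expRN lef_pV2 ?posrE ?expR_gt0//.
  by apply: le_trans (expR_ge1Dx y); rewrite lerDr.
rewrite /y invf_div ler_wpM2l ?mulr_ge0 ?(ltW e0)// lef_pV2 ?posrE ?exprn_gt0//.
by apply: lerXn2r => //; rewrite nnegrE ltW.
Qed.

(** [f] is integrable but only continuous at x, so far from x its values are not bounded: |f(y)| is
    paired with the pointwise bound [gv_le_lin], and |f(x)| with [gam_far]. Both contributions carry
    a factor eps, and [D] collects their coefficients. *)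
Lemma gaussian_average_cvg N (f : N.-tuple R -> R) (x : N.-tuple R) :
  integrable_RN f ->
  (forall e, 0 < e -> exists2 d, 0 < d & forall y, enorm (vsub y x) < d -> `|f y - f x| < e) ->
  forall e, 0 < e -> exists2 d, 0 < d & forall eps, 0 < eps < d ->
    `|\int[muN N]_y (f y * gam eps (vsub x y)) - (2 * pi) ^+ N * f x| <= e.
Proof.
move=> irf cf e e0; have if_ := integrable_RN_muN irf; have [mf _] := irf.
have piN : 0 < (2 * pi) ^+ N :> R by rewrite exprn_gt0// mulr_gt0// pi_gt0.
have [del del0 hdel] := cf (e / 3 / (2 * pi) ^+ N) (divr_gt0 (divr_gt0 e0 (ltr0n _ 3)) piN).
have [C C0 hC] := gv_le_lin N.
pose I := \int[muN N]_y `|f y|.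
have I0 : 0 <= I by apply: Rintegral_ge0.
pose K1 : R := Num.sqrt pi ^+ N * C * del ^- N.+2.
pose K2 : R := `|f x| * (Num.sqrt 2 ^+ N * (8 / del ^+ 2)).
have K10 : 0 <= K1 by rewrite !mulr_ge0 ?exprn_ge0 ?sqrtr_ge0 ?(ltW C0)// invr_ge0 exprn_ge0// ltW.
have K20 : 0 <= K2 by rewrite !mulr_ge0 ?exprn_ge0 ?sqrtr_ge0// invr_ge0 exprn_ge0// ltW.
pose D : R := K1 * I + K2 * (2 * pi) ^+ N + 1.
have D0 : 0 < D by rewrite ltr_wpDl// addr_ge0// mulr_ge0// ltW.
exists (e / 3 / D); first by rewrite !divr_gt0.
move=> eps /andP[eps0 epsd].
have eps20 : 0 < 2 * eps by rewrite mulr_gt0.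
have mg (v : R) : 0 < v -> measurable_fun setT (fun y : N.-tuple R => gam v (vsub x y)).
  move=> v0; have mv : measurable_fun setT (fun y : N.-tuple R => vsub x y) by apply: measurable_vsub.
  exact: (measurableT_comp (measurable_gam v0) mv).
have ig (v : R) : 0 < v -> (muN N).-integrable setT (EFin \o (fun y : N.-tuple R => gam v (vsub x y))).
  move=> v0; apply/integrableP; split; first by apply/measurable_EFinP; exact: mg.
  under eq_integral do rewrite /= gtr0_norm ?gam_gt0//.
  by rewrite gam_shift_integral// ltry.
have Ig (v : R) : 0 < v -> \int[muN N]_y gam v (vsub x y) = (2 * pi) ^+ N.
  by move=> v0; rewrite /Rintegral gam_shift_integral.
have igf : (muN N).-integrable setT (EFin \o (fun y => f y * gam eps (vsub x y))).
  have ie := integrableZl measurableT (Num.sqrt (pi / eps) ^+ N) if_.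
  apply: le_integrable ie => //.
    by apply/measurable_EFinP; apply: measurable_funM => //; exact: mg.
  move=> y _ /=; rewrite lee_fin !normrM mulrC ler_wpM2r// ger0_norm ?(ltW (gam_gt0 _ _))//.
  rewrite ger0_norm ?exprn_ge0 ?sqrtr_ge0// /gam -[leRHS]mulr1 ler_wpM2l ?exprn_ge0 ?sqrtr_ge0//.
  by rewrite -[leRHS]expR0 ler_expR oppr_le0 divr_ge0 ?sqr_ge0// mulr_ge0// ltW.
have -> : \int[muN N]_y (f y * gam eps (vsub x y)) - (2 * pi) ^+ N * f x =
  \int[muN N]_y (1 * (f y * gam eps (vsub x y)) + (- f x) * gam eps (vsub x y)).
  rewrite Rintegral_lin//; last exact: ig.
  by rewrite mul1r Ig// mulNr mulrC.
have ia := integrable_lin 1 (- f x) igf (ig _ eps0).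
apply: le_trans (le_normr_Rintegral measurableT ia) _.
have inf : (muN N).-integrable setT (EFin \o (fun y => `|f y|)) by exact: integrable_norm.
have ib := integrable_lin (e / 3 / (2 * pi) ^+ N) 1 (ig _ eps0)
  (integrable_lin (eps * K1) (eps * K2) inf (ig _ eps20)).
apply: (@le_trans _ _ (\int[muN N]_y (e / 3 / (2 * pi) ^+ N * gam eps (vsub x y) +
  1 * (eps * K1 * `|f y| + eps * K2 * gam (2 * eps) (vsub x y))))).
  apply: le_Rintegral => //; first exact: integrable_norm.
  move=> y _; rewrite mul1r mulNr -mulrBl normrM (gtr0_norm (gam_gt0 _ eps0)) mul1r.
  have g1 := gam_gt0 (vsub x y) eps0; have g2 := gam_gt0 (vsub x y) eps20.
  have [yd|yd] := ltP (enorm (vsub y x)) del.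
    apply: (@le_trans _ _ (e / 3 / (2 * pi) ^+ N * gam eps (vsub x y))).
      by apply: ler_wpM2r; [exact: ltW|exact/ltW/hdel].
    rewrite lerDl; apply: addr_ge0; first exact: mulr_ge0 (mulr_ge0 (ltW eps0) K10) (normr_ge0 _).
    exact: mulr_ge0 (mulr_ge0 (ltW eps0) K20) (ltW g2).
  rewrite enorm_vsubC in yd.
  apply: (@le_trans _ _ (eps * K1 * `|f y| + eps * K2 * gam (2 * eps) (vsub x y))); last first.
    rewrite lerDr; apply: mulr_ge0; last exact: ltW.
    exact: ltW (divr_gt0 (divr_gt0 e0 (ltr0n _ 3)) piN).
  apply: (@le_trans _ _ (`|f y| * gam eps (vsub x y) + `|f x| * gam eps (vsub x y))).
    by rewrite -mulrDl ler_wpM2r ?(ltW g1)// ler_normB.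
  have z0 : 0 < enorm (vsub x y) by exact: lt_le_trans yd.
  apply: lerD.
    rewrite mulrC ler_wpM2r// gam_gv//.
    apply: le_trans (ler_wpM2l _ (hC _ _ eps0 z0)) _; first by rewrite exprn_ge0 ?sqrtr_ge0.
    have -> : eps * K1 = Num.sqrt pi ^+ N * (C * eps * del ^- N.+2) by rewrite /K1; ring.
    rewrite ler_wpM2l ?exprn_ge0 ?sqrtr_ge0// ler_wpM2l ?mulr_ge0 ?(ltW C0) ?(ltW eps0)//.
    rewrite lef_pV2 ?posrE ?exprn_gt0//.
    by apply: lerXn2r => //; rewrite nnegrE ltW.
  apply: le_trans (ler_wpM2l (normr_ge0 _) (gam_far eps0 del0 yd)) _.
  by rewrite /K2 le_eqVlt; apply/orP; left; apply/eqP; ring.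
rewrite Rintegral_lin//; [|exact: ig|exact: (integrable_lin (eps * K1) (eps * K2) inf (ig _ eps20))].
rewrite Rintegral_lin//; last exact: ig.
rewrite !Ig// divfK ?gt_eqF// mul1r -/I.
have h : eps * D < e / 3 by rewrite -ltr_pdivlMr.
have : eps * D = eps * K1 * I + eps * K2 * (2 * pi) ^+ N + eps by rewrite /D; ring.
move: h; move: (eps * D) (eps * K1 * I) (eps * K2 * _) => A1 A2 A3; lra.
Qed.
End gaussian_limits.

(** * Mixtures of heat kernels converge to Gaussian averages of Z *)

Section mix_gaussian_limit.
Context {R : realType}.
Local Opaque Gamma gamma_int MittagLeffler.
Variables (N : nat) (a : R).
Hypothesis a01 : 0 < a < 1.

Lemma mixL_le1 (s : R) n : 0 <= s -> `|mixL a s n| <= 1.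
Proof.
move=> s0; apply: norm_mixE => // j _; rewrite ger0_norm ?expR_ge0//.
rewrite -[leRHS]expR0 ler_expR mulNr oppr_le0 mulr_ge0// mulr_ge0//.
by rewrite ltW// qscale_gt0.
Qed.

(** The limit is taken on the Fourier side, where [mixL] is at most 1 in absolute value and
    converges pointwise. Keeping eps > 0 fixed while n grows provides the dominating function
    [gN eps]. *)
Lemma mix_gauss_cvg (f : N.-tuple R -> R) (sig eps : R) (x : N.-tuple R) : 0 < sig -> 0 < eps ->
  integrable_RN f ->
  (forall w, RintN (fun y => f y * cos (vdot y w)) = MittagLeffler a (- (enorm w ^+ 2) * sig)) ->
  (forall w, RintN (fun y => f y * sin (vdot y w)) = 0) ->
  mixE a n (fun j => gam (eps + sig * (qscale a n * j%:R)) x) @[n --> \oo] -->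
    \int[muN N]_y (f y * gam eps (vsub x y)).
Proof.
move=> s0 e0 irf Mc Ms.
have if_ := integrable_RN_muN irf.
rewrite (gaussian_average x e0 irf Mc Ms).
pose s (w : N.-tuple R) := enorm w ^+ 2 * sig.
have sw0 w : 0 <= s w by rewrite mulr_ge0 ?sqr_ge0// ltW.
have v0 n (j : nat) : 0 < eps + sig * (qscale a n * j%:R).
  by rewrite ltr_wpDr// mulr_ge0 ?(ltW s0)// mulr_ge0// ltW// qscale_gt0.
have mc : measurable_fun setT (fun w : N.-tuple R => cos (vdot w x)).
  by apply: measurable_cosT; apply: measurable_vdot.
pose F n j w := gN (eps + sig * (qscale a n * j%:R)) w * cos (vdot w x).
have iF n j : (muN N).-integrable setT (EFin \o F n j).
  by apply: integrable_gN_bounded => // w; exact: cos_max.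
(* Increasing the variance multiplies [gN eps] by an exponential in |w|^2, so the mixture over j
   acts on that factor alone and produces [mixL]. *)
have FE n w : mixE a n (F n ^~ w) = gN eps w * (cos (vdot w x) * mixL a (s w) n).
  rewrite mulrA -mixEZ; congr mixE; apply/funext => j.
  rewrite /F mulrAC -expRD; congr (expR _ * _); rewrite /s; ring.
have -> : (fun n => mixE a n (fun j => gam (eps + sig * (qscale a n * j%:R)) x)) =
   (fun n => \int[muN N]_w (gN eps w * (cos (vdot w x) * mixL a (s w) n))).
  apply/funext => n; under eq_Rintegral do rewrite -FE.
  have [_ ->] := mixE_Rintegral a n (iF n); congr mixE; apply/funext => j.
  by rewrite /F integral_gN_cos.
have lim w : cos (vdot w x) * mixL a (s w) n @[n --> \oo] -->
    cos (vdot w x) * MittagLeffler a (- (enorm w ^+ 2) * sig).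
  apply: cvgM; first exact: cvg_cst.
  by rewrite mulNr; exact: mixL_cvg.
have mF n : measurable_fun setT (fun w => (gN eps w * (cos (vdot w x) * mixL a (s w) n))%:E).
  have [/integrableP[mF _] _] := mixE_Rintegral a n (iF n).
  by under eq_fun do rewrite -FE.
have cF w : setT w -> (gN eps w * (cos (vdot w x) * mixL a (s w) n))%:E @[n --> \oo] -->
    (gN eps w * (cos (vdot w x) * MittagLeffler a (- (enorm w ^+ 2) * sig)))%:E.
  move=> _; apply: cvg_EFin; first exact: nearW.
  by apply: cvgM; [exact: cvg_cst|exact: lim].
have bF n w : setT w ->
    (`|(gN eps w * (cos (vdot w x) * mixL a (s w) n))%:E| <= (EFin \o @gN R eps N) w)%E.
  move=> _ /=; rewrite lee_fin normrM (gtr0_norm (gN_gt0 _ _)) -[leRHS]mulr1.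
  rewrite ler_wpM2l ?(ltW (gN_gt0 _ _))// normrM mulr_ile1// ?cos_max//.
  exact: mixL_le1.
have fing w : setT w -> (EFin \o @gN R eps N) w \is a fin_num by [].
have ig := integrable_gN N e0.
have mlim : measurable_fun setT (fun w => (gN eps w * (cos (vdot w x) * MittagLeffler a (- (enorm w ^+ 2) * sig)))%:E).
  exact: emeasurable_fun_cvg mF cF.
have [ilim _ _] := dominated_convergence measurableT mF mlim (aeW _ cF) ig (aeW _ (fun w n => bF n w)).
apply: fine_cvg; rewrite /Rintegral fineK; last exact: integrable_fin_num.
exact: (dominated_cvg measurableT mF cF fing ig bF).
Qed.
End mix_gaussian_limit.

(** * The time integral of the heat kernel at distance 1 *)

Section kernel_primitive.
Context {R : realType}.
Notation mu := (@lebesgue_measure R).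
Variable N : nat.
Hypothesis N3 : (3 <= N)%N.

Let g (s : R) := gv N s 1.

Lemma gv_le0 (s r : R) : s <= 0 -> gv N s r = 0.
Proof.
move=> s0; rewrite /gv ler0_sqrtr// expr0n (_ : (N == 0)%N = false) ?invr0 ?mul0r//.
by case: N N3.
Qed.

Lemma continuous_gv1 : continuous g.
Proof.
move=> s; have [s0|s0] := leP s 0; last first.
  apply: cvgM.
    apply: cvgV; first by rewrite expf_eq0 gt_eqF ?andbF// sqrtr_gt0.
    apply: (@continuous_comp _ _ _ (@Num.sqrt R) (fun x => x ^+ N)); first exact: sqrt_continuous.
    exact: exprn_continuous.
  apply: (@continuous_comp _ _ _ (fun v : R => - (1 ^+ 2 / (4 * v))) expR); last exact: continuous_expR.
  apply: cvgN; apply: cvgM; first exact: cvg_cst.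
  by apply: cvgV; [rewrite gt_eqF// mulr_gt0|apply: cvgM; [exact: cvg_cst|exact: cvg_id]].
have [C C0 hC] := @gv_le_lin R N.
apply/cvgrPdist_lt => e e0; near=> t.
have -> : g s = 0 by exact: gv_le0.
rewrite sub0r normrN; have [t0|t0] := leP t 0; first by rewrite /g gv_le0// normr0.
rewrite ger0_norm ?(ltW (gv_gt0 _ _ _))//; apply: le_lt_trans (hC t 1 t0 ltr01) _.
rewrite expr1n invr1 mulr1 mulrC -ltr_pdivlMr//.
near: t; apply: lt_nbhsl; apply: le_lt_trans s0 _; exact: divr_gt0.
Unshelve. all: end_near. Qed.

(** Distance 1 suffices, by scaling. Since [gv] vanishes for s <= 0, the integrand is continuous on
    the whole line, including the endpoint 0. *)
Definition gvP (v : R) := \int[mu]_(s in `[0, v]) g s.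

Lemma integrable_gv (u : R) : mu.-integrable `[0, u] (EFin \o g).
Proof.
apply: continuous_compact_integrable; first exact: segment_compact.
by apply: continuous_subspaceT; exact: continuous_gv1.
Qed.

Lemma gvP_derive (v : R) : 0 < v -> is_derive v 1 gvP (gv N v 1).
Proof.
move=> v0; have vv : v < v + 1 by rewrite ltrDl.
have [d1 d2] := continuous_FTC1_closed vv (integrable_gv _) v0 (@continuous_gv1 v).
by split; [exact: d1|rewrite -derive1E; exact: d2].
Qed.

Lemma gvP_ge0 v : 0 <= gvP v.
Proof.
apply: Rintegral_ge0 => s _; have [s0|s0] := leP s 0; first by rewrite /g gv_le0.
exact: ltW (gv_gt0 _ _ _).
Qed.

Lemma gvP_small : exists2 C : R, 0 < C & forall v, 0 < v -> gvP v <= C * v ^+ 2.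
Proof.
have [C C0 hC] := @gv_le_lin R N; exists C => // v v0.
apply: (@le_trans _ _ (\int[mu]_(s in `[0, v]) (C * v))).
  apply: le_Rintegral => //; first exact: integrable_gv.
    apply: continuous_compact_integrable; first exact: segment_compact.
    by apply: continuous_subspaceT => s; exact: cvg_cst.
  move=> s; rewrite /= in_itv/= => /andP[s0 sv].
  have [s00|s00] := leP s 0; first by rewrite /g gv_le0// mulr_ge0 ?ltW.
  apply: le_trans (hC s 1 s00 ltr01) _; rewrite expr1n invr1 mulr1.
  by rewrite ler_wpM2l// ltW.
rewrite Rintegral_cst//= lebesgue_measure_itv/= lte_fin v0 -EFinB subr0/=.
by rewrite expr2 mulrA.
Qed.

Lemma gvP_mono u v : 0 < u -> u <= v -> gvP u <= gvP v.
Proof.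
move=> u0; rewrite le_eqVlt => /predU1P[->//|uv].
have d1 x : x \in `]u, v[ -> is_derive x 1 gvP (g x).
  by rewrite in_itv/= => /andP[ux _]; apply: gvP_derive; exact: lt_trans ux.
have d2 : {within `[u, v], continuous gvP}.
  apply: derivable_within_continuous => x; rewrite in_itv/= => /andP[ux _].
  by have [] := gvP_derive (lt_le_trans u0 ux).
have [c] := MVT uv d1 d2.
rewrite in_itv/= => /andP[uc _] E; rewrite -subr_ge0 E mulr_ge0//.
  by rewrite ltW// gv_gt0// (lt_trans u0).
by rewrite subr_ge0 ltW.
Qed.

(** As g(s) <= C s^(-3/2), the function H(s) = gvP(s) + 2 C s^(-1/2) is nonincreasing. *)
Lemma gvP_tail : exists2 C : R, 0 < C & forall u v, 0 < u -> u < v ->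
  gvP v - gvP u <= C / Num.sqrt u.
Proof.
have [C C0 hC] := @gv_le_32 R N N3; exists (2 * C); first by rewrite mulr_gt0.
move=> u v u0 uv; have v0 := lt_trans u0 uv.
pose H (s : R) := gvP s + 2 * C * s `^ (- 2^-1).
have dH (x : R) : 0 < x -> is_derive x 1 H (g x + 2 * C * (- 2^-1 * x `^ (- 2^-1 - 1))).
  move=> x0; have d1 := gvP_derive x0; have d2 := is_derive1_powR (- 2^-1) x0.
  have d3 := is_deriveM (is_derive_cst (2 * C) x 1) d2.
  by apply: is_derive_eq (is_deriveD d1 d3) _; rewrite /GRing.scale/= mulr0 addr0.
have d1 x : x \in `]u, v[ -> is_derive x 1 H (g x + 2 * C * (- 2^-1 * x `^ (- 2^-1 - 1))).
  by rewrite in_itv/= => /andP[ux _]; apply: dH; exact: lt_trans ux.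
have d2 : {within `[u, v], continuous H}.
  apply: derivable_within_continuous => x; rewrite in_itv/= => /andP[ux _].
  by have [] := dH x (lt_le_trans u0 ux).
have [c] := MVT uv d1 d2.
rewrite in_itv/= => /andP[uc _] E; have c0 := lt_trans u0 uc.
have pE (x : R) : 0 < x -> x `^ (- 2^-1) = (Num.sqrt x)^-1.
  by move=> x0; rewrite powRN powR12_sqrt// ltW.
have : H v - H u <= 0.
  rewrite E mulr_le0_ge0//; last by rewrite subr_ge0 ltW.
  have -> : c `^ (- 2^-1 - 1) = (c * Num.sqrt c)^-1.
    rewrite powRB; last by apply/implyP => _; rewrite gt_eqF.
    by rewrite powRr1 ?ltW// pE// invfM mulrC.
  have := hC c 1 c0 ltr01; rewrite expr1n invr1 mulr1 -/(g c).
  move: (_^-1) => X; move: (g c) => Y; lra.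
rewrite /H !pE//; have : 0 <= 2 * C * (Num.sqrt v)^-1.
  by rewrite !mulr_ge0// ?invr_ge0 ?sqrtr_ge0// ltW.
move: (_ / Num.sqrt v) (_ / Num.sqrt u) => X Y; lra.
Qed.

(** The constant c is the integral over all times, 2^(N-2) Gamma(N/2 - 1); it is obtained as a
    supremum, and its value is not computed. *)
Lemma gvP_limit : exists c C : R, 0 < C /\ forall v, 0 < v ->
  gvP v <= c /\ c - gvP v <= C / Num.sqrt v.
Proof.
have [C C0 hC] := gvP_tail.
pose A := [set gvP v | v in [set v : R | 0 < v]].
have ub u : 0 < u -> ubound A (gvP u + C / Num.sqrt u).
  move=> u0 _ [v /= v0 <-]; have [vu|uv] := leP v u.
    by apply: le_trans (gvP_mono v0 vu) _; rewrite lerDl divr_ge0 ?sqrtr_ge0// ltW.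
  by rewrite -lerBlDl; exact: hC.
have hA : has_sup A.
  by split; [exists (gvP 1), 1 => /=|exists (gvP 1 + C / Num.sqrt 1); exact: ub].
exists (sup A), C; split => // v v0; split.
  by apply: sup_upper_bound => //; exists v.
rewrite lerBlDl; apply: sup_le_ub; first by case: hA.
exact: ub.
Qed.
End kernel_primitive.

(** * Riemann sums of the heat kernel over its variance *)

Section mixture_kernel.
Context {R : realType}.
Variable N : nat.
Hypothesis N3 : (3 <= N)%N.

(** The primitive in v of [gv N v r], by parabolic scaling. As v grows it tends to c r^(2-N): this
    is where the Newtonian kernel appears. *)
Definition gvPr (r v : R) := r ^- (N - 2) * gvP N (v / r ^+ 2).

Lemma gv_rescale (v r : R) : 0 < v -> 0 < r -> gv N v r = r ^- N * gv N (v / r ^+ 2) 1.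
Proof.
move=> v0 r0; have v1 : 0 < v / r ^+ 2 by rewrite divr_gt0// exprn_gt0.
rewrite gv_scale// [in RHS]gv_scale// expr1n invr1 mul1r.
have -> : Num.sqrt (v / r ^+ 2) = Num.sqrt v / r.
  by rewrite sqrtrM ?ltW// sqrtrV ?sqr_ge0// sqrtr_sqr gtr0_norm.
by rewrite div1r invf_div.
Qed.

Lemma gvPr_derive (r v : R) : 0 < r -> 0 < v -> is_derive v 1 (gvPr r) (gv N v r).
Proof.
move=> r0 v0; have v1 : 0 < v / r ^+ 2 by rewrite divr_gt0// exprn_gt0.
have d1 : is_derive v 1 (fun x : R => x / r ^+ 2) (r ^- 2).
  by apply: is_derive_eq; rewrite /GRing.scale /=; ring.
have d2 := @is_derive1_comp R (gvP N) (fun x : R => x / r ^+ 2) v _ _ (gvP_derive N3 v1) d1.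
apply: is_derive_eq (is_deriveM (is_derive_cst (r ^- (N - 2)) v 1) d2) _.
rewrite /GRing.scale/= mulr0 addr0 [RHS]gv_rescale//.
have -> : r ^- N = r ^- (N - 2) * r ^- 2.
  by rewrite -{1}(subnK (ltnW N3)) exprD invfM.
by ring.
Qed.

Let A (v : R) := Num.sqrt v ^- N.
Let E (r v : R) := expR (- (r ^+ 2 / (4 * v))).

Lemma A_dec u v : 0 < u -> u <= v -> A v <= A u.
Proof.
move=> u0 uv; have v0 := lt_le_trans u0 uv.
rewrite lef_pV2 ?posrE ?exprn_gt0 ?sqrtr_gt0//.
by apply: lerXn2r; rewrite ?nnegrE ?sqrtr_ge0// ler_wsqrtr.
Qed.

Lemma A_ge0 v : 0 <= A v. Proof. by rewrite invr_ge0 exprn_ge0// sqrtr_ge0. Qed.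

Lemma E_inc r u v : 0 < u -> u <= v -> E r u <= E r v.
Proof.
move=> u0 uv; have v0 := lt_le_trans u0 uv.
rewrite ler_expR lerN2 ler_wpM2l ?sqr_ge0// lef_pV2 ?posrE ?mulr_gt0//.
by rewrite ler_wpM2l.
Qed.

Lemma E_ge0 r v : 0 <= E r v. Proof. exact: expR_ge0. Qed.

Lemma E_le1 r v : 0 < v -> E r v <= 1.
Proof.
move=> v0; rewrite -[leRHS]expR0 ler_expR oppr_le0 divr_ge0 ?sqr_ge0//.
by rewrite mulr_ge0// ltW.
Qed.

(* gv is a decreasing times an increasing function of v, so the error of its Riemann sums is
   controlled by total variation. *)
Lemma riemann_gv (r e h : R) k : 0 < r -> 0 < e -> 0 < h ->
  `|h * (\sum_(1 <= j < k.+1) gv N (e + h * j%:R) r) - (gvPr r (e + h * k%:R) - gvPr r e)| <=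
  h * ((A e - A (e + h * k%:R)) + A e * (E r (e + h * k%:R) - E r e)).
Proof.
move=> r0 e0 h0; elim: k => [|k IH].
  by rewrite big_geq// !mulr0 addr0 !subrr normr0 mulr0 addr0 mulr0.
rewrite big_nat_recr//= mulrDr.
have v0 (j : nat) : 0 < e + h * j%:R by rewrite ltr_wpDr// mulr_ge0// ltW.
have ek (j : nat) : e <= e + h * j%:R by rewrite lerDl mulr_ge0// ltW.
have vE : e + h * k.+1%:R = e + h * k%:R + h by rewrite -natr1; ring.
set v := e + h * k%:R in IH vE *; set v' := e + h * k.+1%:R in vE *.
have vp : 0 < v by exact: v0.
have vv : v < v' by rewrite vE ltrDl.
have d1 x : x \in `]v, v'[ -> is_derive x 1 (gvPr r) (gv N x r).
  by rewrite in_itv/= => /andP[ux _]; apply: gvPr_derive => //; exact: lt_trans ux.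
have d2 : {within `[v, v'], continuous (gvPr r)}.
  apply: derivable_within_continuous => x; rewrite in_itv/= => /andP[ux _].
  by have [] := gvPr_derive r0 (lt_le_trans vp ux).
have [c + Ec] := MVT vv d1 d2; rewrite in_itv/= => /andP[vc cv'].
have {}Ec : gvPr r v' - gvPr r v = gv N c r * h by rewrite Ec vE addrAC subrr add0r.
have c0 := lt_trans vp vc.
have key : `|gv N v' r - gv N c r| <= (A v - A v') + A e * (E r v' - E r v).
  have a1 := A_dec vp (ltW vc); have a2 := A_dec c0 (ltW cv').
  have a3 := A_dec e0 (ek k); have a0 := A_ge0 v'.
  have e1 := E_inc r vp (ltW vc); have e2 := E_inc r c0 (ltW cv').
  have e3 := E_le1 r (lt_trans c0 cv'); have e4 := E_ge0 r v.
  have g1 : A v' * E r v <= gv N v' r <= A v * E r v'.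
    rewrite /gv -/(A v') -/(E r v'); apply/andP; split.
      by apply: ler_wpM2l => //; exact: le_trans e2.
    by apply: ler_wpM2r; [exact: E_ge0|exact: le_trans a1].
  have g2 : A v' * E r v <= gv N c r <= A v * E r v'.
    rewrite /gv -/(A c) -/(E r c).
    by apply/andP; split; apply: ler_pM; rewrite ?A_ge0 ?E_ge0.
  have b1 : (A v - A v') * E r v' <= A v - A v'.
    by rewrite -[leRHS]mulr1 ler_wpM2l// subr_ge0 (le_trans a2).
  have b2 : A v' * (E r v' - E r v) <= A e * (E r v' - E r v).
    by rewrite ler_wpM2r ?subr_ge0 ?(le_trans e1)// (le_trans _ a3)// (le_trans a2).
  move: g1 g2 b1 b2; rewrite ler_norml !mulrBl !mulrBr => /andP[? ?] /andP[? ?] ? ?.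
  apply/andP; split; lra.
have := ler_wpM2l (ltW h0) key.
rewrite -[X in X * `|_|](gtr0_norm h0) -normrM => key'.
have -> : h * \sum_(1 <= j < k.+1) gv N (e + h * j%:R) r + h * gv N v' r - (gvPr r v' - gvPr r e) =
   (h * \sum_(1 <= j < k.+1) gv N (e + h * j%:R) r - (gvPr r v - gvPr r e)) +
   h * (gv N v' r - gv N c r).
  by move: Ec; rewrite mulrBr => Ec; lra.
apply: le_trans (ler_normD _ _) _; apply: le_trans (lerD IH key') _.
by rewrite le_eqVlt; apply/orP; left; apply/eqP; ring.
Qed.

Lemma natr_succ_le_double k : k.+2%:R <= 2 * k.+1%:R :> R.
Proof. by rewrite -natrM ler_nat mul2n -addnn addSn addnS ltnS; apply: leq_addl. Qed.

Lemma powm32_le2 (y z : R) : 0 < y -> 0 < z -> z <= 2 * y ->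
  (y * Num.sqrt y)^-1 <= 4 * (z * Num.sqrt z)^-1.
Proof.
move=> y0 z0 zy; have sy : 0 < Num.sqrt y by rewrite sqrtr_gt0.
have sz : 0 < Num.sqrt z by rewrite sqrtr_gt0.
have s4 : Num.sqrt z <= 2 * Num.sqrt y.
  rewrite -(@ler_pXn2r _ 2) ?nnegrE ?(ltW sz) ?mulr_ge0 ?(ltW sy)//.
  rewrite exprMn !sqr_sqrtr ?(ltW y0) ?(ltW z0)//.
  by apply: le_trans zy _; rewrite ler_wpM2r ?(ltW y0)// expr2; lra.
have h := ler_pM (ltW z0) (ltW sz) zy s4.
rewrite ler_pdivlMr ?mulr_gt0// mulrC ler_pdivrMr ?mulr_gt0//.
apply: le_trans h _; rewrite le_eqVlt; apply/orP; left; apply/eqP; ring.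
Qed.

(** Lets a mean of 1/y be controlled by the one negative moment at hand, of order -3/2. *)
Lemma inv_le_powm32 (y : R) : 0 < y -> y^-1 <= 1 + (y * Num.sqrt y)^-1.
Proof.
move=> y0; have sy : 0 < Num.sqrt y by rewrite sqrtr_gt0.
have i0 : 0 < (y * Num.sqrt y)^-1 by rewrite invr_gt0 mulr_gt0.
have [y_1|y_1] := leP 1 y.
  by rewrite (le_trans (_ : y^-1 <= 1))// ?invf_le1// lerDl ltW.
have h : y^-1 <= (y * Num.sqrt y)^-1.
  rewrite lef_pV2 ?posrE ?mulr_gt0// -[leRHS]mulr1 ler_wpM2l ?(ltW y0)//.
  by rewrite -[leRHS]sqrtr1 ler_wsqrtr// ltW.
by apply: le_trans h _; rewrite lerDr.
Qed.

Lemma variation_le (x y z w : R) : 0 <= x -> 0 <= y -> 0 <= z -> w <= 1 ->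
  (x - y) + x * (w - z) <= 2 * x.
Proof.
move=> x0 y0 z0 w1; have := ler_wpM2l x0 w1; have := mulr_ge0 x0 z0.
by rewrite mulrBr mulr1; move: (x * z) (x * w) => *; lra.
Qed.

Lemma mix_kernel_bound (c2 c3 c w z1 z2 : R) : 0 <= c2 -> 0 <= c3 -> 0 <= c -> 0 <= w ->
  0 <= z1 -> 0 <= z2 ->
  4 * (w * (c3 + c) + (c2 * z1 + 2 * z2)) * 8 + (c2 * z1 + 2 * z2) <=
  (32 * (c3 + c) + 33 * (c2 + 2)) * (w + z1 + z2).
Proof.
move=> h2 h3 h w0 p1 p2.
have e1 := mulr_ge0 h3 p1; have e2 := mulr_ge0 h3 p2; have e3 := mulr_ge0 h p1.
have e4 := mulr_ge0 h p2; have e5 := mulr_ge0 h2 w0; have e6 := mulr_ge0 h2 p2.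
rewrite -subr_ge0.
have -> : (32 * (c3 + c) + 33 * (c2 + 2)) * (w + z1 + z2) -
  (4 * (w * (c3 + c) + (c2 * z1 + 2 * z2)) * 8 + (c2 * z1 + 2 * z2)) =
  32 * (c3 * z1 + c3 * z2 + c * z1 + c * z2) + 33 * (c2 * w + c2 * z2) + 66 * (w + z1).
  by ring.
by rewrite !addr_ge0// mulr_ge0// !addr_ge0.
Qed.

Lemma expr_subn2 (r : R) : r ^+ (N - 2) = r ^+ (N - 3) * r.
Proof. by rewrite -exprSr; congr (_ ^+ _); case: N N3 => [|[|[|n]]]//; rewrite !subSS !subn0. Qed.

Variable a : R.
Hypothesis a01 : 0 < a < 1.

(** The coefficient of the Newtonian kernel at stage n, up to constants: the mean of 1/(q (K-1)),
    where K-1 is the normalisation of the uniform law. It involves neither x nor t. *)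
Definition kapn n := chainE a n (fun m => (qscale a n * (m.-1)%:R)^-1).

(** Condition on the state m, put y = q (m-1) and multiply by s r^(N-2). The atom is an error of
    order (r / sqrt s) y^(-3/2). The uniform part is 1/y times a Riemann sum of mesh s q over
    [e, e + s y], equal to c up to the tail (r / sqrt s) y^(-1/2), the missing piece [0, e] and the
    discretisation error. The total is affine in [Y m], whose mean is at most 8. *)
Lemma mix_kernel_est : exists K c : R, 0 < K /\ forall n (r s e : R), 0 < r -> 0 < s -> 0 < e ->
  `|s * r ^+ (N - 2) * mixE a n (fun j => gv N (e + s * (qscale a n * j%:R)) r) - (1 - a) * kapn n * c|
  <= K * (r / Num.sqrt s + e ^+ 2 * r ^- 4 + s * r ^+ (N - 2) * qscale a n * A e).
Proof.
have /andP[a0 a1] := a01.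
have [C3 C30 h3] := @gv_le_32 R N N3.
have [C2 C20 h2] := @gvP_small R N N3.
have [c [C [C0 hc]]] := @gvP_limit R N N3.
pose K : R := 32 * (C3 + C) + 33 * (C2 + 2).
exists K, c; split; first by rewrite /K; lra.
move=> n r s e r0 s0 e0.
set q := qscale a n; have q0 : 0 < q := qscale_gt0 a n.
have h0 : 0 < s * q by rewrite mulr_gt0.
pose f (j : nat) := gv N (e + s * (q * j%:R)) r.
have rN : 0 < r ^+ (N - 2) by rewrite exprn_gt0.
have ss : 0 < Num.sqrt s by rewrite sqrtr_gt0.
(* The first term bounds the missing integral over [0, e], by [gvP_small]; the second is the Riemann
   sum error, the total variation being at most 2 A(e). *)
pose D : R := C2 * (e ^+ 2 * r ^- 4) + 2 * (s * r ^+ (N - 2) * q * A e).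
have D0 : 0 <= D.
  rewrite addr_ge0// !mulr_ge0 ?A_ge0 ?sqr_ge0 ?invr_ge0 ?exprn_ge0 ?(ltW C20) ?(ltW s0) ?(ltW q0)// ltW//.
pose rs := r / Num.sqrt s; have rs0 : 0 < rs by rewrite divr_gt0.
pose Y (m : nat) := (q * m%:R * Num.sqrt (q * m%:R))^-1.
have pt m : (2 <= m <= n.+2)%N ->
   `|s * r ^+ (N - 2) * (a * f m + (1 - a) * ((m.-1)%:R^-1 * \sum_(1 <= j < m) f j))
     - (1 - a) * c * (q * (m.-1)%:R)^-1| <= 4 * (rs * (C3 + C) + D) * Y m + D.
  case: m => // -[//|k] _; rewrite [k.+2.-1]/=.
  have k0 : (0 : R) < k.+1%:R by rewrite ltr0n.
  set y := q * k.+1%:R; have y0 : 0 < y by rewrite mulr_gt0.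
  have sy : 0 < Num.sqrt y by rewrite sqrtr_gt0.
  have sy0 : 0 < s * y by rewrite mulr_gt0.
  (* The sum runs up to m-1 = k+1 while the moment bound concerns m = k+2; as m <= 2 (m-1), passing
     from one to the other costs the factor 4. *)
  have y2 : q * k.+2%:R <= 2 * y.
    by have := ler_wpM2l (ltW q0) (natr_succ_le_double k); rewrite (mulrCA q 2).
  have qk0 : 0 < q * k.+2%:R by rewrite mulr_gt0// ltr0n.
  have Y1 : (y * Num.sqrt y)^-1 <= 4 * Y k.+2 by exact: powm32_le2.
  have y1 : y^-1 <= 1 + 4 * Y k.+2.
    by apply: le_trans (inv_le_powm32 y0) _; rewrite lerD2l.
  have Y0 : 0 <= Y k.+2 by rewrite invr_ge0 mulr_ge0 ?sqrtr_ge0// ltW.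
  have t1 : s * r ^+ (N - 2) * f k.+2 <= rs * C3 * (y * Num.sqrt y)^-1.
    have vp : 0 < e + s * (q * k.+2%:R) by rewrite addr_gt0// mulr_gt0.
    have sv : s * y <= e + s * (q * k.+2%:R).
      apply: le_trans (_ : s * (q * k.+2%:R) <= _); last by rewrite lerDr ltW.
      by rewrite ler_wpM2l ?(ltW s0)// ler_wpM2l ?(ltW q0)// ler_nat.
    apply: le_trans (ler_wpM2l _ (h3 _ _ vp r0)) _; first exact: mulr_ge0 (ltW s0) (ltW rN).
    rewrite expr_subn2; have k3 : 0 < r ^+ (N - 3) by rewrite exprn_gt0.
    have vv : ((e + s * (q * k.+2%:R)) * Num.sqrt (e + s * (q * k.+2%:R)))^-1 <= (s * y * Num.sqrt (s * y))^-1.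
      rewrite lef_pV2 ?posrE ?mulr_gt0 ?sqrtr_gt0//.
      by apply: ler_pM; rewrite ?sqrtr_ge0 ?(ltW sy0)// ler_wsqrtr.
    have k1 : 0 <= C3 * r ^- (N - 3) by rewrite mulr_ge0 ?(ltW C30)// invr_ge0 ltW.
    have k2 : 0 <= s * (r ^+ (N - 3) * r) by rewrite mulr_ge0 ?(ltW s0)// mulr_ge0 ?(ltW k3)// ltW.
    apply: le_trans (ler_wpM2l k2 (ler_wpM2l k1 vv)) _.
    rewrite (sqrtrM _ (ltW s0)) /rs le_eqVlt; apply/orP; left; apply/eqP.
    by field; rewrite !gt_eqF.
  have t2 : `|r ^+ (N - 2) * (s * q * \sum_(1 <= j < k.+2) f j) - c| <= rs * C / Num.sqrt y + D.
    have := riemann_gv k.+1 r0 e0 h0.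
    have -> : \sum_(1 <= j < k.+2) gv N (e + s * q * j%:R) r = \sum_(1 <= j < k.+2) f j.
      by apply: eq_bigr => j _; rewrite /f mulrA.
    set S := s * q * _; set V := e + s * q * k.+1%:R => hS.
    have VE : V = e + s * y by rewrite /V /y mulrA.
    have V0 : 0 < V by rewrite VE addr_gt0.
    have {}hS : `|S - (gvPr r V - gvPr r e)| <= s * q * (2 * A e).
      apply: le_trans hS _; rewrite ler_wpM2l ?(ltW h0)//.
      by apply: variation_le; rewrite ?A_ge0 ?E_ge0 ?E_le1.
    have r2 : 0 < r ^+ 2 by rewrite exprn_gt0.
    have P1 : r ^+ (N - 2) * gvPr r V = gvP N (V / r ^+ 2) by rewrite /gvPr mulVKf// gt_eqF.
    have P2 : r ^+ (N - 2) * gvPr r e = gvP N (e / r ^+ 2) by rewrite /gvPr mulVKf// gt_eqF.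
    have [cl cu] := hc _ (divr_gt0 V0 r2).
    have p0 := gvP_ge0 N3 (e / r ^+ 2); have pe := h2 _ (divr_gt0 e0 r2).
    have sqV : C / Num.sqrt (V / r ^+ 2) <= rs * C / Num.sqrt y.
      have -> : Num.sqrt (V / r ^+ 2) = Num.sqrt V / r.
        by rewrite sqrtrM ?ltW// sqrtrV ?sqr_ge0// sqrtr_sqr gtr0_norm.
      have -> : rs * C / Num.sqrt y = C * (r / Num.sqrt (s * y)).
        by rewrite (sqrtrM _ (ltW s0)) /rs; field; rewrite !gt_eqF.
      rewrite invf_div ler_wpM2l ?(ltW C0)// ler_wpM2l ?(ltW r0)//.
      by rewrite lef_pV2 ?posrE ?sqrtr_gt0// ler_wsqrtr// VE lerDr ltW.
    have De : C2 * (e / r ^+ 2) ^+ 2 = C2 * (e ^+ 2 * r ^- 4) by rewrite expr_div_n -exprM.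
    have hS' : `|r ^+ (N - 2) * S - (gvP N (V / r ^+ 2) - gvP N (e / r ^+ 2))| <= 2 * (s * r ^+ (N - 2) * q * A e).
      rewrite -P1 -P2 -mulrBr -mulrBr normrM (gtr0_norm rN).
      apply: le_trans (ler_wpM2l (ltW rN) hS) _.
      by rewrite le_eqVlt; apply/orP; left; apply/eqP; ring.
    move: hS' cl cu p0 pe sqV; rewrite De /D.
    move: (r ^+ (N - 2) * S) (gvP N _) (gvP N _) (C / Num.sqrt (_ / _)) (rs * C / _) (C2 * _) (2 * _).
    move=> X1 X2 X3 X4 X5 X6 X7; rewrite !ler_norml => /andP[? ?] ? ? ? ? ?; apply/andP; split; lra.
  have -> : s * r ^+ (N - 2) * (a * f k.+2 + (1 - a) * (k.+1%:R^-1 * \sum_(1 <= j < k.+2) f j)) - (1 - a) * c * y^-1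
   = a * (s * r ^+ (N - 2) * f k.+2) + (1 - a) * (y^-1 * (r ^+ (N - 2) * (s * q * \sum_(1 <= j < k.+2) f j) - c)).
    by rewrite /y; field; rewrite !gt_eqF.
  have fp : 0 <= s * r ^+ (N - 2) * f k.+2.
    apply: mulr_ge0; first exact: mulr_ge0 (ltW s0) (ltW rN).
    by apply/ltW/gv_gt0; rewrite addr_gt0// mulr_gt0.
  have a1' : 0 <= 1 - a by lra.
  apply: le_trans (ler_normD _ _) _.
  rewrite (ger0_norm (mulr_ge0 (ltW a0) fp)) normrM (ger0_norm a1') normrM (gtr0_norm (_ : 0 < y^-1)) ?invr_gt0//.
  have yi : 0 <= y^-1 by rewrite invr_ge0 ltW.
  have t3 := ler_wpM2l yi t2.
  have t3E : y^-1 * (rs * C / Num.sqrt y + D) = rs * C * (y * Num.sqrt y)^-1 + y^-1 * D.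
    by field; rewrite !gt_eqF.
  have u1 : rs * C3 * (y * Num.sqrt y)^-1 <= rs * C3 * (4 * Y k.+2).
    by apply: ler_wpM2l => //; apply: mulr_ge0; apply: ltW.
  have u2 : rs * C * (y * Num.sqrt y)^-1 <= rs * C * (4 * Y k.+2).
    by apply: ler_wpM2l => //; apply: mulr_ge0; apply: ltW.
  have u3 : y^-1 * D <= (1 + 4 * Y k.+2) * D by rewrite ler_wpM2r.
  have w1 : a * (s * r ^+ (N - 2) * f k.+2) <= s * r ^+ (N - 2) * f k.+2 by rewrite ler_piMl// ltW.
  have w2 : (1 - a) * (y^-1 * `|r ^+ (N - 2) * (s * q * \sum_(1 <= j < k.+2) f j) - c|) <=
     y^-1 * `|r ^+ (N - 2) * (s * q * \sum_(1 <= j < k.+2) f j) - c| by rewrite ler_piMl ?mulr_ge0//; lra.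
  have -> : 4 * (rs * (C3 + C) + D) * Y k.+2 + D =
    rs * C3 * (4 * Y k.+2) + rs * C * (4 * Y k.+2) + (1 + 4 * Y k.+2) * D by ring.
  apply: le_trans (lerD (le_trans w1 (le_trans t1 u1)) (le_trans w2 t3)) _.
  rewrite t3E -addrA lerD2l lerD//.
have -> : s * r ^+ (N - 2) * mixE a n (fun j => gv N (e + s * (q * j%:R)) r) - (1 - a) * kapn n * c =
  chainE a n (fun m => s * r ^+ (N - 2) * (a * f m + (1 - a) * ((m.-1)%:R^-1 * \sum_(1 <= j < m) f j))
     - (1 - a) * c * (q * (m.-1)%:R)^-1).
  by rewrite chainEB !chainEZ /mixE /kapn -/q; congr (_ - _); ring.
apply: le_trans (norm_chainE a01 _ _) _.
apply: le_trans (le_chainE a01 pt) _.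
rewrite chainED chainEZ chainE_cst.
have EY := chain_neg_moment a01 n; rewrite -/q in EY.
have k4 : 0 <= 4 * (rs * (C3 + C) + D).
  by rewrite mulr_ge0// addr_ge0// mulr_ge0 ?(ltW rs0)// addr_ge0 ?(ltW C30) ?(ltW C0).
apply: le_trans (lerD (ler_wpM2l k4 EY) (lexx D)) _.
have z1 : 0 <= e ^+ 2 * r ^- 4 by rewrite mulr_ge0 ?sqr_ge0// invr_ge0 exprn_ge0// ltW.
have z2 : 0 <= s * r ^+ (N - 2) * q * A e by rewrite !mulr_ge0 ?A_ge0 ?(ltW s0) ?(ltW rN) ?(ltW q0).
by rewrite -/rs /K /D; apply: mix_kernel_bound; rewrite // ltW.
Qed.
End mixture_kernel.

(** * Comparison of Z with the Newtonian kernel *)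

Section expansion_at_origin.
Context {R : realType}.
Variables (N : nat) (a : R) (Z : N.-tuple R -> R -> R).
Hypothesis N3 : (3 <= N)%N.
Hypothesis a01 : 0 < a < 1.
Hypothesis hZ : fundamental_solution a Z.

(** The order of the limits matters. First [e] is made small depending on (x,t), for the approximate
    identity and the term e^2 r^-4; then n is made large depending on [e], so that q A(e) is small.
    The quantity [kapn a n * c] does not depend on (x,t). *)
Lemma fundamental_solution_mix : exists K c : R, 0 < K /\
  forall t x (eta : R), 0 < t -> 0 < enorm x -> 0 < eta ->
  \forall n \near \oo, `|t `^ a * enorm x ^+ (N - 2) * Z x t - kapn a n * c| <=
    K * (enorm x / Num.sqrt (t `^ a)) + eta.
Proof.
have [K [c [K0 hK]]] := mix_kernel_est N3 a01.
pose P : R := Num.sqrt pi ^+ N; pose T : R := (2 * pi) ^+ N.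
have P0 : 0 < P by rewrite exprn_gt0// sqrtr_gt0 pi_gt0.
have T0 : 0 < T by rewrite exprn_gt0// mulr_gt0// pi_gt0.
have PT0 : 0 < P / T by rewrite divr_gt0.
(* P / T = (4 pi)^(-N/2) is the factor of the heat kernel omitted from [gv]. *)
exists (P / T * K), (P / T * ((1 - a) * c)); split; first by rewrite mulr_gt0.
move=> t x eta t0 x0 eta0; have [iZ cZ sZ kZ] := hZ t0.
set s := t `^ a; have s0 : 0 < s by rewrite powR_gt0.
set r := enorm x in x0 *.
pose w := s * r ^+ (N - 2); have w0 : 0 < w by rewrite mulr_gt0// exprn_gt0.
pose e1 := eta * T / w / 4; have e10 : 0 < e1 by rewrite !divr_gt0// mulr_gt0.
have [d d0 hd] := gaussian_average_cvg iZ (kZ x x0) e10.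
pose e2 := eta / (4 * (P / T * K * r ^- 4)).
have ptk : 0 < P / T * K := mulr_gt0 PT0 K0.
have pk : 0 < P / T * K * r ^- 4 by rewrite mulr_gt0// invr_gt0 exprn_gt0.
have e20 : 0 < e2 by rewrite divr_gt0// mulr_gt0.
pose e := Num.min (d / 2) (Num.min 1 e2).
have d2 : 0 < d / 2 by rewrite divr_gt0.
have e0 : 0 < e by rewrite !lt_min d2 ltr01 e20.
have ed : e < d by rewrite /e gt_min; apply/orP; left; lra.
have e_1 : e <= 1 by rewrite /e !ge_min lexx !orbT.
have e_2 : e <= e2 by rewrite /e !ge_min lexx !orbT.
have ee : P / T * K * r ^- 4 * e ^+ 2 <= eta / 4.
  have : e ^+ 2 <= e2 by apply: le_trans e_2; rewrite expr2 ler_piMr// ltW.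
  move/(ler_wpM2l (ltW pk))/le_trans; apply; rewrite /e2 le_eqVlt; apply/orP; left; apply/eqP.
  by move: pk => /gt_eqF; move: (_ * r ^- 4) => y y0; field; rewrite y0.
have hd' := hd _ (introT andP (conj e0 ed)).
have mg := mix_gauss_cvg a01 s0 e0 iZ cZ sZ (x := x).
have cq := cvg_qscale a01.
pose B := P / T * K * (w * (Num.sqrt e ^- N)).
have B0 : 0 < B by rewrite mulr_gt0// mulr_gt0// invr_gt0 exprn_gt0// sqrtr_gt0.
have q4 : 0 < eta / (4 * B) by rewrite divr_gt0// mulr_gt0.
near=> n.
have qn : qscale a n <= eta / (4 * B).
  have : `|0 - qscale a n| < eta / (4 * B).
    by near: n; move/cvgrPdist_lt: cq; apply.
  by rewrite sub0r normrN => /ltW; apply: le_trans; apply: ler_norm.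
have mn : `|\int[muN N]_y (Z y t * gam e (vsub x y)) -
    mixE a n (fun j => gam (e + s * (qscale a n * j%:R)) x)| < e1.
  by near: n; move/cvgrPdist_lt: mg; apply.
have hKn := hK n r s e x0 s0 e0.
have gE : mixE a n (fun j => gam (e + s * (qscale a n * j%:R)) x) =
    P * mixE a n (fun j => gv N (e + s * (qscale a n * j%:R)) r).
  rewrite -mixEZ; apply: eq_chainE => m _; rewrite gam_gv//; last first.
    by rewrite ltr_wpDr// mulr_ge0 ?(ltW s0)// mulr_ge0// ltW// qscale_gt0.
  congr (_ + _ * (_ * _)); apply: eq_bigr => j _; rewrite gam_gv//.
  by rewrite ltr_wpDr// mulr_ge0 ?(ltW s0)// mulr_ge0// ltW// qscale_gt0.
rewrite gE in mn; move: mn hd' hKn; rewrite -/w -/r.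
set M := mixE _ _ _; set I := \int[_]_y _ => mn hd' hKn.
have -> : w * Z x t - kapn a n * (P / T * ((1 - a) * c)) =
   w / T * (T * Z x t - P * M) + P / T * (w * M - (1 - a) * kapn a n * c).
  by field; rewrite gt_eqF.
apply: le_trans (ler_normD _ _) _.
have wT0 : 0 < w / T by rewrite divr_gt0.
rewrite (normrM (w / T)) (normrM (P / T)) (gtr0_norm PT0) (gtr0_norm wT0).
have h1 : `|T * Z x t - P * M| <= e1 + e1.
  rewrite distrC (le_trans (ler_distD I _ _))// lerD//.
  by rewrite distrC; exact: ltW.
have h1' : w / T * `|T * Z x t - P * M| <= eta / 2.
  apply: le_trans (ler_wpM2l (ltW (divr_gt0 w0 T0)) h1) _.
  by rewrite /e1 le_eqVlt; apply/orP; left; apply/eqP; field; rewrite !gt_eqF.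
have h2 := ler_wpM2l (ltW PT0) hKn.
have h3 : B * qscale a n <= eta / 4.
  apply: le_trans (ler_wpM2l (ltW B0) qn) _.
  by rewrite le_eqVlt; apply/orP; left; apply/eqP; field; rewrite !gt_eqF.
have h4 : P / T * (K * (r / Num.sqrt s + e ^+ 2 * r ^- 4 + w * qscale a n * Num.sqrt e ^- N)) =
  P / T * K * (r / Num.sqrt s) + P / T * K * r ^- 4 * e ^+ 2 + B * qscale a n.
  by rewrite /B; ring.
rewrite h4 in h2.
move: (w / T * _) (P / T * `|_|) (P / T * K * (r / _)) (P / T * K * _ * _) (B * _) h1' h2 h3 ee.
by move=> y1 y2 y3 y4 y5 *; lra.
Unshelve. all: by end_near. Qed.

Lemma enorm_const_tuple (c : R) : 0 <= c -> enorm [tuple c | i < N] = Num.sqrt N%:R * c.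
Proof.
move=> c0; rewrite /enorm /vdot.
under eq_bigr do rewrite tnth_mktuple.
by rewrite sumr_const card_ord -[_ *+ N]mulr_natl -expr2 (@sqrtrM _ N%:R (c ^+ 2) (ler0n _ N)) sqrtr_sqr ger0_norm.
Qed.

(** For one large n, the same number [kapn a n * c] approximates the rescaled [Z] at (x,t) and at
    (y,1). Taking |y| small brings in kappa, and the n-dependent number cancels between the two
    estimates. *)
Lemma fundamental_solution_newton kappa : kappa_limit Z kappa -> exists2 K : R, 0 < K &
  forall t x, 0 < t -> 0 < enorm x ->
  `|t `^ a * Z x t - kappa * enorm x ^- (N - 2)| <= K * t `^ (- (a / 2)) * enorm x ^- (N - 3).
Proof.
move=> hk; have [K [c [K0 hK]]] := fundamental_solution_mix.
exists K => // t x t0 x0.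
have r20 : 0 < enorm x ^+ (N - 2) by rewrite exprn_gt0.
have key : `|t `^ a * enorm x ^+ (N - 2) * Z x t - kappa| <= K * (enorm x / Num.sqrt (t `^ a)).
  apply/ler_addgt0Pr => eta eta0; have eta5 : 0 < eta / 5 by rewrite divr_gt0.
  have [d d0 hd] := hk _ eta5.
  pose rho := Num.min (d / 2) (eta / 5 / K).
  have rho0 : 0 < rho by rewrite lt_min !divr_gt0.
  have rhod : rho < d by rewrite /rho gt_min; apply/orP; left; lra.
  have rhoK : K * rho <= eta / 5.
    have : rho <= eta / 5 / K by rewrite /rho ge_min lexx orbT.
    by rewrite ler_pdivlMr// mulrC.
  have sN : 0 < Num.sqrt N%:R :> R by rewrite sqrtr_gt0 ltr0n (leq_trans _ N3).
  (* A point of norm exactly [rho], which is small enough both for [kappa_limit] and for the error K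
     |y| at time 1. *)
  pose y : N.-tuple R := [tuple rho / Num.sqrt N%:R | i < N].
  have ny : enorm y = rho.
    by rewrite enorm_const_tuple ?divr_ge0 ?(ltW rho0)// mulrC divfK// gt_eqF.
  have y0 : 0 < enorm y by rewrite ny.
  have hy : `|Z y 1 * enorm y ^+ (N - 2) - kappa| < eta / 5 by apply: hd; rewrite y0 ny.
  near \oo => n.
  have h1 : `|t `^ a * enorm x ^+ (N - 2) * Z x t - kapn a n * c| <=
      K * (enorm x / Num.sqrt (t `^ a)) + eta / 5.
    by near: n; exact: hK.
  have h2 : `|1 `^ a * enorm y ^+ (N - 2) * Z y 1 - kapn a n * c| <=
      K * (enorm y / Num.sqrt (1 `^ a)) + eta / 5.
    by near: n; exact: hK.
  move: h2; rewrite powR1 sqrtr1 divr1 mul1r [_ ^+ _ * Z y 1]mulrC => h2.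
  rewrite ny in h2 hy.
  move: (t `^ a * _ * Z x t) (kapn a n * c) (Z y 1 * _) h1 h2 hy => X1 X2 X3.
  move: (K * (enorm x / _)) (K * rho) rhoK => X4 X5 hX5.
  rewrite !ler_norml ltr_norml => /andP[? ?] /andP[? ?] /andP[? ?]; apply/andP; split; lra.
have -> : t `^ a * Z x t - kappa * enorm x ^- (N - 2) =
   enorm x ^- (N - 2) * (t `^ a * enorm x ^+ (N - 2) * Z x t - kappa).
  by field; rewrite gt_eqF.
rewrite normrM gtr0_norm ?invr_gt0//.
have ri : 0 <= enorm x ^- (N - 2) by rewrite invr_ge0 ltW.
apply: le_trans (ler_wpM2l ri key) _.
have -> : Num.sqrt (t `^ a) = t `^ (a / 2).
  have -> : t `^ a = (t `^ (a / 2)) ^+ 2.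
    by rewrite -powR_mulrn ?powR_ge0// -powRrM divfK.
  by rewrite sqrtr_sqr ger0_norm ?powR_ge0.
rewrite expr_subn2// powRN le_eqVlt; apply/orP; left; apply/eqP.
have := @powR_gt0 _ t (a / 2) t0; move: (t `^ (a / 2)) => p p0.
have : 0 < enorm x ^+ (N - 3) by rewrite exprn_gt0.
move: (enorm x ^+ (N - 3)) => q q0; move: (enorm x) x0 => r r0.
by field; rewrite !gt_eqF.
Unshelve. all: by end_near. Qed.
End expansion_at_origin.

(** * Weak and strong Lebesgue norms *)

Section marcinkiewicz.
Context {R : realType}.
Variable N : nat.
Implicit Types (Om : set (N.-tuple R)) (h : N.-tuple R -> \bar R) (p : R).

Lemma lee_poweR p (x y : \bar R) : 0 <= p -> (0 <= x)%E -> (x <= y)%E -> (poweR x p <= poweR y p)%E.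
Proof.
move=> p0 x0 xy; apply: gt0_ler_poweR => //; rewrite in_itv/= leey andbT//.
exact: le_trans xy.
Qed.

Lemma powR_poweR_inv p (l : R) : 0 < p -> 0 <= l -> poweR (l `^ p)%:E p^-1 = l%:E.
Proof. by move=> p0 l0; rewrite poweR_EFin -powRrM mulfV ?gt_eqF// powRr1. Qed.

Lemma lebN_muN (A : set (N.-tuple R)) : measurable A -> lebN A = muN N A.
Proof.
move=> mA; rewrite /lebN intRN_muN//; last first.
  by apply/measurable_EFinP; exact: measurable_indic.
by rewrite integral_indic// setIT.
Qed.

Lemma measurable_superlevel Om h (l : R) : measurable Om -> measurable_fun setT h ->
  measurable [set x | Om x /\ (l%:E < `|h x|)%E].
Proof.
move=> mOm mh; apply: (measurable_lte mOm) => //.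
by apply: measurable_funTS; exact: measurableT_comp.
Qed.

Lemma LpnormN_muN p Om h : measurable Om -> measurable_fun setT h ->
  LpnormN p Om h = poweR (\int[muN N]_x ((\1_Om x)%:E * poweR `|h x| p)) p^-1.
Proof.
move=> mOm mh; rewrite /LpnormN intRN_muN// => [|x]; last first.
  by rewrite mule_ge0 ?poweR_ge0.
apply: emeasurable_funM; first by apply/measurable_EFinP; exact: measurable_indic.
by apply: (measurableT_comp (measurable_poweR _)); exact: measurableT_comp.
Qed.

Lemma markov_ge0 (S : set (N.-tuple R)) h (l : R) : measurable S -> 0 <= l ->
  (forall x, (0 <= h x)%E) -> measurable_fun setT h -> (forall x, S x -> (l%:E <= h x)%E) ->
  (l%:E * muN N S <= \int[muN N]_x h x)%E.
Proof.
move=> mS l0 h0 mh Sh.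
have -> : muN N S = (\int[muN N]_x (\1_S x)%:E)%E by rewrite integral_indic// setIT.
have mI : measurable_fun setT (\1_S : N.-tuple R -> R) by exact: measurable_indic.
rewrite -ge0_integralZ_real//.
apply: ge0_le_integral => //.
- by move=> x _; rewrite lee_fin mulr_ge0.
- by apply/measurable_EFinP; exact: measurable_funM.
move=> x _; have [xS|xS] := pselect (S x).
  by rewrite indicE mem_set// mulr1 Sh.
by rewrite indicE memNset// mulr0.
Qed.

(** Chebyshev's inequality at every level. *)
Lemma weakLnorm_le_LpnormN p Om h : 0 < p -> measurable Om -> measurable_fun setT h ->
  (weakLnorm p Om h <= LpnormN p Om h)%E.
Proof.
move=> p0 mOm mh; apply: ge_ereal_sup => _ [l /= l0 <-].
have mS := measurable_superlevel l mOm mh.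
set S := [set x | _] in mS *.
rewrite lebN_muN// LpnormN_muN// -(powR_poweR_inv p0 (ltW l0)) -poweRM ?lee_fin ?powR_ge0//.
apply: lee_poweR; rewrite ?invr_ge0 ?(ltW p0) ?mule_ge0 ?lee_fin ?powR_ge0//.
apply: markov_ge0 => //; first exact: powR_ge0.
- by move=> x; rewrite mule_ge0 ?poweR_ge0.
- apply: emeasurable_funM; first by apply/measurable_EFinP; exact: measurable_indic.
  by apply: (measurableT_comp (measurable_poweR _)); exact: measurableT_comp.
move=> x [xOm lx]; rewrite !indicE !mem_set// mul1e -poweR_EFin.
by apply: lee_poweR; rewrite ?(ltW p0) ?lee_fin ?(ltW l0)// ltW.
Qed.

Lemma weakLnorm_ge0 p Om h : (0 <= weakLnorm p Om h)%E.
Proof.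
apply: le_ereal_sup_tmp; exists (1%:E * poweR (lebN [set x | Om x /\ (1%:E < `|h x|)%E]) p^-1)%E.
  by exists 1 => /=; rewrite ?ltr01.
by rewrite mul1e poweR_ge0.
Qed.

Lemma LpnormN_ge0 p Om h : (0 <= LpnormN p Om h)%E.
Proof. exact: poweR_ge0. Qed.
End marcinkiewicz.

(** * Weak-type bound for the Newtonian potential *)

Section newtonian_potential.
Context {R : realType}.
Variable N : nat.
Hypothesis N3 : (3 <= N)%N.
Variable u0 : N.-tuple R -> R.
Hypothesis u0_ge0 : forall x, 0 <= u0 x.
Hypothesis mu0 : measurable_fun setT u0.
Variable A : R.
Hypothesis A0 : 0 < A.
Hypothesis u0A : (\int[muN N]_x (u0 x)%:E <= A%:E)%E.

Let p : R := N%:R / (N%:R - 2).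

Lemma natr_gt2 : 0 < N%:R - 2 :> R.
Proof. by rewrite subr_gt0 ltr_nat. Qed.

Lemma pc_ge1 : 1 <= p.
Proof. by rewrite /p ler_pdivlMr ?natr_gt2// mul1r; lra. Qed.

Lemma newton_potential_conv : newton_potential u0 = conv (@kern R N (N - 2)) u0.
Proof.
apply/funext => x; rewrite conv_comm//; last 2 first.
- exact: measurable_kern.
- by move=> z; exact: kern_ge0.
rewrite /newton_potential intRN_muN//.
- apply/measurable_EFinP; apply: measurable_funM; last exact: measurable_kern.
  by apply: (measurableT_comp mu0); apply: measurable_vsub.
- by move=> y; rewrite lee_fin mulr_ge0// kern_ge0.
Qed.

Lemma measurable_newton_potential : measurable_fun setT (newton_potential u0).
Proof.
rewrite newton_potential_conv; apply: measurable_conv => //; first exact: measurable_kern.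
by move=> z; exact: kern_ge0.
Qed.

Lemma natr_subn2 : (N - 2)%:R = N%:R - 2 :> R.
Proof. by rewrite natrB// ltnW. Qed.

Definition near_kern (r : R) (z : N.-tuple R) : R := \1_(ballO r) z * kern (N - 2) z.

Lemma near_kern_ge0 r z : 0 <= near_kern r z.
Proof. by rewrite mulr_ge0// kern_ge0. Qed.

Lemma measurable_near_kern r : measurable_fun setT (near_kern r).
Proof.
apply: measurable_funM; last exact: measurable_kern.
by apply: measurable_indic; exact: measurable_ballO.
Qed.

Lemma near_kern_integral : exists2 C : R, 0 < C & forall r, 0 < r ->
  (\int[muN N]_z (near_kern r z)%:E <= (C * r ^+ 2)%:E)%E.
Proof.
have k1 : (N - 2)%:R * 1 < N%:R :> R by rewrite mulr1 natr_subn2; lra.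
have [C C0 hC] := kern_ball_integral ltr01 k1.
exists C => // r r0; have := hC r r0.
rewrite mulr1 natr_subn2 [_ - (_ - 2)](_ : _ = 2); last by lra.
have -> : r `^ 2 = r ^+ 2 by rewrite -powR_mulrn// ltW.
apply: le_trans.
apply: ge0_le_integral_real => [|||z]; first exact: measurable_near_kern.
- apply: measurable_funM; first by apply: measurable_indic; exact: measurable_ballO.
  by apply: (measurableT_comp (measurable_powR _)); exact: measurable_kern.
- by move=> z; exact: near_kern_ge0.
- by rewrite powRr1// kern_ge0.
Qed.

(** Outside the ball of radius r the kernel is at most r^(2-N), so only the near part, whose kernel
    is integrable, can be large. *)
Lemma newton_potential_le_near (r : R) x : 0 < r ->
  (newton_potential u0 x <= conv (near_kern r) u0 x + (r ^- (N - 2) * A)%:E)%E.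
Proof.
move=> r0; have ri : 0 <= r ^- (N - 2) by rewrite invr_ge0 exprn_ge0// ltW.
rewrite newton_potential_conv; apply: (@le_trans _ _
  (conv (near_kern r) u0 x + \int[muN N]_y (r ^- (N - 2) * u0 y)%:E)%E); last first.
  by rewrite leeD2l// ge0_integralZ_real// EFinM lee_wpmul2l.
have mn : measurable_fun setT (fun y => near_kern r (vsub x y) * u0 y).
  apply: measurable_funM => //; apply: (measurableT_comp (measurable_near_kern r)).
  exact: measurable_vsub.
rewrite /conv -ge0_integralD_real//; last 3 first.
- exact: measurable_funM.
- by move=> y; rewrite mulr_ge0// near_kern_ge0.
- by move=> y; rewrite mulr_ge0.
apply: ge0_le_integral_real.
- apply: measurable_funM => //; apply: (measurableT_comp (@measurable_kern R N (N - 2))).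
  exact: measurable_vsub.
- by apply: measurable_funD => //; exact: measurable_funM.
- by move=> y; rewrite mulr_ge0// kern_ge0.
move=> y; rewrite -mulrDl ler_wpM2r// /near_kern; set z := vsub x y.
have [zr|zr] := ltP (enorm z) r.
  by rewrite indicE mem_set// mul1r lerDl.
rewrite indicE memNset ?mul0r ?add0r; last by move=> h; move: zr; rewrite leNgt h.
have z0 : 0 < enorm z by exact: lt_le_trans zr.
by rewrite lef_pV2 ?posrE ?exprn_gt0//; apply: lerXn2r; rewrite ?nnegrE ?(ltW z0) ?(ltW r0).
Qed.

(** The radius makes the far part exactly l/2, so the near part is at least l/2 on the set. Markov
    with its L^1 norm, at most A C r^2, gives C (2A/l) r^2 = C (2A/l)^p, because r =
    (2A/l)^(1/(N-2)) and 1 + 2/(N-2) = p. *)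
Lemma superlevel_newton_potential : exists2 C : R, 0 < C & forall l : R, 0 < l ->
  (muN N [set x | (l%:E < newton_potential u0 x)%E] <= (C * (A / l) `^ p)%:E)%E.
Proof.
have [C C0 hC] := near_kern_integral.
exists (C * 2 `^ p); first by rewrite mulr_gt0// powR_gt0.
move=> l l0; have Al : 0 < 2 * A / l by rewrite divr_gt0// mulr_gt0.
pose r : R := (2 * A / l) `^ ((N%:R - 2)^-1); have r0 : 0 < r by rewrite powR_gt0.
have rN : r ^+ (N - 2) = 2 * A / l.
  by rewrite -powR_mulrn ?(ltW r0)// -powRrM natr_subn2 mulVf ?gt_eqF ?natr_gt2// powRr1// ltW.
have r2 : 2 * A / l * r ^+ 2 = (2 * A / l) `^ p.
  rewrite -powR_mulrn ?(ltW r0)// -powRrM -{1}[_ / l]powRr1 ?(ltW Al)// -powRD; last first.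
    by apply/implyP => _; rewrite gt_eqF.
  by congr powR; rewrite /p; field; rewrite gt_eqF ?natr_gt2.
set S := [set x | _].
have mP := measurable_newton_potential.
have mS : measurable S.
  by rewrite /S -[X in measurable X]setTI; exact: (measurable_lte measurableT).
have cf0 x : (0 <= conv (near_kern r) u0 x)%E.
  by apply: integral_ge0 => y _; rewrite lee_fin mulr_ge0// near_kern_ge0.
have mc : measurable_fun setT (conv (near_kern r) u0).
  by apply: measurable_conv => //; [exact: measurable_near_kern|exact: near_kern_ge0].
(* The L^1 convolution bound is [conv_Lp] with exponent 1 on the whole space. *)
have cE : (\int[muN N]_x conv (near_kern r) u0 x <= (A * (C * r ^+ 2))%:E)%E.
  have -> : (\int[muN N]_x conv (near_kern r) u0 x =
      \int[muN N]_x ((\1_setT x)%:E * poweR (conv (near_kern r) u0 x) 1))%E.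
    by apply: eq_integral => x _; rewrite indicT mul1e poweRe1.
  rewrite -{1}(powRr1 (ltW A0)).
  apply: conv_Lp => //; first by rewrite mulr_ge0 ?sqr_ge0// ltW.
  - exact: measurable_near_kern.
  - exact: near_kern_ge0.
  move=> y _; under eq_integral => x _ do rewrite indicT mul1r powRr1 ?near_kern_ge0//.
  rewrite (@integral_vsubr _ N y (fun z => (near_kern r z)%:E)); first exact: hC.
    by apply/measurable_EFinP; exact: measurable_near_kern.
  by move=> z; rewrite lee_fin near_kern_ge0.
have l2 : 0 < l / 2 by rewrite divr_gt0.
have rl : r ^- (N - 2) * A = l / 2 by rewrite rN; field; rewrite !gt_eqF.
have SE x : S x -> ((l / 2)%:E <= conv (near_kern r) u0 x)%E.
  rewrite /S/= => /lt_le_trans/(_ (newton_potential_le_near x r0)); rewrite rl.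
  case: (conv _ _ _) => [c| |] //; last by rewrite leey.
  by rewrite -EFinD lte_fin lee_fin; lra.
have := le_trans (markov_ge0 mS (ltW l2) cf0 mc SE) cE.
rewrite muleC -lee_pdivlMr// => /le_trans; apply; rewrite lee_fin.
have -> : C * 2 `^ p * (A / l) `^ p = C * (2 * A / l) `^ p.
  by rewrite -mulrA -powRM// ?divr_ge0 ?(ltW A0) ?(ltW l0)// mulrA.
by rewrite -r2 le_eqVlt; apply/orP; left; apply/eqP; field; rewrite gt_eqF.
Qed.

Lemma weakLnorm_newton_potential_lty :
  (weakLnorm p [set: N.-tuple R] (newton_potential u0) < +oo)%E.
Proof.
have [C C0 hC] := superlevel_newton_potential.
have p0 : 0 < p by exact: lt_le_trans pc_ge1.
apply: (@le_lt_trans _ _ (C `^ p^-1 * A)%:E); last exact: ltry.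
apply: ge_ereal_sup => _ [l /= l0 <-].
have P0 x : (0 <= newton_potential u0 x)%E.
  by rewrite newton_potential_conv; apply: integral_ge0 => y _; rewrite lee_fin mulr_ge0// kern_ge0.
have -> : [set x | True /\ (l%:E < `|newton_potential u0 x|)%E] =
  [set x | (l%:E < newton_potential u0 x)%E].
  by apply/seteqP; split => x /=; rewrite gee0_abs// => -[].
rewrite lebN_muN; last first.
  rewrite -[X in measurable X]setTI; apply: (measurable_lte measurableT) => //.
  exact: measurable_newton_potential.
apply: le_trans (_ : l%:E * poweR (C * (A / l) `^ p)%:E p^-1 <= _)%E.
  rewrite lee_wpmul2l ?lee_fin ?(ltW l0)//; apply: lee_poweR; rewrite ?invr_ge0 ?(ltW p0)//; exact: hC.
have Al : 0 <= A / l by rewrite divr_ge0 ?(ltW A0) ?(ltW l0).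
rewrite poweR_EFin powRM ?powR_ge0 ?(ltW C0)// -powRrM mulfV ?gt_eqF// powRr1//.
rewrite -EFinM lee_fin le_eqVlt; apply/orP; left; apply/eqP.
by field; rewrite gt_eqF.
Qed.
End newtonian_potential.

(** * From the kernel estimate to the mild solution *)

Section kernel_expansion.
Context {R : realType}.
Variable N : nat.
Hypothesis N3 : (3 <= N)%N.
Variable u0 : N.-tuple R -> R.
Hypothesis u0_ge0 : forall x, 0 <= u0 x.
Hypothesis mu0 : measurable_fun setT u0.
Variable A : R.
Hypothesis A0 : 0 < A.
Hypothesis u0A : (\int[muN N]_x (u0 x)%:E <= A%:E)%E.

Lemma conv_ge0 (k u : N.-tuple R -> R) x : (forall z, 0 <= k z) -> (forall z, 0 <= u z) ->
  (0 <= conv k u x)%E.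
Proof. by move=> k0 v0; apply: integral_ge0 => y _; rewrite lee_fin mulr_ge0. Qed.

Lemma measurable_conv_kern m : measurable_fun setT (conv (@kern R N m) u0).
Proof. by apply: measurable_conv => //; [exact: measurable_kern|move=> z; exact: kern_ge0]. Qed.

Lemma conv_kern_ball_integral m (q : R) : 1 <= q -> m%:R * q < N%:R ->
  exists2 C : R, 0 < C & forall r : R, 0 < r ->
  (\int[muN N]_x ((\1_(ballO r) x)%:E * poweR (conv (@kern R N m) u0 x) q) <=
   (A `^ q * (C * r `^ (N%:R - m%:R * q)))%:E)%E.
Proof.
move=> q1 mq; have q0 : 0 < q by exact: lt_le_trans q1.
have [C C0 hC] := kern_ball_integral_shift q0 mq; exists C => // r r0.
apply: conv_Lp => //.
- by rewrite mulr_ge0 ?powR_ge0// ltW.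
- exact: measurable_ballO.
- exact: measurable_kern.
- by move=> z; exact: kern_ge0.
- by move=> y _; exact: hC.
Qed.

(** Where a potential is infinite, the real-valued integral may be a default value; such points are
    put aside as a null set. *)
Lemma conv_kern_ae_lty m (r : R) : (m < N)%N -> 0 < r ->
  {ae muN N, forall x, ballO r x -> (conv (@kern R N m) u0 x < +oo)%E}.
Proof.
move=> mN r0; have m1 : m%:R * 1 < N%:R :> R by rewrite mulr1 ltr_nat.
have [C C0 hC] := conv_kern_ball_integral (lexx 1) m1.
have mI : measurable_fun setT (\1_(ballO r) : N.-tuple R -> R).
  by apply: measurable_indic; exact: measurable_ballO.
pose f x := ((\1_(ballO r) x)%:E * conv (@kern R N m) u0 x)%E.
have f0 x : (0 <= f x)%E by rewrite mule_ge0 ?lee_fin// conv_ge0// => z; exact: kern_ge0.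
have fi : (muN N).-integrable setT f.
  apply/integrableP; split.
    by apply: emeasurable_funM; [exact/measurable_EFinP|exact: measurable_conv_kern].
  under eq_integral do rewrite gee0_abs//.
  apply: le_lt_trans (ltry _); apply: le_trans (hC r r0).
  rewrite le_eqVlt; apply/orP; left; apply/eqP; apply: eq_integral => x _.
  by rewrite poweRe1// conv_ge0// => z; exact: kern_ge0.
have := integrable_ae measurableT fi.
apply: filterS => x /(_ I) + xB.
rewrite /f indicE mem_set// mul1e ge0_fin_numE// conv_ge0// => z; exact: kern_ge0.
Qed.

Lemma measurable_vsub_preimage (x : N.-tuple R) (S : set (N.-tuple R)) : measurable S ->
  measurable [set y | S (vsub x y)].
Proof.
move=> mS; have mv : measurable_fun setT (fun y => vsub x y).
  by apply: measurable_vsub; [exact: measurable_cst|exact: measurable_id].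
by rewrite -[X in measurable X]setTI; exact: mv.
Qed.

(** A point lies in balls of arbitrarily small measure: 2d <= 1 and 2d <= e give (2d)^N <= e. *)
Lemma muN_center (x : N.-tuple R) : muN N [set y | ~ (0 < enorm (vsub x y))] = 0%E.
Proof.
apply/eqP; rewrite eq_le measure_ge0 andbT; apply/lee_addgt0Pr => e e0; rewrite add0e.
pose d := Num.min e 1 / 2.
have d0 : 0 < d by rewrite divr_gt0// lt_min e0 ltr01.
have d1 : 2 * d <= 1 by rewrite /d mulrC divfK// ge_min lexx orbT.
have de : 2 * d <= e by rewrite /d mulrC divfK// ge_min lexx.
clearbody d.
have mf : measurable_fun setT (fun y => enorm (vsub x y)).
  by apply: (measurableT_comp (@measurable_enorm R N)); apply: measurable_vsub.
have mB := @measurable_ballO R N d.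
have mS : measurable [set y | ballO d (vsub x y)] by exact: measurable_vsub_preimage.
apply: (@le_trans _ _ (muN N [set y | ballO d (vsub x y)])).
  apply: le_measure; rewrite ?inE//; last first.
    by move=> y /= /negP; rewrite -leNgt => h; exact: le_lt_trans d0.
  have -> : [set y | ~ (0 < enorm (vsub x y))] =
      setT `&` (fun y => enorm (vsub x y)) @^-1` `]-oo, 0].
    rewrite setTI; apply/seteqP; split => y /=; rewrite in_itv/= leNgt; by move/negP.
  exact: mf.
have -> : muN N [set y | ballO d (vsub x y)] = muN N (ballO d).
  have muE (B : set (N.-tuple R)) : measurable B ->
      muN N B = (\int[muN N]_y (\1_B y)%:E)%E.
    by move=> mC; rewrite integral_indic// setIT.
  rewrite !muE// -(@integral_vsub _ N x (fun z => (\1_(ballO d) z)%:E))//.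
  by apply/measurable_EFinP; exact: measurable_indic.
apply: le_trans (muN_ball_le N d0) _; rewrite lee_fin; apply: le_trans de.
rewrite -{1}(subnK (leq_trans (isT : (0 < 3)%N) N3)) addn1 exprS ler_piMr ?mulr_ge0 ?(ltW d0)//.
by rewrite exprn_ile1// mulr_ge0 ?(ltW d0).
Qed.

Lemma RintN_ae (f g : N.-tuple R -> R) : measurable_fun setT f -> measurable_fun setT g ->
  {ae muN N, forall x, f x = g x} -> RintN f = RintN g.
Proof.
move=> mf mg fg; rewrite !RintN_muN//.
have mm (k : N.-tuple R -> R) : measurable_fun setT k ->
    measurable_fun setT (fun x => (Num.max (k x) 0)%:E).
  by move=> mk; apply/measurable_EFinP; exact: measurable_maxr.
congr (fine _ - fine _).
  by apply: ae_eq_integral => //; [exact: mm|exact: mm|apply: filterS fg => x /= -> _].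
apply: ae_eq_integral => //.
- by apply: (mm (fun x => - f x)); exact: measurable_funN.
- by apply: (mm (fun x => - g x)); exact: measurable_funN.
- by apply: filterS fg => x /= -> _.
Qed.

Lemma conv_integrable (k : N.-tuple R -> R) x : measurable_fun setT k -> (forall z, 0 <= k z) ->
  (conv k u0 x < +oo)%E -> (muN N).-integrable setT (EFin \o (fun y => k (vsub x y) * u0 y)).
Proof.
move=> mk k0 ?; apply/integrableP; split.
  apply/measurable_EFinP; apply: measurable_funM => //.
  by apply: (measurableT_comp mk); apply: measurable_vsub.
by under eq_integral => y _ do rewrite /= ger0_norm ?mulr_ge0//.
Qed.

Lemma conv_Rintegral (k : N.-tuple R -> R) x : measurable_fun setT k -> (forall z, 0 <= k z) ->
  (conv k u0 x < +oo)%E -> conv k u0 x = (\int[muN N]_y (k (vsub x y) * u0 y))%:E.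
Proof.
move=> mk k0 foo; rewrite /Rintegral fineK// ge0_fin_numE//; exact: conv_ge0.
Qed.

(** The estimate says nothing about [k] at the origin, so [k] is replaced there by 0, which alters
    the integrand on a null set. As [kern (N - 2)] also has value 0 at the origin, the pointwise
    estimate then holds everywhere and can be integrated. *)
Lemma conv_kern_expansion (k : N.-tuple R -> R) (c kappa b : R) x : measurable_fun setT k ->
  0 < c -> 0 <= b ->
  (forall z, 0 < enorm z -> `|c * k z - kappa * kern (N - 2) z| <= b * kern (N - 3) z) ->
  (conv (@kern R N (N - 2)) u0 x < +oo)%E -> (conv (@kern R N (N - 3)) u0 x < +oo)%E ->
  (`|(c * RintN (fun y => k (vsub x y) * u0 y))%:E - kappa%:E * conv (@kern R N (N - 2)) u0 x| <=
   b%:E * conv (@kern R N (N - 3)) u0 x)%E.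
Proof.
move=> mk c0 b0 hk foo2 foo3.
pose S := [set z : N.-tuple R | 0 < enorm z].
have mS : measurable S.
  have -> : S = setT `&` (@enorm R N) @^-1` `]0, +oo[.
    by apply/seteqP; split => y /=; rewrite in_itv/= andbT => // -[].
  exact: measurable_enorm.
pose k' z := k z * \1_S z.
have mk' : measurable_fun setT k' by apply: measurable_funM => //; exact: measurable_indic.
have mv (v : N.-tuple R -> R) : measurable_fun setT v ->
    measurable_fun setT (fun y => v (vsub x y) * u0 y).
  move=> mv; apply: measurable_funM => //; apply: (measurableT_comp mv); exact: measurable_vsub.
pose f y := k' (vsub x y) * u0 y.
pose G y := kern (N - 2) (vsub x y) * u0 y; pose H y := kern (N - 3) (vsub x y) * u0 y.
have iG : (muN N).-integrable setT (EFin \o G).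
  by apply: conv_integrable => //; [exact: measurable_kern|move=> z; exact: kern_ge0].
have iH : (muN N).-integrable setT (EFin \o H).
  by apply: conv_integrable => //; [exact: measurable_kern|move=> z; exact: kern_ge0].
have H0 y : 0 <= H y by rewrite mulr_ge0// kern_ge0.
have -> : RintN (fun y => k (vsub x y) * u0 y) = RintN f.
  apply: RintN_ae; [exact: mv|exact: mv|].
  exists [set y | ~ (0 < enorm (vsub x y))]; split; last 2 first.
  - exact: muN_center.
  - move=> y /= h h0; apply: h; rewrite /f /k' indicE mem_set ?mulr1//.
  by apply: measurableC; exact: (measurable_vsub_preimage x mS).
have hf y : `|c * f y - kappa * G y| <= b * H y.
  have -> : c * f y - kappa * G y = (c * k' (vsub x y) - kappa * kern (N - 2) (vsub x y)) * u0 y.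
    by rewrite /f /G; ring.
  rewrite normrM (ger0_norm (u0_ge0 y)) /H mulrA ler_wpM2r//.
  have [z0|z0] := ltP 0 (enorm (vsub x y)).
    by rewrite /k' indicE mem_set ?mulr1//; exact: hk.
  have zE : enorm (vsub x y) = 0 by apply/eqP; rewrite eq_le z0 enorm_ge0.
  rewrite /k' indicE memNset; last by rewrite /S/= zE ltxx.
  rewrite !mulr0 sub0r normrN {1}/kern zE expr0n subn_eq0 leqNgt N3 invr0 mulr0 normr0.
  by rewrite mulr_ge0// kern_ge0.
(* Integrability is a consequence of the estimate itself: c |f| <= b H + |kappa| G. *)
have if_ : (muN N).-integrable setT (EFin \o f).
  have i2 : (muN N).-integrable setT (EFin \o (fun y => `|kappa| / c * G y + b / c * H y)).
    exact: integrable_lin.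
  apply: le_integrable i2 => //; first by apply/measurable_EFinP; exact: mv.
  move=> y _; rewrite /= lee_fin; apply: le_trans (ler_norm _).
  have G0 : 0 <= G y by rewrite mulr_ge0// kern_ge0.
  rewrite -(ler_pM2l c0) -{1}(gtr0_norm c0) -normrM.
  have -> : c * (`|kappa| / c * G y + b / c * H y) = b * H y + `|kappa| * G y.
    by field; rewrite gt_eqF.
  rewrite -[c * f y](subrK (kappa * G y)).
  apply: le_trans (ler_normD _ _) _; apply: lerD => //.
  by rewrite normrM (ger0_norm G0).
have kg m z : 0 <= @kern R N m z by exact: kern_ge0.
have E2 := conv_Rintegral (@measurable_kern R N (N - 2)) (kg (N - 2)%N) foo2.
have E3 := conv_Rintegral (@measurable_kern R N (N - 3)) (kg (N - 3)%N) foo3.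
rewrite E2 E3 (RintN_Rintegral if_) -!EFinM -EFinB lee_fin.
have -> : c * \int[muN N]_y f y - kappa * \int[muN N]_y G y =
   \int[muN N]_y (c * f y + (- kappa) * G y).
  by rewrite (Rintegral_lin _ _ if_ iG) mulNr.
have icG := integrable_lin c (- kappa) if_ iG.
apply: le_trans (le_normr_Rintegral measurableT icG) _.
have <- : \int[muN N]_y (b * H y) = b * \int[muN N]_y H y by rewrite RintegralZl.
apply: (le_Rintegral measurableT (integrable_norm icG) (integrableZl measurableT b iH)).
by move=> y _ /=; rewrite mulNr.
Qed.
End kernel_expansion.

(** * Local integrability of the Newtonian potential *)

Section local_integrability.
Context {R : realType}.
Variable N : nat.

Lemma poweR_add_le_fin (p b r : R) : 0 < p -> 0 <= b -> 0 <= r ->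
  (poweR (r%:E + b%:E) p <= (2 `^ p)%:E * (poweR r%:E p + (b `^ p)%:E))%E.
Proof.
move=> p0 b0 x0; change (((r + b) `^ p)%:E <= (2 `^ p * (r `^ p + b `^ p))%:E)%E; rewrite lee_fin.
have m0 : 0 <= Num.max r b by rewrite le_max x0.
apply: (@le_trans _ _ ((2 * Num.max r b) `^ p)).
  rewrite ge0_ler_powR ?nnegrE ?(ltW p0) ?addr_ge0 ?mulr_ge0//.
  have h1 : r <= Num.max r b by rewrite le_max lexx.
  have h2 : b <= Num.max r b by rewrite le_max lexx orbT.
  lra.
rewrite powRM// ler_wpM2l ?powR_ge0//.
by case: (leP r b) => _; rewrite ?lerDl ?lerDr powR_ge0.
Qed.

Lemma poweR_add_le (p b : R) (x : \bar R) : 0 < p -> 0 <= b -> (0 <= x)%E ->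
  (poweR (x + b%:E) p <= (2 `^ p)%:E * (poweR x p + (b `^ p)%:E))%E.
Proof.
move=> p0 b0; have p2 : 0 < 2 `^ p :> R by rewrite powR_gt0.
case: x => [r| |] x0; last by move: x0; rewrite leNgt ltNyr.
- move: x0; rewrite lee_fin => x0.
  exact: poweR_add_le_fin.
- by rewrite addye// poweRyr ?gt_eqF// addye// gt0_muley ?leey ?lte_fin.
Qed.

(** The loose factor 2 comes from |x-y|^2 <= 2 |x|^2 + 2 |y|^2, which holds coordinate by
    coordinate. *)
Lemma enorm_vsub_lt (x y : N.-tuple R) (r : R) : enorm x < r -> enorm y < 1 ->
  enorm (vsub x y) < 2 * (r + 1).
Proof.
move=> xr y1; have x0 := enorm_ge0 x; have y0 := enorm_ge0 y.
have r0 : 0 < r by exact: le_lt_trans xr.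
rewrite -(@ltr_pXn2r _ 2) ?nnegrE ?enorm_ge0//; last by rewrite mulr_ge0// addr_ge0// ltW.
have : enorm (vsub x y) ^+ 2 <= 2 * enorm x ^+ 2 + 2 * enorm y ^+ 2.
  rewrite !enorm_sqr !mulr_sumr -big_split/=; apply: ler_sum => i _.
  rewrite tnth_vsub; have := sqr_ge0 (tnth x i + tnth y i).
  by move: (tnth x i) (tnth y i) => u v; rewrite !expr2; lra.
have : enorm x ^+ 2 <= r ^+ 2 by rewrite lerXn2r ?nnegrE ?(ltW xr) ?(ltW r0).
have : enorm y ^+ 2 <= 1 by rewrite expr_le1// ltW.
have -> : (2 * (r + 1)) ^+ 2 = 4 * r ^+ 2 + 8 * r + 4 by ring.
have := sqr_ge0 r; move: (enorm (vsub x y) ^+ 2) (enorm x ^+ 2) (enorm y ^+ 2) (r ^+ 2) r0.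
by move=> a b c d ? *; lra.
Qed.

Hypothesis N3 : (3 <= N)%N.
Variable u0 : N.-tuple R -> R.
Hypothesis u0_ge0 : forall x, 0 <= u0 x.
Hypothesis mu0 : measurable_fun setT u0.
Variable A : R.
Hypothesis A0 : 0 < A.
Hypothesis u0A : (\int[muN N]_x (u0 x)%:E <= A%:E)%E.

Let p : R := N%:R / (N%:R - 2).

Lemma newton_potential_ge0 x : (0 <= newton_potential u0 x)%E.
Proof. by rewrite newton_potential_conv// conv_ge0// => z; exact: kern_ge0. Qed.

(** The roles in [conv_Lp] are exchanged: [near_kern 1] is the integrable weight and [u0] the
    kernel. The weight lives in the unit ball, so for x in the ball of radius r only the values of
    [u0] on the ball of radius 2(r+1) are seen. *)
Lemma near_potential_Lp (r : R) : 0 < r -> LplocN p (fun x => (u0 x)%:E) ->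
  (\int[muN N]_x ((\1_(ballO r) x)%:E * poweR (conv (near_kern 1) u0 x) p) < +oo)%E.
Proof.
move=> r0 [_ hu]; have p1 : 1 <= p := pc_ge1 N3; have p0 : 0 < p by exact: lt_le_trans p1.
have r1 : 0 < 2 * (r + 1) by rewrite mulr_gt0// addr_gt0.
have mB (s : R) : measurable_fun setT (\1_(ballO s) : N.-tuple R -> R).
  by apply: measurable_indic; exact: measurable_ballO.
have mup : measurable_fun setT (fun x => u0 x `^ p).
  exact: (measurableT_comp (measurable_powR _) mu0).
pose J := (\int[muN N]_x (\1_(ballO (2 * (r + 1))) x * u0 x `^ p)%:E)%E.
have J0 : (0 <= J)%E by apply: integral_ge0 => x _; rewrite lee_fin mulr_ge0 ?powR_ge0.
have Joo : (J < +oo)%E.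
  have := hu _ r1; rewrite LpnormN_muN; [|exact: measurable_ballO|exact/measurable_EFinP].
  move/(lty_poweRy (invr_neq0 (lt0r_neq0 p0))); apply: le_lt_trans.
  rewrite le_eqVlt; apply/orP; left; apply/eqP; apply: eq_integral => x _.
  by rewrite gee0_abs ?lee_fin// poweR_EFin.
have [C C0 hC] := near_kern_integral (R := R) N3.
have mn := @measurable_near_kern R N 1; have n0 z : 0 <= near_kern 1 z := @near_kern_ge0 R N 1 z.
apply: (@le_lt_trans _ _ (C `^ p * fine J)%:E); last exact: ltry.
under eq_integral do rewrite conv_comm//.
apply: conv_Lp => //.
- exact: fine_ge0.
- exact: measurable_ballO.
- by have := hC 1 ltr01; rewrite expr1n mulr1.
move=> y ny; rewrite fineK ?ge0_fin_numE//.
have y1 : enorm y < 1.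
  rewrite ltNge; apply/negP => h; move: ny; rewrite /near_kern indicE memNset ?mul0r ?ltxx//.
  by rewrite /ballO/= => h'; move: h; rewrite leNgt h'.
rewrite /J -(@integral_vsubr _ N y (fun z => (\1_(ballO (2 * (r + 1))) z * u0 z `^ p)%:E)); last 2 first.
- by apply/measurable_EFinP; exact: measurable_funM.
- by move=> z; rewrite lee_fin mulr_ge0 ?powR_ge0.
have mv : measurable_fun setT (fun x => vsub x y) by apply: measurable_vsub.
apply: ge0_le_integral_real => [|||x].
- by apply: measurable_funM => //; exact: (measurableT_comp mup mv).
- by apply: measurable_funM; [exact: (measurableT_comp (mB _) mv)|exact: (measurableT_comp mup mv)].
- by move=> x; rewrite mulr_ge0 ?powR_ge0.
rewrite ler_wpM2r ?powR_ge0// !indicE; have [xB|xB] := boolP (x \in _); last by [].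
by rewrite mem_set//; apply: enorm_vsub_lt => //; move: xB; rewrite inE.
Qed.

(** At cutting radius 1 the far part is at most the constant A, which is in L^p of every ball. *)
Lemma Lploc_newton_potential : LplocN p (fun x => (u0 x)%:E) -> LplocN p (newton_potential u0).
Proof.
move=> hu; have mP : measurable_fun setT (newton_potential u0) by exact: measurable_newton_potential.
split=> // r r0; rewrite LpnormN_muN//; last exact: measurable_ballO.
have p1 : 1 <= p := pc_ge1 N3; have p0 : 0 < p by exact: lt_le_trans p1.
apply: poweR_lty.
have mB : measurable_fun setT (\1_(ballO r) : N.-tuple R -> R).
  by apply: measurable_indic; exact: measurable_ballO.
pose F (x : N.-tuple R) := ((\1_(ballO r) x)%:E * poweR (conv (near_kern 1) u0 x) p)%E.
have mF : measurable_fun setT F.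
  apply: emeasurable_funM; first exact/measurable_EFinP.
  apply: (measurableT_comp (measurable_poweR _)); apply: measurable_conv => //.
    exact: measurable_near_kern.
  by move=> z; exact: near_kern_ge0.
have F0 x : (0 <= F x)%E by rewrite mule_ge0 ?lee_fin ?poweR_ge0.
have Foo : (\int[muN N]_x F x < +oo)%E by exact: near_potential_Lp.
pose G (x : N.-tuple R) : \bar R := (A `^ p * \1_(ballO r) x)%:E.
have mG : measurable_fun setT G by apply/measurable_EFinP; exact: measurable_funM.
have G0 x : (0 <= G x)%E by rewrite lee_fin mulr_ge0 ?powR_ge0.
have Goo : (\int[muN N]_x G x < +oo)%E.
  rewrite ge0_integralZ_real ?powR_ge0// integral_indic//; last exact: measurable_ballO.
  by rewrite setIT lte_mul_pinfty ?lee_fin ?powR_ge0// (le_lt_trans (muN_ball_le N r0))// ltry.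
apply: (@le_lt_trans _ _ ((2 `^ p)%:E * (\int[muN N]_x F x + \int[muN N]_x G x))%E); last first.
  by rewrite lte_mul_pinfty ?lee_fin ?powR_ge0// lte_add_pinfty.
rewrite -ge0_integralD// -ge0_integralZl//; last 2 first.
- exact: emeasurable_funD.
- by move=> x _; rewrite adde_ge0.
apply: ge0_le_integral => //.
- by move=> x _; rewrite mule_ge0 ?poweR_ge0.
- apply: emeasurable_funM; first exact/measurable_EFinP.
  by apply: (measurableT_comp (measurable_poweR _)); exact: measurableT_comp.
- by apply: emeasurable_funM => //; exact: emeasurable_funD.
move=> x _; rewrite /F /G indicE.
have [xB|xB] := boolP (x \in _); last first.
  by rewrite !mul0e mulr0 adde0 mule0.
rewrite !mul1e mulr1 gee0_abs ?newton_potential_ge0//.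
have n0 : (0 <= conv (near_kern 1) u0 x)%E by apply: conv_ge0 => // z; exact: near_kern_ge0.
apply: le_trans (poweR_add_le p0 (ltW A0) n0).
apply: lee_poweR; rewrite ?(ltW p0) ?newton_potential_ge0//.
have := newton_potential_le_near u0_ge0 mu0 u0A x ltr01.
by rewrite expr1n invr1 mul1r.
Qed.
End local_integrability.

(** * The strong norm of the rescaled difference on balls *)

Section rescaled_difference.
Context {R : realType}.
Variable N : nat.
Hypothesis N3 : (3 <= N)%N.
Variable u0 : N.-tuple R -> R.
Hypothesis u0_ge0 : forall x, 0 <= u0 x.
Hypothesis mu0 : measurable_fun setT u0.

(** [k] may change sign, so its positive and negative parts are convolved separately; u0 >= 0 lets
    the maximum pass through the product. *)
Lemma measurable_RintN_conv (k : N.-tuple R -> R) : measurable_fun setT k ->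
  measurable_fun setT (fun x => RintN (fun y => k (vsub x y) * u0 y)).
Proof.
move=> mk.
have mM (v : N.-tuple R -> R) : measurable_fun setT v ->
    measurable_fun setT (fun x => fine (conv (fun z => Num.max (v z) 0) u0 x)).
  move=> mv; apply: (measurableT_comp (fine_measurable measurableT)).
  apply: measurable_conv => // [|z]; first exact: measurable_maxr.
  by rewrite le_max lexx orbT.
have E (v : N.-tuple R -> R) x : (\int[muN N]_y (Num.max (v (vsub x y) * u0 y) 0)%:E)%E =
    conv (fun z => Num.max (v z) 0) u0 x.
  by apply: eq_integral => y _; rewrite maxr_pMl// mul0r.
rewrite (_ : (fun x => _) = (fun x => fine (conv (fun z => Num.max (k z) 0) u0 x) -
  fine (conv (fun z => Num.max (- k z) 0) u0 x))).
  by apply: measurable_funB; [exact: mM|apply: (mM (fun z => - k z)); exact: measurable_funN].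
apply/funext => x; rewrite RintN_muN.
  rewrite -E -(E (fun z => - k z)); congr (_ - fine _).
  by apply: eq_integral => y _; rewrite mulNr.
by apply: measurable_funM => //; apply: (measurableT_comp mk); apply: measurable_vsub.
Qed.

Variable A : R.
Hypothesis A0 : 0 < A.
Hypothesis u0A : (\int[muN N]_x (u0 x)%:E <= A%:E)%E.
Variables (a : R) (Z : N.-tuple R -> R -> R) (kappa : R).
Hypothesis a01 : 0 < a < 1.
Hypothesis hZ : fundamental_solution a Z.
Hypothesis hk : kappa_limit Z kappa.

Let p : R := N%:R / (N%:R - 2).
Let h := fun t x =>
  ((t `^ a * mild_solution Z u0 x t)%:E - kappa%:E * newton_potential u0 x)%E.

Lemma measurable_rescaled_difference t : 0 < t -> measurable_fun setT (h t).
Proof.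
move=> t0; have [[mZ _] _ _ _] := hZ t0; apply: emeasurable_funB.
  apply/measurable_EFinP; apply: measurable_funM => //.
  exact: (measurable_RintN_conv mZ).
by apply: emeasurable_funM => //; exact: measurable_newton_potential.
Qed.

(** The identity N - (N-3) p = p makes the integral of the p-th power scale like r^p, so the norm is
    linear in r; with the factor t^(-a/2) of the kernel estimate this gives r / t^(a/2). *)
Lemma rescaled_difference_Lp : exists M : R, forall t r, 0 < t -> 0 < r ->
  (LpnormN p (ballO r) (h t) <= (M * (r / t `^ (a / 2)))%:E)%E.
Proof.
have [K K0 hK] := fundamental_solution_newton N3 a01 hZ hk.
have p1 : 1 <= p := pc_ge1 N3; have p0 : 0 < p by exact: lt_le_trans p1.
have n2 := @natr_gt2 R N N3.
have n3 : (N - 3)%:R = N%:R - 3 :> R by rewrite natrB.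
have pE : N%:R - (N - 3)%:R * p = p by rewrite n3 /p; field; rewrite gt_eqF.
have pN : (N - 3)%:R * p < N%:R by rewrite -subr_gt0 pE.
have [C C0 hC] := conv_kern_ball_integral u0_ge0 mu0 A0 u0A p1 pN.
exists (K * A * C `^ p^-1) => t r t0 r0.
have mh := measurable_rescaled_difference t0.
have tp : 0 < t `^ (a / 2) by rewrite powR_gt0.
pose b := K * t `^ (- (a / 2)); have b0 : 0 < b by rewrite mulr_gt0// powR_gt0.
have mB := @measurable_ballO R N r.
have mI : measurable_fun setT (\1_(ballO r) : N.-tuple R -> R) by exact: measurable_indic.
have [[mZ _] _ _ _] := hZ t0.
have N2 : (N - 2 < N)%N by rewrite ltn_subrL (leq_trans _ N3).
have N1 : (N - 3 < N)%N by rewrite ltn_subrL (leq_trans _ N3).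
have mW := measurable_conv_kern u0_ge0 mu0 (N - 3).
pose W := conv (@kern R N (N - 3)) u0.
have W0 x : (0 <= W x)%E by apply: conv_ge0 => // z; exact: kern_ge0.
have hW : {ae muN N, forall x, ballO r x -> (`|h t x| <= b%:E * W x)%E}.
  have := conv_kern_ae_lty u0_ge0 mu0 A0 u0A N2 r0.
  apply: filterS2 (conv_kern_ae_lty u0_ge0 mu0 A0 u0A N1 r0) => x h3 h2 xB.
  rewrite /h newton_potential_conv//.
  have hb z : 0 < enorm z -> `|t `^ a * Z z t - kappa * kern (N - 2) z| <= b * kern (N - 3) z.
    by move=> z0; exact: hK.
  have ta : 0 < t `^ a by rewrite powR_gt0.
  exact: (conv_kern_expansion N3 u0_ge0 mu0 mZ ta (ltW b0) hb (h2 xB) (h3 xB)).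
have bE : b = K * t `^ (- (a / 2)) by [].
clearbody b.
have mL : measurable_fun setT (fun x => ((\1_(ballO r) x)%:E * poweR (W x) p)%E).
  apply: emeasurable_funM; first exact/measurable_EFinP.
  exact: (measurableT_comp (measurable_poweR _) mW).
have int_le : (\int[muN N]_x ((\1_(ballO r) x)%:E * poweR `|h t x| p) <=
    (b `^ p)%:E * \int[muN N]_x ((\1_(ballO r) x)%:E * poweR (W x) p))%E.
  rewrite -ge0_integralZl//; last 2 first.
  - by move=> x _; rewrite mule_ge0 ?lee_fin ?poweR_ge0.
  - by rewrite lee_fin powR_ge0.
  apply: (@ae_ge0_le_integral _ _ R (muN N) setT measurableT) => //.
  - by move=> x _; rewrite mule_ge0 ?lee_fin ?poweR_ge0.
  - apply: emeasurable_funM; first exact/measurable_EFinP.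
    by apply: (measurableT_comp (measurable_poweR _)); exact: measurableT_comp.
  - by move=> x _; rewrite !mule_ge0 ?lee_fin ?powR_ge0 ?poweR_ge0.
  - by apply: emeasurable_funM => //.
  apply: filterS hW => x hx _; rewrite indicE; have [xB|xB] := boolP (x \in _); last first.
    by rewrite !mul0e mule0.
  rewrite !mul1e -poweR_EFin -poweRM ?lee_fin ?(ltW b0)//.
  by apply: lee_poweR; rewrite ?(ltW p0)//; apply: hx; move: xB; rewrite inE.
have final : (\int[muN N]_x ((\1_(ballO r) x)%:E * poweR `|h t x| p) <=
    ((b * A * C `^ p^-1 * r) `^ p)%:E)%E.
  apply: le_trans int_le _; have bp : (0 <= (b `^ p)%:E)%E by rewrite lee_fin powR_ge0.
  apply: le_trans (lee_wpmul2l bp (hC r r0)) _; rewrite pE -EFinM lee_fin.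
  have c0 : 0 <= C `^ p^-1 by exact: powR_ge0.
  rewrite powRM ?mulr_ge0 ?(ltW b0) ?(ltW A0) ?(ltW r0)// powRM ?mulr_ge0 ?(ltW b0) ?(ltW A0)//.
  rewrite powRM ?(ltW b0) ?(ltW A0)// -powRrM mulVf ?gt_eqF// powRr1 ?(ltW C0)//.
  by rewrite !mulrA.
rewrite LpnormN_muN//; apply: le_trans (_ : poweR ((b * A * C `^ p^-1 * r) `^ p)%:E p^-1 <= _)%E.
  apply: lee_poweR => //; first by rewrite invr_ge0 ltW.
  by apply: integral_ge0 => x _; rewrite mule_ge0 ?lee_fin ?poweR_ge0.
rewrite powR_poweR_inv//; last by rewrite !mulr_ge0 ?powR_ge0 ?(ltW b0) ?(ltW A0) ?(ltW r0).
by rewrite lee_fin bE powRN le_eqVlt; apply/orP; left; apply/eqP; ring.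
Qed.

End rescaled_difference.

Theorem theorem5p4 (R : realType) (N : nat) (a : R)
    (Z : N.-tuple R -> R -> R) (kappa : R)
    (u0 : N.-tuple R -> R) (g : R -> R) :
  (3 <= N)%N -> 0 < a < 1 ->
  fundamental_solution a Z -> kappa_limit Z kappa ->
  (forall x, 0 <= u0 x) -> integrable_RN u0 ->
  (0 < intRN (fun x => (u0 x)%:E))%E ->
  (forall t, 0 < t -> 0 < g t) ->
  g t @[t --> +oo] --> +oo ->
  g t / t `^ (a / 2) @[t --> +oo] --> 0 ->
  let pc : R := N%:R / (N%:R - 2) in
  let Phi := newton_potential u0 in
  let h := fun t x => ((t `^ a * mild_solution Z u0 x t)%:E - kappa%:E * Phi x)%E in
  (* (a) *)
  ((measurable_fun [set: N.-tuple R] Phi /\ (weakLnorm pc [set: N.-tuple R] Phi < +oo)%E) /\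
   weakLnorm pc (ballO (N:=N) (g t)) (h t) @[t --> +oo] --> 0%E) /\
  (* (b) *)
  (LplocN pc (fun x => (u0 x)%:E) ->
   LplocN pc Phi /\
   LpnormN pc (ballO (N:=N) (g t)) (h t) @[t --> +oo] --> 0%E).
Proof.
move=> N3 a01 hZ hk u0_ge0 iu0 u0_gt0 g0 _ gt0 pc Phi h.
have [mu0 u0oo] := iu0.
have u0E : intRN (fun x => (u0 x)%:E) = (\int[muN N]_x (u0 x)%:E)%E.
  by apply: intRN_muN => [|x]; [exact/measurable_EFinP|rewrite lee_fin].
have u0N : intRN (fun x => `|u0 x|%:E) = intRN (fun x => (u0 x)%:E).
  by congr intRN; apply/funext => x; rewrite ger0_norm.
rewrite u0N u0E in u0oo; rewrite u0E in u0_gt0.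
pose A := fine (\int[muN N]_x (u0 x)%:E)%E.
have u0fin : (\int[muN N]_x (u0 x)%:E)%E \is a fin_num by rewrite ge0_fin_numE// ltW.
have A0 : 0 < A by rewrite fine_gt0// u0_gt0 u0oo.
have u0A : (\int[muN N]_x (u0 x)%:E <= A%:E)%E by rewrite fineK.
have pc0 : 0 < pc by exact: lt_le_trans (pc_ge1 N3).
have [M hM] := rescaled_difference_Lp N3 u0_ge0 mu0 A0 u0A a01 hZ hk.
have Mcvg : (M * (g t / t `^ (a / 2)))%:E @[t --> +oo] --> 0%E.
  apply: cvg_EFin; first by near=> t.
  by rewrite -[X in _ --> X](mulr0 M); apply: cvgM => //; exact: cvg_cst.
(* Serves both parts: in (a) the weak norm is squeezed between 0 and this strong norm. *)
have Lcvg : LpnormN pc (ballO (N:=N) (g t)) (h t) @[t --> +oo] --> 0%E.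
  apply: (squeeze_cvge _ (cvg_cst 0%E) Mcvg).
  near=> t; have t0 : 0 < t by near: t; exact: nbhs_pinfty_gt.
  by rewrite LpnormN_ge0/=; apply: hM => //; exact: g0.
split; last by move=> hu; split => //; exact: (Lploc_newton_potential N3 u0_ge0 mu0 A0 u0A hu).
split; first split.
- exact: measurable_newton_potential.
- exact: (weakLnorm_newton_potential_lty N3 u0_ge0 mu0 A0 u0A).
apply: (squeeze_cvge _ (cvg_cst 0%E) Lcvg).
near=> t; have t0 : 0 < t by near: t; exact: nbhs_pinfty_gt.
rewrite weakLnorm_ge0/=; apply: weakLnorm_le_LpnormN => //; first exact: measurable_ballO.
exact: (measurable_rescaled_difference u0_ge0 mu0 kappa hZ t0).
Unshelve. all: by end_near. Qed.
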